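(* The canonical map $\Upsilon\colon BV([0,1]^d)\to CH([0,1]^d)^*$, sending $u$ to the functional $\omega\mapsto\omega(u)$, is an isometric isomorphism of Banach spaces.
   Context: $BV([0,1]^d)$ is the space of $u\in L^1(\mathbb{R}^d)$ with $u=0$ a.e. on $\mathbb{R}^d\setminus[0,1]^d$ and finite total variation $\|Du\|(\mathbb{R}^d)=\sup\{\int u\operatorname{div} w: w\in C^1_c(\mathbb{R}^d;\mathbb{R}^d),\|w\|_\infty\le1\}$, normed by $\|u\|_{BV}=\|Du\|(\mathbb{R}^d)$; $Du$ denotes its distributional gradient, an $\mathbb{R}^d$-valued finite measure. Define $\operatorname{div}\colon C([0,1]^d;\mathbb{R}^d)\to BV([0,1]^d)^*$ by $(\operatorname{div} v)(u)=-\int_{[0,1]^d} v\cdot dDu$. The space of strong charges is $CH([0,1]^d)=\operatorname{im}\operatorname{div}\subset BV([0,1]^d)^*$, equipped with the operator norm of $BV([0,1]^d)^*$ (it is a Banach space). $CH([0,1]^d)^*$ denotes its dual Banach space. *)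

(* Defs.v *)
From HB Require Import structures.
From mathcomp Require Import all_boot all_order all_algebra.
From mathcomp Require Import all_classical all_reals all_analysis.
Set Implicit Arguments. Unset Strict Implicit. Unset Printing Implicit Defensive.
Import Order.TTheory GRing.Theory Num.Theory.
Import numFieldNormedType.Exports.
Local Open Scope classical_set_scope.
Local Open Scope ring_scope.

(** * R^d as the row-vector type 'rV[R]_d, with its Borel sigma-algebra,
      i.e. the sigma-algebra generated by the coordinate maps. *)

Definition rV_display : measure_display -> measure_display.
Proof. exact. Qed.

Section measurable_rV.
Context (R : realType) (d : nat).

Definition rV_coord (i : 'I_d) (x : 'rV[R]_d) : R := x ord0 i.

Let rV_set0 : g_sigma_preimage rV_coord set0.
Proof. exact: sigma_algebra0. Qed.

Let rV_setC A : g_sigma_preimage rV_coord A -> g_sigma_preimage rV_coord (~` A).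
Proof. exact: sigma_algebraC. Qed.

Let rV_bigcup (F : _^nat) : (forall i, g_sigma_preimage rV_coord (F i)) ->
  g_sigma_preimage rV_coord (\bigcup_i (F i)).
Proof. exact: sigma_algebra_bigcup. Qed.

HB.instance Definition _ := @isMeasurable.Build (rV_display default_measure_display)
  'rV[R]_d (g_sigma_preimage rV_coord) rV_set0 rV_setC rV_bigcup.

End measurable_rV.

Section bv.
Context (R : realType) (d : nat).
Local Notation V := 'rV[R]_d.

(** Lebesgue measure on R^d: characterized (uniquely, on the Borel
    sigma-algebra) by its value on closed boxes. *)
Definition rbox (a b : 'I_d -> R) : set V :=
  [set x | forall i, a i <= x ord0 i <= b i].

Definition is_lebesgue_measure (lam : {measure set V -> \bar R}) : Prop :=
  forall a b : 'I_d -> R, (forall i, a i <= b i) ->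
    lam (rbox a b) = (\prod_(i < d) (b i - a i))%:E.

Definition unit_cube : set V := [set x | forall i, 0 <= x ord0 i <= 1].

Definition ebasis (i : 'I_d) : V := delta_mx 0 i.
Definition pderiv (i : 'I_d) (f : V -> R) (x : V) : R := 'D_(ebasis i) f x.

Definition C1c (f : V -> R) : Prop :=
  continuous f /\
  (forall (i : 'I_d) (x : V), derivable f x (ebasis i)) /\
  (forall i : 'I_d, continuous (pderiv i f)) /\
  (exists K : set V, compact K /\ forall x, ~ K x -> f x = 0).

Definition C1c_field (w : V -> V) : Prop :=
  forall j : 'I_d, C1c (fun x => w x ord0 j).

Definition divg (w : V -> V) (x : V) : R :=
  \sum_(i < d) pderiv i (fun y => w y ord0 i) x.

Definition sup_norm_le1 (w : V -> V) : Prop :=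
  forall x, \sum_(j < d) (w x ord0 j) ^+ 2 <= 1.

Variable lam : {measure set V -> \bar R}.

Definition TV_norm (u : V -> R) : \bar R :=
  ereal_sup [set (\int[lam]_x (u x * divg w x)%:E)%E
            | w in [set w | C1c_field w /\ sup_norm_le1 w]].

(** membership in BV([0,1]^d); functions are representatives of L^1 classes *)
Definition isBV (u : V -> R) : Prop :=
  [/\ measurable_fun setT u,
      lam.-integrable setT (EFin \o u),
      {ae lam, forall x, ~ unit_cube x -> u x = 0} &
      (TV_norm u < +oo)%E].

(** (mp i - mn i)_i is a representative of the distributional gradient Du:
    an R^d-valued finite (signed) measure, written as difference of finite
    measures *)
Definition grad_rep (u : V -> R) (mp mn : 'I_d -> {measure set V -> \bar R}) : Prop :=
  (forall i, (mp i setT < +oo)%E /\ (mn i setT < +oo)%E) /\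
  forall (i : 'I_d) (phi : V -> R), C1c phi ->
    (\int[lam]_x (u x * pderiv i phi x)%:E =
     - (\int[mp i]_x (phi x)%:E - \int[mn i]_x (phi x)%:E))%E.

Definition div_action (v : V -> V) (u : V -> R) (r : R) : Prop :=
  exists mp mn, grad_rep u mp mn /\
    (r%:E = - \sum_(i < d) (\int[mp i]_(x in unit_cube) (v x ord0 i)%:E
                          - \int[mn i]_(x in unit_cube) (v x ord0 i)%:E))%E.

(** functionals on BV are represented by maps (V -> R) -> R; only their
    values on BV matter *)
Definition isCH (om : (V -> R) -> R) : Prop :=
  exists v : V -> V, {within unit_cube, continuous v} /\
    forall u, isBV u -> div_action v u (om u).

Definition BVdual_norm (om : (V -> R) -> R) : \bar R :=
  ereal_sup [set `|om u|%:E | u in [set u | isBV u /\ (TV_norm u <= 1)%E]].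

Definition isCHdual (L : ((V -> R) -> R) -> R) : Prop :=
  (forall (a : R) om1 om2, isCH om1 -> isCH om2 ->
     L (fun u => a * om1 u + om2 u) = a * L om1 + L om2) /\
  exists C : R, 0 <= C /\
    forall om, isCH om -> (`|L om|%:E <= C%:E * BVdual_norm om)%E.

Definition CHdual_norm (L : ((V -> R) -> R) -> R) : \bar R :=
  ereal_sup [set `|L om|%:E | om in [set om | isCH om /\ (BVdual_norm om <= 1)%E]].

Definition Upsilon (u : V -> R) : ((V -> R) -> R) -> R := fun om => om u.

End bv.

(* Main.v *)
(** An element of CH is approximated, in the dual norm, by functionals
    [u |-> \int u div w] with [w] a C^1_c field.  This rests on the representation
    of the gradient of a BV function by finite measures carried by the cube (a
    Riesz argument), and yields boundedness, linearity and the isometry.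

    Each tensor B-spline [psi K] of the grid of step [1/n] agrees on the cube with
    a partial derivative of a C^1_c function of size [O(1/n)].  Summing over the
    grid, [|\int u f| <= 4 sup|f| TV(u)] for continuous [f], and every continuous
    function can be tested through CH, which gives injectivity.

    For [L] in CH^*, put [l f := L (u |-> \int u f)] and let [v_n] be the step function
    with value [n^d l(psi K)] on the cell of [K].  The difference between [psi K] on
    the grid of step [1/(2n)] and [2^-d] times its parent spline is the divergence
    of a field; these fields sum to one of size [O(1/n)], so [(v_(2^m))_m] is Cauchy
    in L^1.  Its limit [u] satisfies [\int u f = l f], because
    [\int v_n f] and [l] of the quasi-interpolant of [f] differ by a modulus of
    continuity of [f]; hence [TV(u) <= ||L||] and [L om = om u]. *)
Require Import Defs.
From HB Require Import structures.
From mathcomp Require Import all_boot all_order all_algebra.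
From mathcomp Require Import all_classical all_reals all_analysis.
From mathcomp Require Import measurable_realfun ring lra zify.
Import Order.TTheory GRing.Theory Num.Theory.
Import numFieldNormedType.Exports.
Set Implicit Arguments. Unset Strict Implicit. Unset Printing Implicit Defensive.
Local Open Scope classical_set_scope.
Local Open Scope ring_scope.

(** * Quadratic B-splines and a partition of unity *)

Section spline.
Context {R : realType}.
Implicit Types t s : R.

(** [lam] is given only by its values on boxes, so mollification by convolution, which rests on
    translation invariance and Fubini, is replaced by finite sums of explicit splines. Degree two is
    the least that makes the bumps C^1. A one-dimensional spline of step [1/(2n)] and half its
    parent have equal integrals, so their difference has a compactly supported primitive without any
    subdivision identity. Two features of the definitions shape the proof. A charge is tied to [u]
    by some choice of gradient measures, made anew for each [u] and possibly charging the complement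
    of the cube; even its linearity in [u] has to be derived, from uniform approximation by
    divergence functionals. And [L] is controlled on charges only: a continuous [f] can be fed to it
    once [f] is known to be, on the cube, the divergence of a C^1_c field, which is why spline sums
    stand in for [f]. The constant 4 of the estimates is the side of the cube [[-2, 2]^d] that
    carries the grid. *)

Definition pospart t : R := Num.max t 0.

Lemma pospartP t : (0 <= t /\ pospart t = t) \/ (t <= 0 /\ pospart t = 0).
Proof.
rewrite /pospart; have [t0|t0] := leP t 0; first by right.
by left; rewrite ltW.
Qed.

(** The quadratic remainder bound yields the derivatives of powers of [pospart] at the knot [0] by
    the same inequality as elsewhere. *)
Lemma is_derive_quad (f : R -> R) t l C :
  (forall h, `|h| <= 1 -> `|f (t + h) - f t - l * h| <= C * h ^+ 2) -> is_derive t 1 f l.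
Proof.
move=> H.
have C0 : 0 <= C.
  have := H 1; rewrite normr1 expr1n !mulr1 => /(_ (lexx _)).
  exact: (le_trans (normr_ge0 _)).
have cv : h^-1 *: ((f \o shift t) (h *: 1) - f t) @[h --> 0^'] --> l.
  apply/cvgrPdist_le => /= e e0; near=> h.
  have h0 : h != 0 by near: h; exact: nbhs_dnbhs_neq.
  have h1 : `|h| <= 1 by near: h; apply: dnbhs0_le.
  have he : `|h| <= e / (C + 1) by near: h; apply: dnbhs0_le; rewrite divr_gt0// ltr_wpDl.
  rewrite /= /GRing.scale /= mulr1 (addrC h t).
  have -> : l - h^-1 * (f (t + h) - f t) = - (h^-1 * (f (t + h) - f t - l * h)).
    by field.
  rewrite normrN normrM normfV ler_pdivrMl ?normr_gt0//.
  apply: (le_trans (H _ h1)).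
  rewrite -(real_normK (num_real h)) expr2 mulrCA ler_wpM2l//.
  apply: (le_trans (ler_wpM2l C0 he)).
  rewrite mulrCA ger_pMr// ler_pdivrMr; lra.
apply: DeriveDef; first by apply/cvg_ex; exists l.
by apply/cvg_lim.
Unshelve. all: by end_near. Qed.

Lemma is_derive_pospart2 t : is_derive t 1 (fun s => pospart s ^+ 2) (2 * pospart t).
Proof.
apply: (@is_derive_quad _ _ _ 1) => h _.
have [[? ->]|[? ->]] := pospartP t; have [[? ->]|[? ->]] := pospartP (t + h);
  rewrite mul1r ler_norml; apply/andP; split; nra.
Qed.

Lemma is_derive_pospart3 t : is_derive t 1 (fun s => pospart s ^+ 3) (3 * pospart t ^+ 2).
Proof.
(* For [t] and [t + h] positive the remainder is [h^2 (3 t + h)]; for mixed signs one of [t^2],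
   [(t + h)^2] is at most [h^2], and the other factor is bounded using [|h| <= 1]. *)
apply: (@is_derive_quad _ _ _ (3 * `|t| + 4)) => h.
rewrite ler_norml => /andP[h1 h2].
have nt : t <= `|t| by exact: ler_norm.
have nt' : - t <= `|t| by rewrite -normrN ler_norm.
have [[? ->]|[? ->]] := pospartP t; have [[? ->]|[? ->]] := pospartP (t + h).
- have -> : (t + h) ^+ 3 - t ^+ 3 - 3 * t ^+ 2 * h = h ^+ 2 * (3 * t + h) by ring.
  rewrite mulrC normrM (ger0_norm (sqr_ge0 h)) ler_wpM2r ?sqr_ge0// ler_norml; apply/andP; split; lra.
- have -> : 0 ^+ 3 - t ^+ 3 - 3 * t ^+ 2 * h = t ^+ 2 * (- t - 3 * h) by ring.
  rewrite normrM (ger0_norm (sqr_ge0 t)) mulrC.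
  have th : t ^+ 2 <= h ^+ 2 by nra.
  apply: ler_pM => //; rewrite ?sqr_ge0 // ler_norml; apply/andP; split; lra.
- have -> : (t + h) ^+ 3 - 0 ^+ 3 - 3 * 0 ^+ 2 * h = (t + h) ^+ 2 * (t + h) by ring.
  rewrite normrM (ger0_norm (sqr_ge0 _)) mulrC.
  have th : (t + h) ^+ 2 <= h ^+ 2 by nra.
  apply: ler_pM => //; rewrite ?sqr_ge0 // ler_norml; apply/andP; split; lra.
- rewrite !expr0n/= !mulr0 !mul0r !subr0 normr0 mulr_ge0 ?sqr_ge0//; lra.
Qed.

Lemma continuous_pospart : continuous (pospart : R -> R).
Proof. by move=> t; apply: (@continuous_max _ _ id (cst 0)); [exact: cvg_id|exact: cvg_cst]. Qed.

(* The integral of the hat function on [0, 2]; [istep] and [ibump] are the primitives of [step] and [bump]. *)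
Definition step t : R :=
  (pospart t ^+ 2 - 2 * pospart (t - 1) ^+ 2 + pospart (t - 2) ^+ 2) / 2.
Definition step' t : R := pospart t - 2 * pospart (t - 1) + pospart (t - 2).
Definition istep t : R :=
  (pospart t ^+ 3 - 2 * pospart (t - 1) ^+ 3 + pospart (t - 2) ^+ 3) / 6.
Definition bump t : R := step t - step (t - 1).
Definition bump' t : R := step' t - step' (t - 1).
Definition ibump t : R := istep t - istep (t - 1).

Lemma pospart_ge t : 0 <= t -> pospart t = t.
Proof. by move=> t0; apply/max_idPl. Qed.
Lemma pospart_le t : t <= 0 -> pospart t = 0.
Proof. by move=> t0; apply/max_idPr. Qed.

Lemma is_derive_shift (f : R -> R) a t l :
  is_derive (t - a) 1 f l -> is_derive t 1 (fun s => f (s - a)) l.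
Proof.
move=> fl; have -> : (fun s => f (s - a)) = f \o (fun s => s - a) by [].
have : is_derive t 1 (fun s : R => s - a) (1 - 0) by exact: is_deriveB.
rewrite subr0 => sd.
have := @is_derive1_comp R f (fun s => s - a) t l 1 fl sd.
by rewrite mulr1.
Qed.

Lemma is_derive_step t : is_derive t 1 step (step' t).
Proof.
have d0 := is_derive_pospart2 t.
have d1 := is_derive_shift (is_derive_pospart2 (t - 1)).
have d2 := is_derive_shift (is_derive_pospart2 (t - 2)).
have := is_deriveZ 2^-1 (is_deriveD (is_deriveB d0 (is_deriveZ 2 d1)) d2).
rewrite (_ : _ \*: _ = step); last first.
  by apply/funext => s; rewrite /step mulrC.
by move/is_derive_eq; apply; rewrite /step' /GRing.scale /=; field.
Qed.

Lemma is_derive_istep t : is_derive t 1 istep (step t).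
Proof.
have d0 := is_derive_pospart3 t.
have d1 := is_derive_shift (is_derive_pospart3 (t - 1)).
have d2 := is_derive_shift (is_derive_pospart3 (t - 2)).
have := is_deriveZ 6^-1 (is_deriveD (is_deriveB d0 (is_deriveZ 2 d1)) d2).
rewrite (_ : _ \*: _ = istep); last first.
  by apply/funext => s; rewrite /istep mulrC.
by move/is_derive_eq; apply; rewrite /step /GRing.scale /=; field.
Qed.

Lemma is_derive_bump t : is_derive t 1 bump (bump' t).
Proof.
have d0 := is_derive_step t.
have d1 := is_derive_shift (is_derive_step (t - 1)).
exact: is_deriveB.
Qed.

Lemma is_derive_ibump t : is_derive t 1 ibump (bump t).
Proof.
have d0 := is_derive_istep t.
have d1 := is_derive_shift (is_derive_istep (t - 1)).
exact: is_deriveB.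
Qed.

Lemma continuous_step' : continuous step'.
Proof.
have c a : continuous (fun t : R => pospart (t - a)).
  move=> t; apply: (@continuous_comp _ _ _ (fun s => s - a) pospart).
    by apply: cvgB; [exact: cvg_id|exact: cvg_cst].
  exact: continuous_pospart.
move=> t; apply: cvgD; last exact: c.
apply: cvgB; first exact: continuous_pospart.
by apply: cvgM; [exact: cvg_cst|exact: c].
Qed.

Lemma continuous_bump' : continuous bump'.
Proof.
move=> t; apply: cvgB; first exact: continuous_step'.
apply: (@continuous_comp _ _ _ (fun s => s - 1) step'); last exact: continuous_step'.
by apply: cvgB; [exact: cvg_id|exact: cvg_cst].
Qed.

Ltac pospart_cases :=
  repeat match goal with |- context [pospart ?x] =>
    have [[? ->]|[? ->]] := pospartP x end.

Lemma step_le0 t : t <= 0 -> step t = 0.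
Proof. move=> t0; rewrite /step !pospart_le//; try lra; ring. Qed.

Lemma step_ge2 t : 2 <= t -> step t = 1.
Proof. move=> t0; rewrite /step !pospart_ge//; try lra; field. Qed.

Lemma bump_ge0 t : 0 <= bump t.
Proof. by rewrite /bump /step; pospart_cases; nra. Qed.

Lemma step_itv t : 0 <= step t <= 1.
Proof. by rewrite /step; apply/andP; split; pospart_cases; nra. Qed.

Lemma ibump_itv t : 0 <= ibump t <= 1.
Proof.
have H1 : 1 <= t <= 2 -> [/\ 0 <= (t - 1) ^+ 2 * (2 - t), 0 <= (2 - t) ^+ 2 * (2 * t - 1) & 0 <= (t - 1) ^+ 2].
  by move=> /andP[? ?]; split; rewrite ?mulr_ge0 ?sqr_ge0//; lra.
have H2 : 2 <= t <= 3 -> 0 <= (3 - t) ^+ 3 /\ 0 <= 1 - (3 - t) ^+ 3.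
  move=> /andP[? ?]; split; first by rewrite exprn_ge0//; lra.
  by rewrite subr_ge0 exprn_ile1//; lra.
rewrite /ibump /istep; apply/andP; split; pospart_cases; try lra; try nra.
- have /H1[? ? ?] : 1 <= t <= 2 by apply/andP; split; lra.
  nra.
- have /H1[? ? ?] : 1 <= t <= 2 by apply/andP; split; lra.
  nra.
Qed.

Lemma bump_out t : ~~ (0 < t < 3) -> bump t = 0.
Proof.
rewrite negb_and -!leNgt => /orP[t0|t3]; rewrite /bump.
  by rewrite !step_le0//; lra.
by rewrite !step_ge2//; lra.
Qed.

Lemma ibump_le0 t : t <= 0 -> ibump t = 0.
Proof. move=> t0; rewrite /ibump /istep !pospart_le//; by [lra|ring]. Qed.

Lemma ibump_ge3 t : 3 <= t -> ibump t = 1.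
Proof. move=> t0; rewrite /ibump /istep !pospart_ge//; by [lra|field]. Qed.

End spline.

(** * Calculus of C^1 and C^1_c functions on R^d *)

Section smooth.
Context {R : realType} {d : nat}.
Local Notation V := 'rV[R]_d.
Implicit Types (f g : V -> R).

(** Carries the gradient explicitly, so that sums and products are differentiated by composing
    lemmas; [pderivE] reads off [pderiv] at the end. *)
Definition has_grad f (g : 'I_d -> V -> R) :=
  [/\ continuous f, forall i x, is_derive x (ebasis R i) f (g i x) &
      forall i, continuous (g i)].

Definition compactly_supported f :=
  exists K : set V, compact K /\ forall x, ~ K x -> f x = 0.

Lemma pderivE f (g : 'I_d -> V -> R) i : has_grad f g -> pderiv i f = g i.
Proof. by case=> _ fg _; apply/funext => x; exact: (@derive_val _ _ _ _ _ _ _ (fg i x)). Qed.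

Lemma has_gradP f : C1c f <->
  has_grad f (fun i => pderiv i f) /\ compactly_supported f.
Proof.
split => [[cf [df [cdf cs]]]|[[cf df cdf] cs]].
  by split=> //; split => // i x; apply: DeriveDef.
by split=> //; split => // i x; exact: ex_derive (df i x).
Qed.

Lemma has_grad_C1c f (g : 'I_d -> V -> R) : has_grad f g -> compactly_supported f -> C1c f.
Proof.
move=> fg cs; apply/has_gradP; split => //.
suff -> : (fun i => pderiv i f) = g by [].
by apply/funext => i; exact: pderivE fg.
Qed.

Lemma has_grad_cst c : has_grad (fun=> c) (fun _ _ => 0).
Proof.
split; [exact: cst_continuous|by move=> i x; exact: is_derive_cst|].
by move=> i; exact: cst_continuous.
Qed.

Lemma has_gradD f1 f2 (g1 g2 : 'I_d -> V -> R) : has_grad f1 g1 -> has_grad f2 g2 ->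
  has_grad (fun x => f1 x + f2 x) (fun i x => g1 i x + g2 i x).
Proof.
move=> [c1 d1 cd1] [c2 d2 cd2]; split.
- by move=> x; exact: (cvgD (c1 x) (c2 x)).
- move=> i x; have := d1 i x; have := d2 i x => ? ?; exact: is_deriveD.
- by move=> i x; exact: (cvgD (cd1 i x) (cd2 i x)).
Qed.

Lemma has_gradM f1 f2 (g1 g2 : 'I_d -> V -> R) : has_grad f1 g1 -> has_grad f2 g2 ->
  has_grad (fun x => f1 x * f2 x) (fun i x => f1 x * g2 i x + f2 x * g1 i x).
Proof.
move=> [c1 d1 cd1] [c2 d2 cd2]; split.
- by move=> x; exact: (cvgM (c1 x) (c2 x)).
- move=> i x; have := d1 i x; have := d2 i x => ? ?; exact: is_deriveM.
- by move=> i x; exact: (cvgD (cvgM (c1 x) (cd2 i x)) (cvgM (c2 x) (cd1 i x))).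
Qed.

Lemma has_gradZ a f (g : 'I_d -> V -> R) : has_grad f g ->
  has_grad (fun x => a * f x) (fun i x => a * g i x).
Proof.
move=> [c1 d1 cd1]; split.
- by move=> x; exact: (cvgM (cvg_cst a) (c1 x)).
- move=> i x; have := d1 i x => ?; exact: is_deriveZ.
- by move=> i x; exact: (cvgM (cvg_cst a) (cd1 i x)).
Qed.

Lemma has_grad_sum (I : Type) (r : seq I) (P : pred I) (F : I -> V -> R) G :
  (forall k, has_grad (F k) (G k)) ->
  has_grad (fun x => \sum_(k <- r | P k) F k x) (fun i x => \sum_(k <- r | P k) G k i x).
Proof.
move=> FG; elim: r => [|k r IH].
  move: (has_grad_cst 0); congr has_grad.
    by apply/funext => x; rewrite big_nil.
  by apply/funext => i; apply/funext => x; rewrite big_nil.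
case Pk : (P k).
  have := has_gradD (FG k) IH; congr has_grad.
    by apply/funext => x; rewrite big_cons Pk.
  by apply/funext => i; apply/funext => x; rewrite big_cons Pk.
move: IH; congr has_grad.
  by apply/funext => x; rewrite big_cons Pk.
by apply/funext => i; apply/funext => x; rewrite big_cons Pk.
Qed.

Lemma compactly_supported0 : compactly_supported (fun=> 0).
Proof. by exists set0; split; [exact: compact0|]. Qed.

Lemma compactly_supportedD f1 f2 : compactly_supported f1 -> compactly_supported f2 ->
  compactly_supported (fun x => f1 x + f2 x).
Proof.
move=> [K1 [cK1 K1P]] [K2 [cK2 K2P]]; exists (K1 `|` K2); split; first exact: compactU.
by move=> x /not_orP[k1 k2]; rewrite K1P// K2P// addr0.
Qed.

Lemma compactly_supportedMr f2 f1 : compactly_supported f1 ->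
  compactly_supported (fun x => f1 x * f2 x).
Proof. by move=> [K [cK KP]]; exists K; split=> // x /KP ->; rewrite mul0r. Qed.

Lemma compactly_supported_sum (I : Type) (r : seq I) (P : pred I) (F : I -> V -> R) :
  (forall k, compactly_supported (F k)) ->
  compactly_supported (fun x => \sum_(k <- r | P k) F k x).
Proof.
move=> cs; elim: r => [|k r IH].
  move: compactly_supported0; congr compactly_supported.
  by apply/funext => x; rewrite big_nil.
case Pk : (P k).
  have := compactly_supportedD (cs k) IH; congr compactly_supported.
  by apply/funext => x; rewrite big_cons Pk.
move: IH; congr compactly_supported.
by apply/funext => x; rewrite big_cons Pk.
Qed.

Lemma C1c_linear a f g : C1c f -> C1c g -> C1c (fun x => a * f x + g x).
Proof.
move=> /has_gradP[gf cf] /has_gradP[gg cg].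
apply: has_grad_C1c (has_gradD (has_gradZ a gf) gg) _.
apply: compactly_supportedD => //.
have := compactly_supportedMr (fun=> a) cf; congr compactly_supported.
by apply/funext => x; rewrite mulrC.
Qed.

Lemma pderiv_linear i a f g : C1c f -> C1c g ->
  pderiv i (fun x => a * f x + g x) = fun x => a * pderiv i f x + pderiv i g x.
Proof.
move=> /has_gradP[gf cf] /has_gradP[gg cg].
exact: pderivE i (has_gradD (has_gradZ a gf) gg).
Qed.

Lemma C1c0 : C1c (fun _ : V => 0 : R).
Proof. exact: has_grad_C1c (has_grad_cst 0) compactly_supported0. Qed.

Lemma C1c_sum (I : Type) (r : seq I) (P : pred I) (a : I -> R) (F : I -> V -> R) :
  (forall k, C1c (F k)) -> C1c (fun x => \sum_(k <- r | P k) a k * F k x).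
Proof.
move=> cF; have gF k : has_grad (F k) (fun i => pderiv i (F k)) by have /has_gradP[] := cF k.
apply: has_grad_C1c (has_grad_sum r P (fun k => has_gradZ (a k) (gF k))) _.
apply: compactly_supported_sum => k.
rewrite (_ : (fun _ => _) = fun x => F k x * a k).
  by apply: compactly_supportedMr; have /has_gradP[] := cF k.
by apply/funext => x; rewrite mulrC.
Qed.

Lemma pderiv_sum i (I : Type) (r : seq I) (P : pred I) (a : I -> R) (F : I -> V -> R) :
  (forall k, C1c (F k)) ->
  pderiv i (fun x => \sum_(k <- r | P k) a k * F k x) =
  fun x => \sum_(k <- r | P k) a k * pderiv i (F k) x.
Proof.
move=> cF; have gF k : has_grad (F k) (fun i => pderiv i (F k)) by have /has_gradP[] := cF k.
exact: pderivE i (has_grad_sum r P (fun k => has_gradZ (a k) (gF k))).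
Qed.

Lemma C1cM f g : C1c f -> C1c g -> C1c (fun x => f x * g x).
Proof.
move=> /has_gradP[gf cf] /has_gradP[gg cg].
by apply: has_grad_C1c (has_gradM gf gg) _; exact: compactly_supportedMr.
Qed.

End smooth.

(** * Tensor products of functions of one variable *)

Section tensor.
Context {R : realType} {d : nat}.
Local Notation V := 'rV[R]_d.

Definition tens (f : 'I_d -> R -> R) (x : V) : R := \prod_i f i (x ord0 i).

Definition upd (f : 'I_d -> R -> R) (i : 'I_d) (g : R -> R) : 'I_d -> R -> R :=
  fun k => if k == i then g else f k.

Lemma tensD1 (f : 'I_d -> R -> R) i x :
  tens f x = f i (x ord0 i) * \prod_(k | k != i) f k (x ord0 k).
Proof. by rewrite /tens (bigD1 i). Qed.

Lemma tens_upd (f : 'I_d -> R -> R) i g x :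
  tens (upd f i g) x = g (x ord0 i) * \prod_(k | k != i) f k (x ord0 k).
Proof.
rewrite (tensD1 _ i) /upd eqxx; congr (_ * _).
by apply: eq_bigr => k /negPf ->.
Qed.

Lemma tens_continuous (f : 'I_d -> R -> R) :
  (forall i, continuous (f i)) -> continuous (tens f).
Proof.
move=> cf; apply: continuous_big => [|i _ x]; first exact: mul_continuous.
apply: (@continuous_comp _ _ _ (fun y : V => y ord0 i) (f i)); last exact: cf.
exact: coord_continuous.
Qed.

(** The directional difference quotient of [f] at [x] is literally that of the one-variable slice at
    [0]. *)
Lemma is_derive_slice (f : V -> R) i x (g : R -> R) l :
  (forall h, f (h *: ebasis R i + x) = g h) -> is_derive (0 : R) 1 g l ->
  is_derive x (ebasis R i) f l.
Proof.
move=> fg [gd gl].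
have E : (fun h : R => h^-1 *: ((f \o shift x) (h *: ebasis R i) - f x)) =
         (fun h : R => h^-1 *: ((g \o shift 0) (h *: 1) - g 0)).
  apply/funext => h /=; rewrite fg -(fg 0) scale0r add0r addr0; congr (_ *: (g _ - _)).
  by rewrite /GRing.scale /= mulr1.
by apply: DeriveDef; [rewrite /derivable E|rewrite /derive E].
Qed.

Lemma is_derive_tens (f : 'I_d -> R -> R) i (x : V) g l :
  is_derive (x ord0 i) 1 g l ->
  is_derive x (ebasis R i) (tens (upd f i g)) (tens (upd f i (fun=> l)) x).
Proof.
move=> gl; pose P := \prod_(k | k != i) f k (x ord0 k).
have sl : is_derive (0 : R) 1 (fun h => P * g (h + x ord0 i)) (P * l).
  apply: is_deriveZ.
  have := @is_derive_shift R g (- x ord0 i) 0 l.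
  rewrite opprK add0r; exact.
have := is_derive_slice _ sl; rewrite tens_upd mulrC; apply => h.
rewrite tens_upd mulrC; congr (_ * _).
  apply: eq_bigr => k ki; congr (f k _).
  by rewrite !mxE (negPf ki) mulr0 add0r.
by rewrite !mxE !eqxx mulr1.
Qed.

Definition C1_1 (f f' : R -> R) := (forall t : R, is_derive t (1 : R) f (f' t)) /\ continuous f'.

Lemma C1_1_continuous f f' : C1_1 f f' -> continuous f.
Proof.
move=> [df _] t; apply: differentiable_continuous; apply/derivable1_diffP.
by have [] := df t.
Qed.

Lemma upd_id (f : 'I_d -> R -> R) i : upd f i (f i) = f.
Proof. by apply/funext => k; rewrite /upd; case: eqP => [->|]. Qed.

Lemma has_grad_tens (f f' : 'I_d -> R -> R) :
  (forall i, C1_1 (f i) (f' i)) -> has_grad (tens f) (fun i => tens (upd f i (f' i))).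
Proof.
move=> cf; split.
- by apply: tens_continuous => i; exact: C1_1_continuous (cf i).
- move=> i x; have [df _] := cf i.
  have := @is_derive_tens f i x _ _ (df (x ord0 i)).
  by rewrite upd_id !tens_upd.
- move=> i; apply: tens_continuous => k; rewrite /upd; case: eqP => [_|_].
    by have [] := cf i.
  exact: C1_1_continuous (cf k).
Qed.

Lemma tens_compactly_supported (f : 'I_d -> R -> R) a b :
  (forall i t, ~~ (a <= t <= b) -> f i t = 0) -> compactly_supported (tens f).
Proof.
move=> f0; exists [set x : V | forall i, `[a, b]%classic (x ord0 i)]; split.
  by apply: (@rV_compact _ _ (fun=> `[a, b]%classic)) => i; exact: segment_compact.
move=> x /existsNP[i /negP xi]; rewrite (tensD1 _ i) f0 ?mul0r//.
Qed.

Lemma C1c_tens (f f' : 'I_d -> R -> R) a b : (forall i, C1_1 (f i) (f' i)) ->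
  (forall i t, ~~ (a <= t <= b) -> f i t = 0) -> C1c (tens f).
Proof.
move=> cf f0; apply: has_grad_C1c (has_grad_tens cf) _.
exact: tens_compactly_supported f0.
Qed.

Lemma pderiv_tens (f f' : 'I_d -> R -> R) i : (forall i, C1_1 (f i) (f' i)) ->
  pderiv i (tens f) = tens (upd f i (f' i)).
Proof. by move=> cf; exact: pderivE i (has_grad_tens cf). Qed.

End tensor.

Section partition_of_unity.
Context {R : realType} {d : nat}.
Local Notation V := 'rV[R]_d.
Local Notation cube := (@unit_cube R d).
Implicit Types (x y : V) (n : nat).

(** Supported in [[k/n - 2, (k + 3)/n - 2]]. The offset 2 makes [n (t + 2) >= 2] for [t >= 0] and
    [n >= 1], so no spline is missing at the left end of [[0, 1]]. *)
Definition psi1 n (k : nat) (t : R) : R := bump (n%:R * (t + 2) - k%:R).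
Definition psi1' n (k : nat) (t : R) : R := n%:R * bump' (n%:R * (t + 2) - k%:R).

Lemma is_derive_affine (f : R -> R) (c a b l t : R) :
  is_derive (c * (t + a) - b) 1 f l ->
  is_derive t 1 (fun s => f (c * (s + a) - b)) (c * l).
Proof.
move=> fl.
have gd : is_derive t 1 (fun s : R => c * (s + a) - b) c.
  have h1 : is_derive t 1 (fun s : R => s + a) (1 + 0) by exact: is_deriveD.
  have h2 : is_derive t 1 (fun s : R => c * (s + a)) (c * (1 + 0)) by exact: is_deriveZ.
  have : is_derive t 1 (fun s : R => c * (s + a) - b) (c * (1 + 0) - 0) by exact: is_deriveB.
  by rewrite addr0 subr0 mulr1.
have := @is_derive1_comp R f (fun s => c * (s + a) - b) t l c fl gd.
by rewrite mulrC.
Qed.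

Lemma continuous_affine (f : R -> R) (c a b : R) :
  continuous f -> continuous (fun s => f (c * (s + a) - b)).
Proof.
move=> cf t; apply: (@continuous_comp _ _ _ (fun s => c * (s + a) - b) f); last exact: cf.
have h1 : (fun s : R => s + a) @ t --> t + a by exact: (cvgD cvg_id (cvg_cst a)).
exact: (cvgB (cvgM (cvg_cst c) h1) (cvg_cst b)).
Qed.

Lemma C1_1_psi1 n k : C1_1 (psi1 n k) (psi1' n k).
Proof.
split=> [t|]; first by apply: is_derive_affine; exact: is_derive_bump.
move=> t; have h := @continuous_affine _ n%:R 2 k%:R continuous_bump' t.
exact: (cvgM (cvg_cst (n%:R : R)) h).
Qed.

Lemma psi1_ge0 n k t : 0 <= psi1 n k t.
Proof. exact: bump_ge0. Qed.

Lemma psi1_neq0 n k t : psi1 n k t != 0 -> 0 < n%:R * (t + 2) - k%:R < 3.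
Proof. by apply: contraNT => /bump_out; rewrite /psi1 => ->. Qed.

(** [bump] is a difference of consecutive translates of [step], so the sum telescopes. *)
Lemma psi1_sum n m t : \sum_(k < m) psi1 n k t =
  step (n%:R * (t + 2)) - step (n%:R * (t + 2) - m%:R).
Proof.
set s := n%:R * (t + 2).
have -> : step s - step (s - m%:R) = - step (s - m%:R) - - step (s - 0%:R).
  by rewrite subr0 opprK addrC.
rewrite -(@telescope_sumr R 0 m (fun k => - step (s - k%:R)))// big_mkord.
apply: eq_bigr => k _; rewrite /psi1 -/s /bump opprK addrC; congr (- step _ + _).
by rewrite -natr1; ring.
Qed.

Lemma psi1_sum_itv n m t : 0 <= \sum_(k < m) psi1 n k t <= 1.
Proof.
rewrite sumr_ge0 => [|k _]; last exact: psi1_ge0.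
rewrite psi1_sum; have /andP[_ h1] := step_itv (n%:R * (t + 2)).
have /andP[h2 _] := step_itv (n%:R * (t + 2) - m%:R); lra.
Qed.

Lemma psi1_sum1 n t : (0 < n)%N -> 0 <= t <= 1 -> \sum_(k < 4 * n) psi1 n k t = 1.
Proof.
move=> n0 /andP[t0 t1]; have n1 : 1 <= n%:R :> R by rewrite ler1n.
rewrite psi1_sum natrM step_ge2; last by nra.
by rewrite step_le0 ?subr0//; nra.
Qed.

(* Cells of side [1/n] in the cube [-2, 2]^d: large enough for all splines meeting the unit cube. *)
Definition grid n := {ffun 'I_d -> 'I_(4 * n)}.

Definition psi n (K : grid n) : V -> R := tens (fun i => psi1 n (K i)).

Lemma psi_ge0 n (K : grid n) x : 0 <= psi K x.
Proof. by apply: prodr_ge0 => i _; exact: psi1_ge0. Qed.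

Lemma psi_sum n x : \sum_(K : grid n) psi K x = \prod_i \sum_(k < 4 * n) psi1 n k (x ord0 i).
Proof. by rewrite bigA_distr_bigA. Qed.

Lemma psi_sum_le1 n x : \sum_(K : grid n) psi K x <= 1.
Proof. by rewrite psi_sum prodr_ile1 => [|i _]//; exact: psi1_sum_itv. Qed.

Lemma psi_sum1 n x : (0 < n)%N -> cube x -> \sum_(K : grid n) psi K x = 1.
Proof. by move=> n0 cx; rewrite psi_sum big1// => i _; rewrite psi1_sum1// cx. Qed.

Lemma psi_neq0 n (K : grid n) x : psi K x != 0 ->
  forall i, 0 < n%:R * (x ord0 i + 2) - (K i)%:R < 3.
Proof.
move=> Kx i; apply: psi1_neq0; apply: contra_neq Kx.
by rewrite /psi (tensD1 _ i) => ->; rewrite mul0r.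
Qed.

Lemma psi_near n (K : grid n) x y i : (0 < n)%N -> psi K x != 0 -> psi K y != 0 ->
  `|x ord0 i - y ord0 i| <= 3 / n%:R.
Proof.
move=> n0 /psi_neq0/(_ i)/andP[x1 x2] /psi_neq0/(_ i)/andP[y1 y2].
have n1 : 0 < n%:R :> R by rewrite ltr0n.
rewrite ler_pdivlMr// -(gtr0_norm n1) -normrM.
by rewrite ler_norml; apply/andP; split; lra.
Qed.

Lemma psi_C1c n (K : grid n) : C1c (psi K).
Proof.
have [n0|n0] := posnP n; rewrite /psi.
  apply: (@C1c_tens _ _ _ _ 0 0 (fun i => C1_1_psi1 _ _)) => i t _.
  by exfalso; have := leq_ltn_trans (leq0n _) (ltn_ord (K i)); rewrite n0 muln0.
apply: (@C1c_tens _ _ _ _ (-2) 5 (fun i => C1_1_psi1 _ _)) => i t.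
apply: contraNeq => /psi1_neq0 /andP[h1 h2].
have n1 : 1 <= n%:R :> R by rewrite ler1n.
have k1 : (K i)%:R + 1 <= 4 * n%:R :> R.
  by rewrite -natrM natr1 ler_nat.
have k0 : 0 <= (K i)%:R :> R by [].
apply/andP; split; nra.
Qed.

(** Splines missing the cube are discarded: the others have a sample point in the cube, and they
    still sum to 1 there. *)
Definition touch n (K : grid n) : bool := `[< exists x, cube x /\ psi K x != 0 >].
(* Junk value 0 when the support of [psi K] misses the cube. *)
Definition pt n (K : grid n) : V := xget 0 [set x | cube x /\ psi K x != 0].

Lemma cube0 : cube 0.
Proof. by move=> i; rewrite mxE lexx ler01. Qed.

Lemma pt_cube n (K : grid n) : cube (pt K).
Proof. by rewrite /pt; case: xgetP => [x _ []|_]//; exact: cube0. Qed.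

Lemma pt_neq0 n (K : grid n) : touch K -> psi K (pt K) != 0.
Proof. by move/asboolP => [x xP]; rewrite /pt; case: xgetP => [y _ []//|/(_ x)]. Qed.

Lemma touchN n (K : grid n) x : ~~ touch K -> cube x -> psi K x = 0.
Proof. by move=> /asboolP Kx cx; apply: contra_notP Kx => /eqP ?; exists x. Qed.

Definition psit n x := \sum_(K : grid n | touch K) psi K x.
(** Quasi-interpolant: it depends only on values of [f] in the cube, and a bound on these holds for
    it on all of R^d ([approx_bound]). *)
Definition approx n (f : V -> R) x := \sum_(K : grid n | touch K) f (pt K) * psi K x.

Lemma psit_itv n x : 0 <= psit n x <= 1.
Proof.
rewrite sumr_ge0 => [|K _]; last exact: psi_ge0.
apply: le_trans (psi_sum_le1 n x).
by rewrite [leRHS](bigID (@touch n)) /= lerDl sumr_ge0// => K _; exact: psi_ge0.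
Qed.

Lemma psit1 n x : (0 < n)%N -> cube x -> psit n x = 1.
Proof.
move=> n0 cx; rewrite -(psi_sum1 n0 cx) [RHS](bigID (@touch n)) /= [X in _ + X]big1 ?addr0//.
by move=> K tK; exact: touchN.
Qed.

Lemma psit_C1c n : C1c (psit n).
Proof.
have := C1c_sum (index_enum (grid n)) (@touch n) (fun=> 1) (@psi_C1c n).
congr C1c; apply/funext => x; apply: eq_bigr => K _; exact: mul1r.
Qed.

Lemma approx_C1c n f : C1c (approx n f).
Proof.
exact: (C1c_sum (index_enum (grid n)) (@touch n) (fun K => f (pt K)) (@psi_C1c n)).
Qed.

Lemma weighted_bound n (c : grid n -> R) (M : R) x : 0 <= M ->
  (forall K, touch K -> psi K x != 0 -> `|c K| <= M) ->
  `|\sum_(K : grid n | touch K) c K * psi K x| <= M.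
Proof.
move=> M0 cM; apply: (le_trans (ler_norm_sum _ _ _)).
apply: (@le_trans _ _ (M * psit n x)); last first.
  by rewrite ler_piMr//; have /andP[] := psit_itv n x.
rewrite mulr_sumr; apply: ler_sum => K tK; rewrite normrM (ger0_norm (psi_ge0 _ _)).
have [->|p0] := eqVneq (psi K x) 0; first by rewrite !mulr0.
by rewrite ler_wpM2r ?psi_ge0// cM.
Qed.

Lemma approx_bound n f M x : (forall y, cube y -> `|f y| <= M) -> `|approx n f x| <= M.
Proof.
move=> fM; apply: weighted_bound => [|K _ _]; last exact/fM/pt_cube.
exact: le_trans (fM _ cube0).
Qed.

(** [S] is the whole space when the estimate must hold everywhere, as for the Riesz functional, and
    the cube when [f] is continuous only there. Off the cube the weights need not sum to 1, whence
    the factor [psit]. *)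
Lemma approx_close (S : set V) n f eta : (0 < n)%N -> 0 <= eta ->
  (forall x y, S x -> cube y -> (forall i, `|x ord0 i - y ord0 i| <= 3 / n%:R) ->
     `|f x - f y| <= eta) ->
  forall x, S x -> `|f x * psit n x - approx n f x| <= eta.
Proof.
move=> n0 eta0 mod x Sx.
have -> : f x * psit n x - approx n f x =
    \sum_(K : grid n | touch K) (f x - f (pt K)) * psi K x.
  by rewrite mulr_sumr -sumrB; apply: eq_bigr => K _; rewrite mulrBl.
apply: weighted_bound => // K tK p0; apply: mod => //; first exact: pt_cube.
by move=> i; exact: (@psi_near n K x (pt K) i n0 p0 (pt_neq0 tK)).
Qed.

Lemma cube_compact : compact cube.
Proof.
have -> : cube = [set x : V | forall i, `[0%R, 1%R]%classic (x ord0 i)].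
  by apply/seteqP; split => x /= H i; have := H i; rewrite in_itv.
apply: (@rV_compact R d (fun=> `[0%R, 1%R]%classic)) => i; exact: segment_compact.
Qed.

(** Heine's argument with only the second point in the compact cube; the first ranges over [S], so
    [S = setT] gives uniform continuity across the boundary as well. *)
Lemma cube_modulus (S : set V) (f : V -> R) : cube `<=` S ->
  (forall y, cube y -> f @ within S (nbhs y) --> f y) ->
  forall eta, 0 < eta -> exists2 del, 0 < del & forall x y, S x -> cube y ->
    (forall i, `|x ord0 i - y ord0 i| <= del) -> `|f x - f y| <= eta.
Proof.
move=> cS cf eta eta0.
have /compact_near_coveringP nc := cube_compact.
pose P (del : R) (y : V) := cube y -> forall x, S x ->
  (forall i, `|x ord0 i - y ord0 i| <= del) -> `|f x - f y| <= eta.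
have := nc R (at_right 0) P _; have FF : Filter ((0 : R)^'+) by apply: at_right_proper_filter.
move=> /(_ FF) H.
have {}H : \forall del \near (0 : R)^'+, cube `<=` P del.
  apply: H => y0 cy0.
  have /cvgrPdist_lt/(_ (eta / 2)) := cf y0 cy0; rewrite divr_gt0// => /(_ isT).
  rewrite near_withinE => /nbhs_ballP[e /= e0 ball_e].
  exists (ball y0 (e / 2), [set del : R | 0 < del < e / 2]) => /=.
    split; first by apply: nbhsx_ballx; rewrite divr_gt0.
    near=> del; apply/andP; split; first by near: del; exact: nbhs_right_gt.
    by near: del; apply: nbhs_right_lt; rewrite divr_gt0.
  move=> [y del] /= [[_ y0y] /andP[del0 dele]] cy x Sx xy.
  have bx : ball y0 e x.
    split=> // i j; rewrite ord1; have := y0y ord0 j; rewrite /ball /= => h.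
    have := xy j => h'.
    rewrite (_ : y0 ord0 j - x ord0 j = (y0 ord0 j - y ord0 j) - (x ord0 j - y ord0 j)); last by ring.
    by rewrite (le_lt_trans (ler_normB _ _))//; lra.
  have by0 : ball y0 e y.
    by split=> // i j; apply: le_ball (y0y i j); lra.
  have := ball_e _ bx Sx; have := ball_e _ by0 (cS _ cy) => h1 h2.
  rewrite (_ : f x - f y = (f y0 - f y) - (f y0 - f x)); last by ring.
  by rewrite (le_trans (ler_normB _ _))//; lra.
have [del [del0 dP]] : exists del : R, 0 < del /\ cube `<=` P del.
  have : \forall del \near (0 : R)^'+, 0 < del /\ cube `<=` P del.
    by near=> del; split; near: del; [exact: nbhs_right_gt|exact: H].
  by move/filter_ex.
by exists del => // x y Sx cy; exact: dP.
Unshelve. all: by end_near. Qed.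

End partition_of_unity.

(** * Borel sets of R^d *)

Section borel.
Context {R : realType} {d : nat}.
Local Notation V := 'rV[R]_d.
Local Notation cube := (@unit_cube R d).
Implicit Types (x y : V).

Lemma measurable_coord i : measurable_fun setT (fun x : V => x ord0 i).
Proof.
move=> _ A mA; rewrite setTI; apply: sub_sigma_algebra.
by rewrite (bigD1 i)//=; left; exists A => //; rewrite setTI.
Qed.

Lemma measurable_fun_rV d' (T : measurableType d') (f : T -> V) :
  (forall i, measurable_fun setT (fun t => f t ord0 i)) -> measurable_fun setT f.
Proof.
move=> mf _ A; rewrite setTI; move: A.
apply: (@smallest_sub _ _ _ [set A | measurable (f @^-1` A)]).
  split => /=.
  - by rewrite preimage_set0; exact: measurable0.
  - by move=> A mA; rewrite setTD preimage_setC; exact: measurableC.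
  - by move=> F mF; rewrite preimage_bigcup; exact: bigcupT_measurable.
move=> A; elim/big_rec : _ => [//|i B _ IH [[C mC <-]|]]; last exact: IH.
rewrite setTI /=; have := mf i measurableT C mC; rewrite setTI; exact.
Qed.

Definition obox (a b : 'I_d -> R) : set V := [set x | forall i, a i < x ord0 i < b i].

Lemma measurable_coords (B : 'I_d -> set R) : (forall i, measurable (B i)) ->
  measurable [set x : V | forall i, B i (x ord0 i)].
Proof.
move=> mB; have -> : [set x : V | forall i, B i (x ord0 i)] =
    \bigcap_(i in [set: 'I_d]) [set x : V | B i (x ord0 i)].
  by apply/seteqP; split => x /= H i => [_|]; exact: H.
apply: fin_bigcap_measurable => // i _.
by have := measurable_coord i measurableT (mB i); rewrite setTI.
Qed.

Lemma measurable_obox a b : measurable (obox a b).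
Proof.
have -> : obox a b = [set x | forall i, `]a i, b i[%classic (x ord0 i)].
  by apply/seteqP; split => x /= H i; have := H i; rewrite in_itv.
by apply: (@measurable_coords (fun i => `]a i, b i[%classic)) => i; exact: measurable_itv.
Qed.

Lemma measurable_cube : measurable cube.
Proof.
have -> : cube = [set x | forall i, `[0%R, 1%R]%classic (x ord0 i)].
  by apply/seteqP; split => x /= H i; have := H i; rewrite in_itv.
by apply: (@measurable_coords (fun=> `[0%R, 1%R]%classic)) => i; exact: measurable_itv.
Qed.

(* Every open set is the union of the countably many dyadic cells it contains. *)
Lemma open_measurable_rV (U : set V) : open U -> measurable U.
Proof.
move=> oU.
pose cell (p : nat * {ffun 'I_d -> int}) : set V :=
  [set x | forall i, (p.2 i)%:~R <= p.1.+1%:R * x ord0 i < (p.2 i + 1)%:~R].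
have mcell p : measurable (cell p).
  have -> : cell p = [set x | forall i, [set t | (p.2 i)%:~R <= p.1.+1%:R * t < (p.2 i + 1)%:~R] (x ord0 i)].
    by [].
  apply: (@measurable_coords (fun i => [set t : R | (p.2 i)%:~R <= p.1.+1%:R * t < (p.2 i + 1)%:~R])) => i.
  have -> : [set t | (p.2 i)%:~R <= p.1.+1%:R * t < (p.2 i + 1)%:~R] =
      `[(p.2 i)%:~R / p.1.+1%:R, (p.2 i + 1)%:~R / p.1.+1%:R[%classic :> set R.
    by apply/seteqP; split => t /=; rewrite in_itv/= ler_pdivrMr// ltr_pdivlMr// [t * _]mulrC.
  exact: measurable_itv.
have -> : U = \bigcup_p (if `[< cell p `<=` U >] then cell p else set0).
  apply/seteqP; split => [x Ux|x [p _]]; last by case: asboolP => // cU; exact: cU.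
  have /nbhs_ballP[e /= e0 eU] : nbhs x U by exact: open_nbhs_nbhs.
  pose n := (Num.truncn e^-1).
  have ne : n.+1%:R^-1 < e.
    by rewrite invf_plt ?posrE// truncnS_gt.
  exists (n, [ffun i => Num.floor (n.+1%:R * x ord0 i)]) => //.
  have cx : cell (n, [ffun i => Num.floor (n.+1%:R * x ord0 i)]) x.
    by move=> i; rewrite /= ffunE floor_itv.
  case: asboolP => // -[] y cy; apply: eU; split => // i j; rewrite ord1.
  have := cx j; have := cy j; rewrite /= ffunE => /andP[h1 h2] /andP[h3 h4].
  rewrite /ball /=; apply: lt_trans ne.
  rewrite -(@ltr_pM2l _ n.+1%:R)// divff ?pnatr_eq0//.
  rewrite -[X in X * _]ger0_norm// -normrM ltr_norml.
  by move: h2 h4; rewrite intrD => h2 h4; apply/andP; split; lra.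
apply: countable_bigcupT_measurable => // p.
by case: ifP.
Qed.

Lemma continuous_measurable_rV (f : V -> R) : continuous f -> measurable_fun setT f.
Proof.
move=> /continuousP cf; apply: (measurability _ (measurable_realfun.RGenOpens.measurableE R)) => //.
move=> _ [_ [a [b ->]] <-]; rewrite setTI.
by apply: open_measurable_rV; apply: cf; exact: interval_open.
Qed.

End borel.

(** * Finite measures are determined by their integrals of C^1_c functions *)

Section measure_uniqueness.
Context {R : realType} {d : nat}.
Local Notation V := 'rV[R]_d.

(** A C^1 cutoff of [(a, b)]: for [c > 0] it vanishes outside and its flanks have width [2/c], so it
    tends to the indicator as [c] grows. *)
Definition plateau (a b c t : R) : R :=
  step (c * (t + - a) - 0) * step (- c * (t + - b) - 0).

Lemma C1_1_plateau a b c : C1_1 (plateau a b c)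
  (fun t => step (c * (t + - a) - 0) * (- c * step' (- c * (t + - b) - 0)) +
            step (- c * (t + - b) - 0) * (c * step' (c * (t + - a) - 0))).
Proof.
have C k e : C1_1 (fun t : R => step (k * (t + e) - 0)) (fun t => k * step' (k * (t + e) - 0)).
  split=> [t|t]; first by apply: is_derive_affine; exact: is_derive_step.
  have h := @continuous_affine R _ k e 0 continuous_step' t.
  exact: (cvgM (cvg_cst k) h).
have [d1 c1'] := C c (- a); have [d2 c2'] := C (- c) (- b).
have c1 := C1_1_continuous (C c (- a)); have c2 := C1_1_continuous (C (- c) (- b)).
split=> t; first by have := d1 t; have := d2 t => ? ?; exact: is_deriveM.
exact: (cvgD (cvgM (c1 t) (c2' t)) (cvgM (c2 t) (c1' t))).
Qed.

Lemma plateau_itv a b c t : 0 <= plateau a b c t <= 1.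
Proof.
rewrite /plateau; have /andP[h1 h2] := step_itv (c * (t + - a) - 0).
have /andP[h3 h4] := step_itv (- c * (t + - b) - 0).
by rewrite mulr_ge0//= mulr_ile1.
Qed.

Lemma plateau0 a b c t : 0 <= c -> ~~ (a < t < b) -> plateau a b c t = 0.
Proof.
rewrite negb_and -!leNgt => c0 /orP[h|h]; rewrite /plateau.
  by rewrite step_le0 ?mul0r//; nra.
by rewrite mulrC step_le0 ?mul0r//; nra.
Qed.

Lemma plateau1 a b c t : 2 <= c * (t - a) -> 2 <= c * (b - t) -> plateau a b c t = 1.
Proof. by move=> h1 h2; rewrite /plateau !step_ge2 ?mulr1//; nra. Qed.

Lemma plateau_cvg a b t : a < t < b -> \forall n \near \oo, plateau a b n%:R t = 1.
Proof.
move=> /andP[ta tb]; near=> n; apply: plateau1.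
  rewrite -ler_pdivrMr ?subr_gt0//; near: n; exact: nbhs_infty_ger.
rewrite -ler_pdivrMr ?subr_gt0//; near: n; exact: nbhs_infty_ger.
Unshelve. all: by end_near. Qed.

Definition boxfun (a b : 'I_d -> R) n : V -> R := tens (fun i => plateau (a i) (b i) n%:R).

Lemma boxfun_C1c a b n : C1c (boxfun a b n).
Proof.
(* One interval containing all [(a i, b i)], since [C1c_tens] asks for bounds common to all
   coordinates. *)
pose lo := - \sum_i `|a i|; pose hi := \sum_i `|b i|.
apply: (@C1c_tens _ _ _ _ lo hi (fun i => C1_1_plateau _ _ _)) => i t.
move=> h; apply: plateau0 => //; apply: contra h => /andP[h1 h2].
have sum_ge (F : 'I_d -> R) : `|F i| <= \sum_k `|F k|.
  by rewrite (bigD1 i)//= lerDl sumr_ge0.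
have := sum_ge a; have := sum_ge b; rewrite -/hi.
have := ler_norm (b i); have := ler_norm (- a i); rewrite normrN /lo => *.
by apply/andP; split; lra.
Qed.

Lemma boxfun_itv a b n x : 0 <= boxfun a b n x <= 1.
Proof.
rewrite prodr_ge0 => [|i _]; last by have /andP[] := plateau_itv (a i) (b i) n%:R (x ord0 i).
by rewrite prodr_ile1// => i _; exact: plateau_itv.
Qed.

Lemma boxfun_cvg a b x : (boxfun a b n x)%:E @[n --> \oo] --> (\1_(obox a b) x : R)%:E.
Proof.
have [xab|xab] := pselect (obox a b x).
  rewrite indicE mem_set//; apply: cvg_near_cst.
  have H : \forall n \near \oo, forall i, plateau (a i) (b i) n%:R (x ord0 i) = 1.
    by apply: filter_forall => i; exact: plateau_cvg.
  apply: filterS H => n Hn.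
  by congr EFin; rewrite /boxfun /tens big1// => i _; exact: Hn.
rewrite indicE memNset//; apply: cvg_near_cst; near=> n.
have /existsNP[i /negP xi] := xab.
by rewrite /boxfun (tensD1 _ i) plateau0 ?mul0r.
Unshelve. all: by end_near. Qed.

Definition oboxes : set (set V) := [set A | exists a b, A = obox a b].

Lemma measurable_oboxes : @measurable _ V `<=` <<s oboxes >>.
Proof.
apply: smallest_sub; first exact: smallest_sigma_algebra.
move=> A; elim/big_rec : _ => [//|i B _ IH [[C mC <-]|]]; last exact: IH.
rewrite setTI; pose T := g_sigma_algebraType oboxes.
have : measurable_fun setT (fun x : T => (x : V) ord0 i).
  apply: (measurability _ (measurable_realfun.RGenOInfty.measurableE R)) => //.
  move=> _ [_ [r ->] <-]; rewrite setTI.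
  (* A half-space is the union of growing open boxes cut at [r] in coordinate [i]. *)
  have -> : (fun x : T => (x : V) ord0 i) @^-1` `]r, +oo[%classic =
     \bigcup_k obox (fun j => if j == i then r else - k%:R) (fun=> k%:R).
    apply/seteqP; split => x /=.
      rewrite in_itv/= andbT => rx.
      pose M := \sum_j `|x ord0 j|.
      have xM j : `|x ord0 j| <= M by rewrite /M (bigD1 j)//= lerDl sumr_ge0.
      exists (Num.truncn M).+1 => // j.
      have Mt := truncnS_gt M.
      have := xM j; rewrite ler_norml => /andP[h1 h2].
      rewrite (le_lt_trans h2 Mt) andbT; case: eqP => [->//|_].
      by rewrite (lt_le_trans _ h1)// ltrN2.
    by move=> [k _ /(_ i)]; rewrite eqxx in_itv/= andbT => /andP[].
  apply: bigcupT_measurable => k; apply: sub_sigma_algebra; by eexists; eexists.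
by move=> /(_ measurableT C mC); rewrite setTI.
Qed.

(** Open boxes form a pi-system generating the Borel sets, and the boxes [(-k, k)^d], of finite
    mass, exhaust the space. *)
Lemma measure_eq_obox (m1 m2 : {measure set V -> \bar R}) :
  (m1 setT < +oo)%E -> (forall a b, m1 (obox a b) = m2 (obox a b)) ->
  forall A, measurable A -> m1 A = m2 A.
Proof.
move=> m1oo m12 A mA.
apply: (@g_sigma_algebra_measure_unique _ _ _ oboxes _ (fun k => obox (fun=> - k%:R) (fun=> k%:R))).
- by move=> _ [a [b ->]]; exact: measurable_obox.
- by move=> k; eexists; eexists.
- apply/seteqP; split => x // _.
  pose M := \sum_j `|x ord0 j|.
  have xM j : `|x ord0 j| <= M by rewrite /M (bigD1 j)//= lerDl sumr_ge0.
  exists (Num.truncn M).+1 => // j.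
  have Mt := truncnS_gt M.
  have := xM j; rewrite ler_norml => /andP[h1 h2].
  by rewrite (le_lt_trans h2 Mt) andbT (lt_le_trans _ h1)// ltrN2.
- move=> _ _ [a [b ->]] [a' [b' ->]].
  exists (fun i => Num.max (a i) (a' i)), (fun i => Num.min (b i) (b' i)).
  apply/seteqP; split => x /=.
    move=> [h h'] i; have /andP[h1 h2] := h i; have /andP[h3 h4] := h' i.
    by rewrite gt_max lt_min h1 h2 h3 h4.
  move=> h; split => i; have := h i; rewrite gt_max lt_min.
    by move=> /andP[/andP[-> _] /andP[-> _]].
  by move=> /andP[/andP[_ ->] /andP[_ ->]].
- by move=> _ [a [b ->]].
- move=> k; apply: le_lt_trans m1oo; apply: le_measure; rewrite ?inE//; exact: measurable_obox.
- exact: measurable_oboxes.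
Qed.

Lemma measurable_boxfun a b n : measurable_fun [set: V] (boxfun a b n).
Proof. by apply: continuous_measurable_rV; have [] := boxfun_C1c a b n. Qed.

(** The functions [boxfun a b n] lie between 0 and 1 and converge to the indicator of the open box,
    so dominated convergence gives equal masses of boxes. *)
Lemma measure_eq_C1c (m1 m2 : {measure set V -> \bar R}) :
  (m1 setT < +oo)%E -> (m2 setT < +oo)%E ->
  (forall f, C1c f -> (forall x, 0 <= f x <= 1) ->
     (\int[m1]_x (f x)%:E = \int[m2]_x (f x)%:E)%E) ->
  forall A, measurable A -> m1 A = m2 A.
Proof.
move=> m1oo m2oo m12; apply: measure_eq_obox => // a b.
have boxE (m : {measure set V -> \bar R}) : (m setT < +oo)%E ->
    (\int[m]_x (boxfun a b n x)%:E)%E @[n --> \oo] --> m (obox a b).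
  move=> moo.
  have mbox n : measurable_fun [set: V] (fun x => (boxfun a b n x)%:E).
    by apply/measurable_EFinP; exact: measurable_boxfun.
  have moob : measurable (obox a b) by exact: measurable_obox.
  have mind : measurable_fun [set: V] (fun x => (\1_(obox a b) x : R)%:E).
    by apply/measurable_EFinP; exact: measurable_indic.
  have i1 : m.-integrable [set: V] (cst 1%E).
    apply/integrableP; split; first exact: measurable_cst.
    by under eq_integral do rewrite abse1; rewrite integral_cst//= mul1e.
  have c1 : {ae m, forall x, setT x -> (boxfun a b n x)%:E @[n --> \oo] --> (\1_(obox a b) x : R)%:E}.
    by apply: aeW => x _ /=; exact: boxfun_cvg.
  have d1 : {ae m, forall x n, setT x -> (`|(boxfun a b n x)%:E| <= cst 1 x)%E}.
    apply: aeW => x n _ /=; rewrite lee_fin.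
    by have /andP[h1 h2] := boxfun_itv a b n x; rewrite ger0_norm.
  have [_ _] := dominated_convergence measurableT mbox mind c1 i1 d1.
  by rewrite integral_indic// setIT.
apply: (@cvg_unique _ (@ereal_hausdorff R) ((fun n => \int[m1]_x (boxfun a b n x)%:E)%E @ \oo)).
  exact: boxE.
have := boxE m2 m2oo; under [X in X @ _]eq_fun do
  rewrite -(m12 _ (boxfun_C1c _ _ _) (boxfun_itv _ _ _)).
exact.
Qed.

End measure_uniqueness.

(** * Pairing an integrable function with test functions *)

Section pairing.
Context {R : realType} {d : nat} (lam : {measure set 'rV[R]_d -> \bar R}).
Local Notation V := 'rV[R]_d.
Local Notation cube := (@unit_cube R d).
Implicit Types (u f g : V -> R).

Definition L1cube u := [/\ measurable_fun [set: V] u, lam.-integrable [set: V] (EFin \o u) &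
  {ae lam, forall x, ~ cube x -> u x = 0}].

(** Boundedness is asked on the cube only, because the functions paired with [f] vanish almost
    everywhere outside; any continuous [f] qualifies. *)
Definition test_fun f := measurable_fun [set: V] f /\ exists M, forall x, cube x -> `|f x| <= M.

Definition pint u f : R := fine (\int[lam]_x (u x * f x)%:E)%E.
Definition norm1 u : R := fine (\int[lam]_x `|u x|%:E)%E.

Lemma test_fun_continuous f : continuous f -> test_fun f.
Proof.
move=> cf; split; first exact: continuous_measurable_rV.
have cfc : {within cube, continuous f} by exact: continuous_subspaceT.
have := @compact_bounded _ _ _ (@continuous_compact _ _ f cube cfc (@cube_compact R d)).
move=> [M [_ /(_ (M + 1))]]; rewrite ltrDl ltr01 => /(_ isT) H1.
by exists (M + 1) => x cx; apply: H1; exists x.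
Qed.

Lemma test_fun_linear a f g : test_fun f -> test_fun g -> test_fun (fun x => a * f x + g x).
Proof.
move=> [mf [M fM]] [mg [N gN]]; split.
  by apply: measurable_funD => //; exact: measurable_funM.
exists (`|a| * M + N) => x cx; rewrite (le_trans (ler_normD _ _))// normrM.
by rewrite lerD ?ler_wpM2l ?fM ?gN.
Qed.

Lemma test_fun_sum (I : Type) (r : seq I) (P : pred I) (a : I -> R) (F : I -> V -> R) :
  (forall k, test_fun (F k)) -> test_fun (fun x => \sum_(k <- r | P k) a k * F k x).
Proof.
move=> gF; elim: r => [|k r IH].
  have : test_fun (fun=> 0) by apply: test_fun_continuous; exact: cst_continuous.
  by congr test_fun; apply/funext => x; rewrite big_nil.
have [Pk|Pk] := boolP (P k).
  have := test_fun_linear (a k) (gF k) IH; congr test_fun.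
  by apply/funext => x; rewrite big_cons Pk.
by move: IH; congr test_fun; apply/funext => x; rewrite big_cons (negPf Pk).
Qed.

Lemma L1cube_integrableM u f : L1cube u -> test_fun f ->
  lam.-integrable [set: V] (EFin \o (fun x => u x * f x)).
Proof.
move=> [mu iu u0] [mf [M fM]].
have mind : measurable_fun [set: V] (\1_cube : V -> R).
  by apply: measurable_indic; exact: measurable_cube.
(* Cut off at the cube, [f] becomes bounded everywhere, and the product with [u] changes only on a
   null set. *)
have iG : lam.-integrable [set: V] (EFin \o (fun x => u x * (f x * \1_cube x))).
  apply: (@le_integrable _ _ _ _ _ measurableT _ (fun x => (`|M|%:E * (u x)%:E)%E)).
  - by apply/measurable_EFinP; apply: measurable_funM => //; exact: measurable_funM.
  - move=> x _ /=; rewrite lee_fin !normrM mulrC ler_wpM2r// normr_id indicE.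
    have [xc|xc] := pselect (cube x).
      by rewrite mem_set// normr1 mulr1 (le_trans (fM x xc))// ler_norm.
    by rewrite memNset// normr0 mulr0.
  - exact: integrableZl.
have mF : measurable_fun [set: V] (EFin \o (fun x => u x * f x)).
  by apply/measurable_EFinP; exact: measurable_funM.
apply/integrableP; split => //.
move/integrableP : iG => [mG]; apply: le_lt_trans.
rewrite (@ge0_ae_eq_integral _ _ _ lam setT (fun x => `|(u x * f x)%:E|%E)
  (fun x => `|(u x * (f x * \1_cube x))%:E|%E))//.
- exact: measurableT_comp.
- exact: measurableT_comp.
- apply: filterS u0 => x ux _ /=; rewrite indicE.
  have [xc|xc] := pselect (cube x); first by rewrite mem_set// mulr1.
  by rewrite ux// !mul0r.
Qed.

Lemma pintE u f : L1cube u -> test_fun f -> (\int[lam]_x (u x * f x)%:E = (pint u f)%:E)%E.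
Proof.
move=> Lu gf; rewrite /pint fineK//.
exact: (integrable_fin_num measurableT (L1cube_integrableM Lu gf)).
Qed.

Lemma norm1E u : L1cube u -> (\int[lam]_x `|u x|%:E = (norm1 u)%:E)%E.
Proof.
move=> [mu iu _]; rewrite /norm1 fineK//.
have := integrable_fin_num measurableT (integrable_norm iu); exact.
Qed.

Lemma norm1_ge0 u : 0 <= norm1 u.
Proof. by apply: fine_ge0; apply: integral_ge0 => x _; rewrite lee_fin. Qed.

Lemma eq_pint u f g : L1cube u -> test_fun f -> test_fun g ->
  (forall x, cube x -> f x = g x) -> pint u f = pint u g.
Proof.
move=> Lu gf gg fg; rewrite /pint; congr fine; apply: ae_eq_integral => //.
- by apply: (measurable_int lam); exact: (L1cube_integrableM Lu gf).
- by apply: (measurable_int lam); exact: (L1cube_integrableM Lu gg).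
have [_ _ u0] := Lu; apply: filterS u0 => x ux _.
have [xc|xc] := pselect (cube x); first by rewrite fg.
by rewrite ux// !mul0r.
Qed.

Lemma pint_linearr u a f g : L1cube u -> test_fun f -> test_fun g ->
  pint u (fun x => a * f x + g x) = a * pint u f + pint u g.
Proof.
move=> Lu gf gg; apply: EFin_inj.
rewrite -(pintE Lu (test_fun_linear a gf gg)) EFinD EFinM -(pintE Lu gf) -(pintE Lu gg).
have i1 := L1cube_integrableM Lu gf; have i2 := L1cube_integrableM Lu gg.
rewrite -integralZl// -integralD//; last exact: integrableZl.
by apply: eq_integral => x _ /=; rewrite -EFinM -EFinD; congr EFin; ring.
Qed.

Lemma pint_linearl u1 u2 a f : L1cube u1 -> L1cube u2 -> test_fun f ->
  pint (fun x => a * u1 x + u2 x) f = a * pint u1 f + pint u2 f.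
Proof.
move=> Lu1 Lu2 gf; apply: EFin_inj.
have i1 := L1cube_integrableM Lu1 gf; have i2 := L1cube_integrableM Lu2 gf.
have E : (\int[lam]_x ((a * u1 x + u2 x) * f x)%:E = (a * pint u1 f + pint u2 f)%:E)%E.
  rewrite EFinD EFinM -(pintE Lu1 gf) -(pintE Lu2 gf).
  rewrite -integralZl// -integralD//; last exact: integrableZl.
  by apply: eq_integral => x _ /=; rewrite -EFinM -EFinD; congr EFin; ring.
by rewrite -E /pint E.
Qed.

Lemma pint0r u : pint u (fun=> 0) = 0.
Proof.
rewrite /pint (eq_integral (cst 0%E)) ?integral0// => x _.
by rewrite mulr0.
Qed.

Lemma pint_sumr u (I : Type) (r : seq I) (P : pred I) (a : I -> R) (F : I -> V -> R) :
  L1cube u -> (forall k, test_fun (F k)) ->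
  pint u (fun x => \sum_(k <- r | P k) a k * F k x) = \sum_(k <- r | P k) a k * pint u (F k).
Proof.
move=> Lu gF; elim: r => [|k r IH].
  rewrite big_nil -[RHS](pint0r u); congr pint.
  by apply/funext => x; rewrite big_nil.
have [Pk|Pk] := boolP (P k); rewrite big_cons ?Pk ?(negPf Pk).
  rewrite -IH -pint_linearr//; last exact: test_fun_sum.
  by congr pint; apply/funext => x; rewrite big_cons Pk.
by rewrite -IH; congr pint; apply/funext => x; rewrite big_cons (negPf Pk).
Qed.

Lemma pint_le_norm1 u f M : L1cube u -> test_fun f -> 0 <= M ->
  (forall x, cube x -> `|f x| <= M) -> `|pint u f| <= M * norm1 u.
Proof.
move=> Lu gf M0 fM.
pose g x := f x * \1_cube x.
have gM x : `|g x| <= M.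
  rewrite /g indicE; have [xc|xc] := pselect (cube x).
    by rewrite mem_set// mulr1 fM.
  by rewrite memNset// mulr0 normr0.
have gg : test_fun g.
  split; last by exists M.
  have [mf _] := gf; apply: measurable_funM => //.
  by apply: measurable_indic; exact: measurable_cube.
have fg x : cube x -> f x = g x by move=> xc; rewrite /g indicE mem_set// mulr1.
rewrite (eq_pint Lu gf gg fg).
have [mu iu _] := Lu; have iug := L1cube_integrableM Lu gg.
rewrite -lee_fin EFinM -(norm1E Lu) -abse_EFin -(pintE Lu gg).
apply: (le_trans (le_abse_integral lam measurableT (measurable_int lam iug))).
have mnu : measurable_fun [set: V] (fun x => `|u x|%:E).
  by apply/measurable_EFinP; exact: measurableT_comp.
rewrite -(ge0_integralZl lam measurableT mnu) ?lee_fin//.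
apply: ge0_le_integral => //.
- by apply: measurableT_comp => //; exact: measurable_int iug.
- by apply/measurable_EFinP; apply: measurable_funM => //; exact: measurableT_comp.
- by move=> x _; rewrite -EFinM lee_fin normrM mulrC ler_wpM2r.
Qed.

Lemma L1cube_linear a u1 u2 : L1cube u1 -> L1cube u2 -> L1cube (fun x => a * u1 x + u2 x).
Proof.
move=> [m1 i1 z1] [m2 i2 z2]; split.
- by apply: measurable_funD => //; exact: measurable_funM.
- have := integrableD measurableT (integrableZl measurableT a i1) i2.
  by apply: eq_integrable => // x _ /=; rewrite EFinD EFinM.
- by apply: filterS2 z1 z2 => x h1 h2 cx; rewrite h1// h2// mulr0 addr0.
Qed.

Lemma L1cube0 : L1cube (fun=> 0).
Proof. by split; [exact: measurable_cst|exact: integrable0|exact: aeW]. Qed.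

End pairing.

(** * Functions of bounded variation on the cube *)

Section bounded_variation.
Context {R : realType} {d : nat} (lam : {measure set 'rV[R]_d -> \bar R}).
Local Notation V := 'rV[R]_d.
Local Notation cube := (@unit_cube R d).
Local Notation pint := (pint lam).
Implicit Types (u f g : V -> R) (w : V -> V).

Definition tv u : R := fine (TV_norm lam u).

Lemma test_fun_C1c f : C1c f -> test_fun f.
Proof. by move=> [cf _]; exact: test_fun_continuous. Qed.

Lemma test_fun_pderiv f i : C1c f -> test_fun (pderiv i f).
Proof. by move=> [_ [_ [cf _]]]; apply: test_fun_continuous; exact: cf. Qed.

Lemma divgE w : divg w = fun x => \sum_i 1 * pderiv i (fun y => w y ord0 i) x.
Proof. by apply/funext => x; apply: eq_bigr => i _; rewrite mul1r. Qed.

Lemma test_fun_divg w : C1c_field w -> test_fun (divg w).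
Proof. by move=> cw; rewrite divgE; apply: test_fun_sum => i; exact/test_fun_pderiv/cw. Qed.

Lemma pint_divg u w : L1cube lam u -> C1c_field w ->
  pint u (divg w) = \sum_i pint u (pderiv i (fun y => w y ord0 i)).
Proof.
move=> Lu cw; rewrite divgE pint_sumr//; first by apply: eq_bigr => i _; rewrite mul1r.
by move=> i; exact/test_fun_pderiv/cw.
Qed.

Definition single (j : 'I_d) g : V -> V := fun x => g x *: ebasis R j.

Lemma single_coord j g i : (fun x => single j g x ord0 i) =
  if i == j then g else fun=> 0.
Proof.
apply/funext => x; rewrite !mxE eqxx /=.
by case: eqP => _; rewrite ?mulr1 ?mulr0.
Qed.

Lemma C1c_single j g : C1c g -> C1c_field (single j g).
Proof. by move=> cg i; rewrite single_coord; case: eqP => // _; exact: C1c0. Qed.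

Lemma divg_single j g : C1c g -> divg (single j g) = pderiv j g.
Proof.
move=> cg; apply/funext => x; rewrite /divg (bigD1 j)//= single_coord eqxx.
rewrite big1 ?addr0// => i ij; rewrite single_coord (negPf ij).
by rewrite (pderivE i (has_grad_cst 0)).
Qed.

Lemma TV_norm_ge0 u : (0 <= TV_norm lam u)%E.
Proof.
apply: ereal_sup_ubound; exists (fun=> 0).
  split; last by move=> x; rewrite big1 ?ler01// => i _; rewrite mxE expr0n.
  move=> j; have := @C1c0 R d; congr C1c.
  by apply/funext => x; rewrite mxE.
rewrite (eq_integral (cst 0%E)) ?integral0// => x _.
rewrite /divg big1 ?mulr0// => i _.
rewrite (_ : (fun y : V => _) = fun=> 0); first by rewrite (pderivE i (has_grad_cst 0)).
by apply/funext => y; rewrite mxE.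
Qed.

Lemma isBV_L1cube u : isBV lam u -> L1cube lam u.
Proof. by case. Qed.

Lemma isBV_tv u : isBV lam u -> TV_norm lam u = (tv u)%:E.
Proof. by case=> _ _ _ TVoo; rewrite /tv fineK// ge0_fin_numE// TV_norm_ge0. Qed.

Lemma tv_ge0 u : 0 <= tv u.
Proof. exact/fine_ge0/TV_norm_ge0. Qed.

Lemma pint_divg_le_tv u w : isBV lam u -> C1c_field w -> sup_norm_le1 w ->
  pint u (divg w) <= tv u.
Proof.
move=> Bu cw w1; rewrite -lee_fin -(isBV_tv Bu) -(pintE (isBV_L1cube Bu) (test_fun_divg cw)).
by apply: ereal_sup_ubound; exists w.
Qed.

Lemma TV_norm_le u M : L1cube lam u ->
  (forall w, C1c_field w -> sup_norm_le1 w -> pint u (divg w) <= M) ->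
  (TV_norm lam u <= M%:E)%E.
Proof.
move=> Lu H; apply: ub_ereal_sup => _ [w [cw w1] <-].
by rewrite (pintE Lu (test_fun_divg cw)) lee_fin H.
Qed.

Lemma C1cZ a g : C1c g -> C1c (fun x => a * g x).
Proof.
move=> cg; have := C1c_linear a cg (@C1c0 R d); congr C1c.
by apply/funext => x; rewrite addr0.
Qed.

Lemma pderivZ i a g : C1c g -> pderiv i (fun x => a * g x) = fun x => a * pderiv i g x.
Proof. by move=> /has_gradP[gg _]; exact: pderivE i (has_gradZ a gg). Qed.

Lemma pintZr u a f : L1cube lam u -> test_fun f -> pint u (fun x => a * f x) = a * pint u f.
Proof.
move=> Lu gf; have g0 : test_fun (fun _ : V => 0 : R) by exact/test_fun_C1c/C1c0.
rewrite -[RHS]addr0 -(pint0r lam u) -pint_linearr//; congr (pint _ _).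
by apply/funext => x; rewrite addr0.
Qed.

(** The field with single coordinate [g], scaled to length at most 1, is admissible in the
    definition of the variation. *)
Lemma pint_pderiv_le u g j M : isBV lam u -> C1c g -> 0 <= M ->
  (forall x, `|g x| <= M) -> `|pint u (pderiv j g)| <= M * tv u.
Proof.
move=> Bu cg M0 gM; have Lu := isBV_L1cube Bu.
have main N (s : R) : 0 < N -> (forall x, `|g x| <= N) -> `|s| = 1 -> s * pint u (pderiv j g) <= N * tv u.
  move=> N0 gN s1; rewrite -ler_pdivrMl// mulrA.
  have cs := C1cZ (N^-1 * s) cg.
  have := pint_divg_le_tv Bu (C1c_single j cs); rewrite divg_single// pderivZ//.
  rewrite pintZr//; last exact: test_fun_pderiv.
  apply => x; rewrite (bigD1 j)//= big1 ?addr0 => [|i ij].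
    rewrite (_ : single _ _ _ _ _ = N^-1 * s * g x); last by rewrite !mxE !eqxx mulr1.
    rewrite -(real_normK (num_real _)) expr_le1// !normrM s1 mulr1 normfV (gtr0_norm N0).
    by rewrite mulrC ler_pdivrMr// mul1r.
  by rewrite !mxE eqxx (negPf ij) mulr0 expr0n.
have main' N : 0 < N -> (forall x, `|g x| <= N) -> `|pint u (pderiv j g)| <= N * tv u.
  move=> N0 gN; rewrite ler_norml lerNl -mulN1r.
  by rewrite (main N (-1)) ?normrN ?normr1//= -[leLHS]mul1r (main N 1) ?normr1.
(* [M] may be [0], which rules out the scaling; the bound is applied to [M + e / (tv u + 1)]
   instead. *)
apply/ler_addgt0Pr => e e0.
have t0 := tv_ge0 u.
apply: (@le_trans _ _ ((M + e / (tv u + 1)) * tv u)).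
  apply: main'; first by rewrite ltr_wpDl// divr_gt0// ltr_wpDl.
  by move=> x; rewrite (le_trans (gM x))// lerDl divr_ge0// ?ltW// ltr_wpDl.
rewrite mulrDl lerD2l -mulrA ger_pMr// ler_pdivrMl ?mulr1 ?lerDl//.
by rewrite ltr_wpDl.
Qed.

(** From a point of the cube, steps of length at most [1/2] along [e_j] or along [- e_j] stay in the
    cube, so arbitrarily small difference quotients vanish. *)
Lemma pderiv0_cube g j x : C1c g -> (forall y, cube y -> g y = 0) -> cube x -> pderiv j g x = 0.
Proof.
move=> [_ [dg _]] g0 cx; have /cvg_ex[/= l gl] := dg j x.
have -> : pderiv j g x = l by apply/cvg_lim.
apply/eqP; apply: contraT => l0.
have : \forall h \near (0 : R)^', h^-1 *: (g (h *: ebasis R j + x) - g x) != 0.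
  apply: (cvgr_neq0 _ gl) => //.
rewrite near_withinE => /nbhs_ballP[e /= e0 H].
have /andP[xj0 xj1] := cx j.
pose h := (if x ord0 j <= 1 / 2 then 1 else -1) * Num.min (e / 2) (1 / 2).
have m0 : 0 < Num.min (e / 2) (1 / 2) by rewrite lt_min; apply/andP; split; lra.
have me : Num.min (e / 2) (1 / 2) <= e / 2 by rewrite ge_min lexx.
have m2 : Num.min (e / 2) (1 / 2) <= 1 / 2 by rewrite ge_min lexx orbT.
have hn : `|h| = Num.min (e / 2) (1 / 2).
  rewrite /h normrM (gtr0_norm m0); case: ifP => _; rewrite ?normrN ?normr1 ?mul1r. reflexivity. reflexivity.
have /H : ball 0 e h by rewrite /ball /= sub0r normrN hn; lra.
have h0 : h != 0 by rewrite -normr_gt0 hn.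
move=> /(_ h0); rewrite g0 ?g0 ?subrr ?scaler0 ?eqxx// => i.
rewrite !mxE; case: (eqVneq i j) => [->|ij]; last by rewrite mulr0 add0r; exact: cx.
rewrite mulr1 /h; case: (leP (x ord0 j) (1 / 2)) => ?; apply/andP; split; lra.
Qed.

Lemma pint_pderiv0 u g j : L1cube lam u -> C1c g -> (forall x, cube x -> g x = 0) ->
  pint u (pderiv j g) = 0.
Proof.
move=> Lu cg g0; rewrite -[RHS](pint0r lam u); apply: eq_pint => //.
- exact: test_fun_pderiv.
- exact/test_fun_C1c/C1c0.
- by move=> x cx; exact: pderiv0_cube.
Qed.

Lemma TV_norm_linear (a : R) u1 u2 : isBV lam u1 -> isBV lam u2 ->
  (TV_norm lam (fun x => a * u1 x + u2 x)%R <= (`|a| * tv u1 + tv u2)%:E)%E.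
Proof.
move=> B1 B2; have L1 := isBV_L1cube B1; have L2 := isBV_L1cube B2.
apply: TV_norm_le; first exact: L1cube_linear.
move=> w cw w1; rewrite pint_linearl//; last exact: test_fun_divg.
apply: lerD; last exact: pint_divg_le_tv.
(* [a] may be negative, so the estimate by [tv u1] is needed for [- w] as well as for [w]. *)
have cw' : C1c_field (fun x => - w x).
  move=> j; have := C1cZ (-1) (cw j); congr C1c.
  by apply/funext => x; rewrite mulN1r mxE.
have w1' : sup_norm_le1 (fun x => - w x).
  move=> x; apply: le_trans (w1 x).
  by rewrite le_eqVlt; apply/orP; left; apply/eqP/eq_bigr => j _; rewrite mxE sqrrN.
have := pint_divg_le_tv B1 cw w1; have := pint_divg_le_tv B1 cw' w1'.
have -> : divg (fun x => - w x) = fun x => (-1) * divg w x.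
  apply/funext => x; rewrite mulN1r /divg -sumrN; apply: eq_bigr => i _.
  rewrite (_ : (fun y => _) = fun y => -1 * w y ord0 i); first by rewrite pderivZ// mulN1r.
  by apply/funext => y; rewrite mulN1r mxE.
rewrite pintZr//; last exact: test_fun_divg.
move=> h1 h2; apply: (le_trans (ler_norm _)); rewrite normrM ler_wpM2l//.
by rewrite ler_norml; apply/andP; split; lra.
Qed.

Lemma isBV_linear a u1 u2 : isBV lam u1 -> isBV lam u2 -> isBV lam (fun x => a * u1 x + u2 x).
Proof.
move=> B1 B2; have [m i z] := L1cube_linear a (isBV_L1cube B1) (isBV_L1cube B2).
split => //; apply: le_lt_trans (TV_norm_linear a B1 B2) _; exact: ltry.
Qed.

Lemma tv_linear a u1 u2 : isBV lam u1 -> isBV lam u2 ->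
  tv (fun x => a * u1 x + u2 x) <= `|a| * tv u1 + tv u2.
Proof.
by move=> B1 B2; rewrite -lee_fin -isBV_tv; [exact: TV_norm_linear|exact: isBV_linear].
Qed.

Lemma TV_norm0_le : (TV_norm lam (fun=> 0%R) <= 0%:E)%E.
Proof.
apply: TV_norm_le => [|w cw w1]; first exact: L1cube0.
rewrite /pint (eq_integral (cst 0%E)) ?integral0// => x _.
by rewrite mul0r.
Qed.

Lemma isBV0 : isBV lam (fun=> 0).
Proof.
have [m i z] := L1cube0 lam; split => //.
by apply: le_lt_trans TV_norm0_le _; exact: ltry.
Qed.

Lemma tv0 : tv (fun=> 0) = 0.
Proof.
apply/eqP; rewrite eq_le tv_ge0 andbT -lee_fin -isBV_tv; last exact: isBV0.
exact: TV_norm0_le.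
Qed.

End bounded_variation.

(** * Weak limits of discrete measures and Riesz representation *)

Section ultralimit.
Context {R : realType} (U : set_system nat) {UU : UltraFilter U}.
Implicit Types a b : nat -> R.

(** Along an ultrafilter every bounded sequence has a limit, linear in the sequence; this spares the
    extraction of subsequences for countably many cells. *)
Definition ulim a : R := lim (a @ U).

(** The image ultrafilter clusters in a compact segment, and a cluster point of an ultrafilter is a
    limit. *)
Lemma cvg_ulim a C : (forall n, `|a n| <= C) -> a @ U --> ulim a.
Proof.
move=> aC; suff [p ap] : exists p : R, a @ U --> p.
  have -> // : ulim a = p by exact: (cvg_lim (@Rhausdorff R) ap).
have abC : (a @ U) `[- C, C]%classic.
  by apply: (@filterS _ U _ setT) => [n _ /=|]; [rewrite in_itv/= -ler_norml|exact: filterT].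
have [p [_ clp]] := @segment_compact R (- C) C (a @ U) _ abC.
exists p => A /= Ap.
have [//|UnA] := in_ultra_setVsetC (a @^-1` A) UU.
have [x [nAx Ax]] := clp (~` A) A UnA Ap.
by have := nAx Ax.
Qed.

Lemma ulim_cvg a l : a @ U --> l -> ulim a = l.
Proof. by move=> al; rewrite /ulim; exact: cvg_lim. Qed.

Lemma ulim_linear a b c C C' : (forall n, `|a n| <= C) -> (forall n, `|b n| <= C') ->
  ulim (fun n => c * a n + b n) = c * ulim a + ulim b.
Proof.
move=> /cvg_ulim ca /cvg_ulim cb; apply: ulim_cvg.
exact: (cvgD (cvgM (cvg_cst c) ca) cb).
Qed.

Lemma ulim_ge0 a C : (forall n, 0 <= a n <= C) -> 0 <= ulim a.
Proof.
move=> aC; have : a @ U --> ulim a.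
  by apply: (@cvg_ulim _ C) => n; have /andP[h1 h2] := aC n; rewrite ger0_norm.
move=> ca; rewrite -(cvg_lim (@Rhausdorff R) ca).
apply: limr_ge; first by apply/cvg_ex; exists (ulim a).
by apply: nearW => n; have /andP[] := aC n.
Qed.

Lemma ulim_le a b C C' : (forall n, `|a n| <= C) -> (forall n, `|b n| <= C') ->
  (forall n, a n <= b n) -> ulim a <= ulim b.
Proof.
move=> aC bC' ab; rewrite -subr_ge0 addrC -mulN1r -(ulim_linear _ aC bC').
apply: (@ulim_ge0 _ (C + C')) => n; rewrite mulN1r addrC subr_ge0 ab/=.
apply: (le_trans (ler_norm _)); apply: (le_trans (ler_normB _ _)).
by rewrite addrC lerD.
Qed.

Lemma ulim_cst c : ulim (fun=> c) = c.
Proof. by apply: ulim_cvg; exact: cvg_cst. Qed.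

Lemma ulim_sum (I : Type) (r : seq I) (x : I -> R) (F : I -> nat -> R) C :
  (forall i n, `|F i n| <= C) ->
  ulim (fun n => \sum_(i <- r) x i * F i n) = \sum_(i <- r) x i * ulim (F i).
Proof.
move=> FC; have C0 : forall i : I, 0 <= C.
  by move=> i; exact: le_trans (normr_ge0 _) (FC i 0%N).
elim: r => [|i r IH].
  by rewrite big_nil -[RHS](ulim_cst 0); congr ulim; apply/funext => n; rewrite big_nil.
have bd n : `|\sum_(j <- r) x j * F j n| <= \sum_(j <- r) `|x j| * C.
  apply: (le_trans (ler_norm_sum _ _ _)); apply: ler_sum => j _.
  by rewrite normrM ler_wpM2l.
rewrite big_cons -IH -(ulim_linear (x i) (FC i) bd); congr ulim.
by apply/funext => n; rewrite big_cons.
Qed.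

End ultralimit.

Lemma cvg_itv {R : realType} (a : nat -> R) l lo hi N : a n @[n --> \oo] --> l ->
  (forall n, (N <= n)%N -> lo <= a n <= hi) -> lo <= l <= hi.
Proof.
move=> al H; have ca : cvgn a by apply/cvg_ex; exists l.
have <- : limn a = l by exact/cvg_lim.
by apply/andP; split; [apply: limr_ge|apply: limr_le] => //;
  exists N => // n /= Nn; have /andP[] := H n Nn.
Qed.

(** * Measures on the cube built from masses on a binary tree of cells *)

Section tree.
Context {R : realType} {d : nat}.
Local Notation V := 'rV[R]_d.
Local Notation cube := (@unit_cube R d).

(* Enumerates all tests [x_i < k / (N + 1)]; the cells are the atoms of the first tests, so they shrink to points. *)
Definition bit (p : nat) (x : V) : bool :=
  if unpickle p is Some (i, N, k) then x ord0 (i : 'I_d) < (k : nat)%:R / (N : nat).+1%:R else false.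

Definition cell (w : seq bool) : set V :=
  [set x | forall p, (p < size w)%N -> bit p x = nth false w p].

Lemma cell_rcons w b : cell (rcons w b) = cell w `&` [set x | bit (size w) x = b].
Proof.
apply/seteqP; split => x /=.
  move=> H; split; last by rewrite H ?size_rcons// nth_rcons ltnn eqxx.
  by move=> p pw; rewrite H ?size_rcons ?ltnS 1?ltnW// nth_rcons pw.
move=> [H1 H2] p; rewrite size_rcons ltnS leq_eqVlt nth_rcons => /orP[/eqP ->|pw].
  by rewrite ltnn eqxx.
by rewrite pw H1.
Qed.

Lemma cell_small (eta : R) : 0 < eta -> exists n, forall w, (n <= size w)%N ->
  forall x y, cube x -> cube y -> cell w x -> cell w y ->
  forall i, `|x ord0 i - y ord0 i| <= eta.
Proof.
move=> eta0; pose N := Num.truncn eta^-1.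
have ne : N.+1%:R^-1 < eta by rewrite invf_plt ?posrE// truncnS_gt.
(* [n] exceeds the codes of all tests with denominator [N + 1]. The index [k] goes up to [N + 2],
   since [x_i = 1] lies strictly below that multiple only. *)
pose n := (\max_(i < d) \max_(k < N.+3) pickle (i, N, k : nat)).+1.
exists n => w nw x y cx cy wx wy i.
have same k : (k < N.+3)%N -> (x ord0 i < k%:R / N.+1%:R) = (y ord0 i < k%:R / N.+1%:R).
  move=> kN; have pn : (pickle (i, N, k) < size w)%N.
    apply: leq_trans nw; rewrite ltnS.
    apply: leq_trans (leq_bigmax i); exact: (leq_bigmax (Ordinal kN)).
  by have := wx _ pn; rewrite -(wy _ pn) /bit pickleK.
wlog xy : x y cx cy wx wy same / x ord0 i <= y ord0 i.
  move=> H; have [|/ltW] := leP (x ord0 i) (y ord0 i); first exact: H.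
  by rewrite distrC; apply: H => // k /same.
rewrite distrC ger0_norm ?subr_ge0//.
(* The first multiple of [1/(N + 1)] above [x_i] is also above [y_i], as both pass the same test;
   with [x_i <= y_i] they differ by at most [1/(N + 1)]. *)
pose k := (Num.truncn (N.+1%:R * x ord0 i)).+1.
have /andP[x0 x1] := cx i.
have Nx0 : 0 <= N.+1%:R * x ord0 i by rewrite mulr_ge0.
have /andP[k1 k2] := truncn_itv Nx0.
have kN : (k < N.+3)%N.
  rewrite !ltnS -(@ler_nat R); apply: (le_trans k1).
  by rewrite (@le_trans _ _ (N.+1%:R * 1)) ?ler_wpM2l// mulr1 ler_nat.
have : x ord0 i < k%:R / N.+1%:R by rewrite ltr_pdivlMr// mulrC.
rewrite same// ltr_pdivlMr// => yk.
apply: le_trans (ltW ne); rewrite -[leRHS]div1r ler_pdivlMr// mulrBl.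
move: yk; rewrite /k -[X in _ < X]natr1 => yk.
by rewrite lerBlDl; apply: (le_trans (ltW yk)); rewrite lerD2r [leRHS]mulrC.
Qed.

Variables (q : seq bool -> R).
Hypothesis q_ge0 : forall w, 0 <= q w.
Hypothesis q_split : forall w, q w = q (rcons w false) + q (rcons w true).
Hypothesis q_pos : forall w, 0 < q w -> exists x, cube x /\ cell w x.

(** For a cell missing the cube the default [0] is taken; it lies in the cube, so [rep_cube] is
    unconditional. *)
Definition rep w : V := xget 0 [set x | cube x /\ cell w x].

Lemma rep_cube w : cube (rep w).
Proof. by rewrite /rep; case: xgetP => [x _ []|_]//; exact: cube0. Qed.

Lemma rep_cell w : 0 < q w -> cell w (rep w).
Proof. by move=> /q_pos[x xP]; rewrite /rep; case: xgetP => [y _ []//|/(_ x)]. Qed.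

(** Binary search for [t] in [[0, q [::])]; the second component is the left end of the interval
    reached. *)
Fixpoint descent (t : R) (n : nat) : seq bool * R :=
  if n is m.+1 then
    let: (w, a) := descent t m in
    if t < a + q (rcons w false) then (rcons w false, a)
    else (rcons w true, a + q (rcons w false))
  else ([::], 0).

Lemma size_descent t n : size (descent t n).1 = n.
Proof. by elim: n => //= n; case: (descent t n) => w a /=; case: ifP => _ /= <-; rewrite size_rcons. Qed.

Lemma descent_itv t n : 0 <= t < q [::] ->
  (descent t n).2 <= t < (descent t n).2 + q (descent t n).1.
Proof.
move=> t0; elim: n => [|n]/=; first by rewrite add0r.
case: (descent t n) => w a /= /andP[h1 h2]; case: ifPn => /= h3; first by rewrite h1.
by rewrite leNgt h3/= -addrA -q_split.
Qed.

(** The left end belongs to the word and not to [t]: by induction the points reaching [w] fill one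
    interval of length [q w], which the next step cuts at [a + q (rcons w false)]. *)
Lemma descent_level w : exists a, [/\ 0 <= a, a + q w <= q [::] & forall t, 0 <= t < q [::] ->
  ((descent t (size w)).1 = w <-> a <= t < a + q w) /\
  ((descent t (size w)).1 = w -> (descent t (size w)).2 = a)].
Proof.
elim/last_ind: w => [|w b [a [a0 aM aP]]].
  by exists 0; split=> // [|t t0]; [rewrite add0r|split=> //=; rewrite add0r].
have qs := q_split w; have qf := q_ge0 (rcons w false); have qt := q_ge0 (rcons w true).
exists (if b then a + q (rcons w false) else a); split=> [||t tM].
- by case: b; lra.
- by case: b; lra.
have [[h1 h1'] h2] := aP t tM.
rewrite size_rcons /=; case E : (descent t (size w)) => [v c] /=.
move: h1 h1' h2; rewrite E /= => h1 h1' h2.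
case: ifPn => /= tc; split.
- split=> [/rcons_inj[vw bb]|].
    have := h1 vw; have ca := h2 vw; move=> /andP[? ?].
    by rewrite -bb -ca; apply/andP; split; [lra|move: tc; rewrite ca vw].
  move=> tab; have vw : v = w by apply: h1'; case: b tab => /andP[? ?]; apply/andP; split; lra.
  have ca := h2 vw; subst v c; case: b tab => // /andP[? ?]; exfalso; lra.
- by move=> /rcons_inj[vw <-]; rewrite h2.
- split=> [/rcons_inj[vw bb]|].
    have := h1 vw; have ca := h2 vw; move=> /andP[? ?].
    subst v c; rewrite -bb; move: tc; rewrite -leNgt => tc; apply/andP; split; lra.
  move=> tab; have vw : v = w by apply: h1'; case: b tab => /andP[? ?]; apply/andP; split; lra.
  have ca := h2 vw; subst v c; case: b tab => // /andP[? ?]; exfalso; move: tc; rewrite -leNgt => tc; lra.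
- by move=> /rcons_inj[vw <-]; rewrite h2 // vw.
Qed.

Lemma cell_descent t n m : (n <= m)%N -> cell (descent t m).1 `<=` cell (descent t n).1.
Proof.
elim: m => [|m IH]; first by rewrite leqn0 => /eqP ->.
rewrite leq_eqVlt ltnS => /orP[/eqP -> //|/IH sub]; apply: subset_trans sub => /=.
by case: (descent t m) => w a; case: ifP => _ /=; rewrite cell_rcons => x [].
Qed.

Definition left_end w : R := sval (cid (descent_level w)).
Definition slot w : set R := `[left_end w, left_end w + q w[%classic.
Definition base : set R := `[0, q [::][%classic.

Lemma slotP w t : base t -> ((descent t (size w)).1 = w <-> slot w t).
Proof.
rewrite /base /slot /= !in_itv /= /left_end => tb.
case: cid => a [a0 aM aP] /=; have [h _] := aP t tb; exact: h.
Qed.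

Lemma slot_base w : slot w `<=` base.
Proof.
move=> t; rewrite /base /slot /= !in_itv /= /left_end.
by case: cid => a [a0 aM _] /= /andP[h1 h2]; apply/andP; split; lra.
Qed.

Lemma lebesgue_half_open (a l : R) : 0 <= l -> lebesgue_measure (`[a, (a + l)%R[%classic : set R) = l%:E.
Proof.
move=> l0; rewrite lebesgue_measure_itv /= lte_fin.
have [_|] := ltP a (a + l); first by rewrite -EFinB addrAC subrr add0r.
by rewrite gerDl => l0'; congr EFin; apply/eqP; rewrite eq_le l0 l0'.
Qed.

Definition path (t : R) n : V :=
  if `[< base t >] then rep (descent t n).1 else rep [::].

Lemma path_cube t n : cube (path t n).
Proof. by rewrite /path; case: ifP => _; exact: rep_cube. Qed.

(** At a fixed level the path takes finitely many values on intervals; this gives both its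
    measurability and its integrals. *)
Lemma path_sum (phi : V -> R) t n : phi (path t n) =
  \sum_(w : n.-tuple bool) phi (rep w) * \1_(slot w) t + phi (rep [::]) * \1_(~` base) t.
Proof.
rewrite /path; case: asboolP => bt.
  rewrite indicE memNset ?mulr0 ?addr0; last by apply.
  pose w0 : n.-tuple bool := tcast (size_descent t n) (in_tuple (descent t n).1).
  have w0E : w0 = (descent t n).1 :> seq bool by rewrite /w0 val_tcast.
  rewrite (bigD1 w0)//= big1 ?addr0 => [|w ww0].
    rewrite indicE mem_set ?mulr1 ?w0E//.
    by apply/(slotP _ bt); rewrite size_descent.
  rewrite indicE memNset ?mulr0// => /(slotP _ bt); rewrite size_tuple -w0E => E.
  by move/eqP: ww0; apply; exact/val_inj.
rewrite indicE mem_set// mulr1 big1 ?add0r// => w _.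
by rewrite indicE memNset ?mulr0// => /slot_base.
Qed.

Lemma path_close eta : 0 < eta -> exists n, forall t m k, (n <= m)%N -> (n <= k)%N ->
  forall i, `|path t m ord0 i - path t k ord0 i| <= eta.
Proof.
move=> eta0; have [n nP] := cell_small eta0; exists n => t m k nm nk i.
rewrite /path; case: asboolP => bt; last by rewrite subrr normr0 ltW.
have tb : 0 <= t < q [::] by move: bt; rewrite /base /= in_itv.
have qp p : 0 < q (descent t p).1.
  have /andP[] := descent_itv p tb; lra.
apply: (nP (descent t n).1); rewrite ?size_descent//; try exact: rep_cube.
- by apply: (cell_descent nm); exact: rep_cell.
- by apply: (cell_descent nk); exact: rep_cell.
Qed.

(** Cells are not closed, so the limit may leave them and mass may settle on a cell boundary. Hence
    only integrals of continuous functions are compared later, never masses of cells. *)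
Definition limit_pt (t : R) : V := \row_i limn (fun n => path t n ord0 i).

Lemma path_cvg t i : path t n ord0 i @[n --> \oo] --> limit_pt t ord0 i.
Proof.
rewrite mxE; apply: cauchy_cvg; apply: cauchy_exP => e e0.
have e20 : 0 < e / 2 by rewrite divr_gt0.
have [n nP] := path_close e20; exists (path t n ord0 i).
exists n => // m /= nm; rewrite /ball /=.
by apply: (le_lt_trans (nP t n m (leqnn _) nm i)); lra.
Qed.

Lemma limit_pt_cube t : cube (limit_pt t).
Proof.
move=> i; have := @cvg_itv R (fun n => path t n ord0 i) _ 0 1 0%N (@path_cvg t i).
by apply=> n _; exact: path_cube.
Qed.

Lemma limit_pt_close eta : 0 < eta -> exists n, forall t m, (n <= m)%N ->
  forall i, `|limit_pt t ord0 i - path t m ord0 i| <= eta.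
Proof.
move=> eta0; have [n nP] := path_close eta0; exists n => t m nm i.
have h : path t k ord0 i - path t m ord0 i @[k --> \oo] -->
    limit_pt t ord0 i - path t m ord0 i.
  exact: (cvgB (@path_cvg t i) (cvg_cst (path t m ord0 i))).
rewrite ler_norml; have := @cvg_itv R _ _ (- eta) eta n h; apply=> k nk /=.
by rewrite -ler_norml; exact: nP.
Qed.

Lemma measurable_limit_pt : measurable_fun setT limit_pt.
Proof.
apply: measurable_fun_rV => i.
apply: (@measurable_fun_cvg _ _ _ setT (fun n t => path t n ord0 i)); last first.
  by move=> t _; exact: path_cvg.
move=> n; under eq_fun do rewrite (path_sum (fun x => x ord0 i)).
have ms w : measurable (slot w) by exact: measurable_itv.
apply: measurable_funD; last first.
  apply: measurable_funM => //; apply: measurable_indic; apply: measurableC.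
  exact: measurable_itv.
apply: measurable_sum => w; apply: measurable_funM => //; exact: measurable_indic.
Qed.

End tree.

Section finite_measure_integrals.
Context d' (T : measurableType d') {R : realType} (m : {measure set T -> \bar R}).
Variables (D : set T) (mD : measurable D).
Hypothesis mfin : (m D < +oo)%E.

Lemma bounded_integrable (F : T -> R) M : measurable_fun D F ->
  (forall x, D x -> `|F x| <= M) -> m.-integrable D (EFin \o F).
Proof.
move=> mF FM; apply: measurable_bounded_integrable => //.
exists M; split; first exact: num_real.
by move=> N MN x Dx; exact: le_trans (FM x Dx) (ltW MN).
Qed.

Lemma integral_close (F G : T -> R) M eta :
  measurable_fun D F -> measurable_fun D G ->
  (forall x, D x -> `|F x| <= M) -> (forall x, D x -> `|G x| <= M) ->
  (forall x, D x -> `|F x - G x| <= eta) ->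
  `|fine (\int[m]_(x in D) (F x)%:E)%E - fine (\int[m]_(x in D) (G x)%:E)%E|
     <= eta * fine (m D).
Proof.
move=> mF mG FM GM FG.
have iF := bounded_integrable mF FM; have iG := bounded_integrable mG GM.
have := RintegralB mD iF iG; rewrite /Rintegral => <-.
have iFG : m.-integrable D (EFin \o (fun x => F x - G x)).
  exact: (integrableB mD iF iG).
apply: le_trans (le_normr_Rintegral mD iFG) _.
rewrite -(Rintegral_cst m mD eta); apply: le_Rintegral => //.
- exact: (integrable_norm iFG).
- by apply: (@bounded_integrable _ `|eta|) => // x Dx.
Qed.

Lemma bounded_integrable_sum (I : Type) (r : seq I) (a : I -> R) (A : I -> set T) :
  (forall k, measurable (A k)) ->
  m.-integrable D (EFin \o (fun x => \sum_(k <- r) a k * \1_(A k) x)).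
Proof.
move=> mA; apply: (@bounded_integrable _ (\sum_(k <- r) `|a k|)).
  by apply: measurable_sum => k; apply: measurable_funM => //; exact: measurable_indic.
move=> x _; apply: (le_trans (ler_norm_sum _ _ _)); apply: ler_sum => k _.
by rewrite normrM ler_piMr// indicE; case: (_ \in _); rewrite ?normr1 ?normr0.
Qed.

Lemma integral_step_fun (I : Type) (r : seq I) (a : I -> R) (A : I -> set T) :
  (forall k, measurable (A k)) ->
  fine (\int[m]_(x in D) (\sum_(k <- r) a k * \1_(A k) x)%:E)%E =
  \sum_(k <- r) a k * fine (m (A k `&` D)).
Proof.
move=> mA; elim: r => [|k r IH].
  by under eq_integral do rewrite big_nil; rewrite integral0 big_nil.
under eq_integral do rewrite big_cons.
have i1 : m.-integrable D (EFin \o (fun x => a k * \1_(A k) x)).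
  have := @bounded_integrable_sum unit [:: tt] (fun=> a k) (fun=> A k) (fun=> mA k).
  by apply: eq_integrable => // x _ /=; rewrite big_seq1.
have i2 : m.-integrable D (EFin \o (\1_(A k) : T -> R)).
  have := @bounded_integrable_sum unit [:: tt] (fun=> 1) (fun=> A k) (fun=> mA k).
  by apply: eq_integrable => // x _ /=; rewrite big_seq1 mul1r.
have := RintegralD mD i1 (bounded_integrable_sum r a mA).
have := RintegralZl (a k) mD i2.
rewrite /Rintegral IH big_cons => -> ->; congr (_ * fine _ + _).
by rewrite integral_indic.
Qed.

End finite_measure_integrals.

(** * Weak limits of discrete measures on the cube *)

Section weak_limit.
Context {R : realType} {d : nat}.
Local Notation V := 'rV[R]_d.
Local Notation cube := (@unit_cube R d).

Lemma continuous_cube_bounded (phi : V -> R) : continuous phi ->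
  exists M, forall x, cube x -> `|phi x| <= M.
Proof. by move=> /test_fun_continuous[_]. Qed.

Lemma continuous_modulus (phi : V -> R) : continuous phi -> forall eta : R, 0 < eta ->
  exists2 del : R, 0 < del & forall x y : V, cube y ->
    (forall i, `|x ord0 i - y ord0 i| <= del) -> `|phi x - phi y| <= eta.
Proof.
move=> cphi eta eta0.
have cf y : cube y -> phi @ within setT (nbhs y) --> phi y.
  by move=> _; apply: cvg_within_filter; exact: cphi.
have [del del0 H] := cube_modulus (@subsetT _ _) cf eta0.
by exists del => // x y; exact: H.
Qed.

(* The interval [0, q(root)) is cut into subintervals of length [q w], one for each cell [w]; the measure is the image of Lebesgue measure under the map sending [t] to the point of the cells containing its subinterval. *)
Lemma tree_measure (q : seq bool -> R) :
  (forall w, 0 <= q w) -> (forall w, q w = q (rcons w false) + q (rcons w true)) ->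
  (forall w, 0 < q w -> exists x : V, cube x /\ cell w x) ->
  exists mu : {measure set V -> \bar R}, [/\ mu setT = (q [::])%:E, mu (~` cube) = 0%E &
    forall phi, continuous phi -> forall eta, 0 < eta -> exists N, forall n, (N <= n)%N ->
      `|fine (\int[mu]_x (phi x)%:E)%E - \sum_(w : n.-tuple bool) phi (rep w) * q w| <= eta].
Proof.
move=> q0 qs qp.
have mb : measurable (base q) by exact: measurable_itv.
pose L : {measure set (measurableTypeR R) -> \bar R} := mrestr (@lebesgue_measure R) mb.
have mg := measurable_limit_pt q0 qs qp.
pose mu' : {measure set V -> \bar R} := pushforward L (limit_pt q).
pose mu := mu' mg.
have LT : L setT = (q [::])%:E.
  rewrite /L /= /mrestr setTI /base -[X in `[_, X[%classic]add0r.
  exact: lebesgue_half_open.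
exists mu; split.
- by rewrite /mu /= /pushforward preimage_setT.
- rewrite /mu /= /pushforward (_ : _ @^-1` _ = set0) ?measure0//.
  by apply/seteqP; split => // t /=; apply; exact: limit_pt_cube.
move=> phi cphi eta eta0.
have mphi := continuous_measurable_rV cphi.
have [M phiM] := continuous_cube_bounded cphi.
have Q0 : 0 < q [::] + 1 by rewrite ltr_wpDl.
have [del del0 delP] := continuous_modulus cphi (divr_gt0 eta0 Q0).
have [N NP] := limit_pt_close qs qp del0.
exists N => n Nn.
have LToo : (L setT < +oo)%E by rewrite LT ltry.
have cubeE : (\int[mu]_x (phi x)%:E = \int[L]_t (phi (limit_pt q t))%:E)%E.
  rewrite integral_pushforward//.
  - by apply/measurable_EFinP.
  - rewrite preimage_setT; apply: (@bounded_integrable _ _ _ _ _ _ _ _ M) => //.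
      exact: measurableT_comp.
    by move=> t _; exact/phiM/limit_pt_cube.
pose Phi t := phi (path q t n).
have ms (w : seq bool) : measurable (slot q0 qs w) by exact: measurable_itv.
have mPhi : measurable_fun setT Phi.
  rewrite /Phi; under eq_fun do rewrite (path_sum q0 qs phi).
  apply: measurable_funD; last first.
    by apply: measurable_funM => //; apply: measurable_indic; exact: measurableC.
  by apply: measurable_sum => w; apply: measurable_funM => //; exact: measurable_indic.
have intPhi : fine (\int[L]_t (Phi t)%:E)%E = \sum_(w : n.-tuple bool) phi (rep w) * q w.
  (* The constant value taken off [base] becomes one more step, of index [None], to which the
     restricted measure gives mass zero. *)
  have E t : Phi t = \sum_(w <- None :: map Some (index_enum (n.-tuple bool : finType)))
      (if w is Some w then phi (rep w) else phi (rep [::])) *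
      \1_(if w is Some w then slot q0 qs w else ~` base q) t.
    rewrite /Phi (path_sum q0 qs phi) big_cons big_map.
    by rewrite addrC.
  under eq_integral do rewrite E.
  rewrite integral_step_fun//; last by case=> [w|]; [exact: ms|exact: measurableC].
  rewrite big_cons big_map /L /= /mrestr /= setIT setICl measure0 mulr0 add0r.
  apply: eq_bigr => w _; congr (_ * _).
  rewrite setIT setIidl; last exact: slot_base.
  by rewrite /slot lebesgue_half_open.
rewrite -intPhi cubeE.
apply: (@le_trans _ _ (eta / (q [::] + 1) * fine (L setT))).
  apply: (@integral_close _ _ _ _ _ measurableT LToo _ _ M) => //.
  - exact: measurableT_comp.
  - by move=> t _; exact/phiM/limit_pt_cube.
  - by move=> t _; exact/phiM/path_cube.
  - move=> t _; apply: delP => //; first exact: path_cube.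
    by move=> i; exact: NP.
rewrite LT /= mulrAC ler_pdivrMr// ler_pM2l// lerDl//.
Qed.

Lemma rep_nonempty (w : seq bool) (x : V) : cube x -> cell w x -> cell w (rep w : V).
Proof. by move=> cx wx; rewrite /rep; case: xgetP => [y _ []//|/(_ x)]; case. Qed.

Definition word m (x : V) : m.-tuple bool := [tuple bit i x | i < m].

Lemma cell_word m x : cell (word m x) x.
Proof.
move=> p; rewrite size_tuple => pm.
by rewrite (nth_map (Ordinal pm)) ?size_enum_ord// nth_enum_ord.
Qed.

Lemma cell_wordP m (w : m.-tuple bool) x : cell w x -> w = word m x.
Proof.
move=> wx; apply: val_inj; apply: (@eq_from_nth _ false); first by rewrite !size_tuple.
move=> p; rewrite size_tuple => pm; rewrite -(wx p) ?size_tuple//.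
by rewrite (@cell_word m x p) ?size_tuple.
Qed.

Variables (U : set_system nat).
Hypothesis UU : UltraFilter U.
Variables (I : nat -> finType) (y : forall n, I n -> V) (c : forall n, I n -> R) (C : R).
Hypothesis y_cube : forall n k, cube (@y n k).
Hypothesis c_ge0 : forall n k, 0 <= @c n k.
Hypothesis c_le : forall n, \sum_k @c n k <= C.

Lemma weak_sum_bound (F : forall n, I n -> R) M n : 0 <= M -> (forall k, `|F n k| <= M) ->
  `|\sum_k @c n k * F n k| <= C * M.
Proof.
move=> M0 FM; apply: (le_trans (ler_norm_sum _ _ _)).
apply: le_trans (ler_wpM2r M0 (c_le n)); rewrite mulr_suml; apply: ler_sum => k _.
by rewrite normrM (ger0_norm (c_ge0 _)) ler_wpM2l.
Qed.

Let mass n (w : seq bool) := \sum_k @c n k * `[< cell w (@y n k) >]%:R.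
(** An ultralimit of measures keeps finite additivity only, and [tree_measure] asks for no more. *)
Let q w := ulim U (mass^~ w).

Let mass_bound n w : `|mass n w| <= C * 1.
Proof.
by apply: (@weak_sum_bound (fun n k => `[< cell w (@y n k) >]%:R)) => // k; case: asbool; rewrite ?normr1 ?normr0.
Qed.

Let mass_ge0 n w : 0 <= mass n w.
Proof. by apply: sumr_ge0 => k _; rewrite mulr_ge0. Qed.

Let q_ge0 w : 0 <= q w.
Proof.
apply: (@ulim_ge0 _ _ _ _ (C * 1)) => n; rewrite mass_ge0.
exact: (le_trans (ler_norm _) (mass_bound n w)).
Qed.

Let q_split w : q w = q (rcons w false) + q (rcons w true).
Proof.
rewrite -[q (rcons w false)]mul1r -(ulim_linear 1 (mass_bound^~ _) (mass_bound^~ _)).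
congr ulim; apply/funext => n; rewrite mul1r -big_split; apply: eq_bigr => k _ /=.
rewrite -mulrDr -natrD; congr (_ * _%:R).
have E b : `[< cell (rcons w b) (@y n k) >] = `[< cell w (@y n k) >] && (bit (size w) (@y n k) == b).
  by apply/asboolP/andP; rewrite cell_rcons /= => -[h1 h2]; split; [exact/asboolP|exact/eqP|exact/asboolP|exact/eqP].
rewrite !{}E; case: (`[< cell w (y k) >]) => //=; by case: (bit (size w) (y k)).
Qed.

Let q_pos w : 0 < q w -> exists x : V, cube x /\ cell w x.
Proof.
move=> qw; apply: contrapT => H; move: qw; rewrite /q.
rewrite (_ : mass^~ w = fun=> 0) ?ulim_cst ?ltxx//.
apply/funext => n; apply: big1 => k _; case: asboolP; rewrite ?mulr0// => wy.
by exfalso; apply: H; exists (y k); split => //; exact: y_cube.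
Qed.

(** Both sides are compared with sums of [phi] over representatives of the cells of level [m]: the
    integral by [tree_measure], the discrete sums because [y k] and the representative of its cell
    are close. *)
Lemma weak_limit : exists mu : {measure set V -> \bar R}, [/\ (mu setT < +oo)%E, mu (~` cube) = 0%E &
  forall phi, continuous phi ->
    fine (\int[mu]_x (phi x)%:E)%E = ulim U (fun n => \sum_k @c n k * phi (@y n k))].
Proof.
have [mu [muT muC muI]] := tree_measure q_ge0 q_split q_pos.
exists mu; split=> //; first by rewrite muT ltry.
move=> phi cphi; have [M0 phiM0] := continuous_cube_bounded cphi.
pose M := Num.max M0 0.
have M_ge0 : 0 <= M by rewrite le_max lexx orbT.
have phiM x : cube x -> `|phi x| <= M by move=> /phiM0 h; rewrite le_max h.
have C0 : 0 <= C by apply: le_trans (c_le 0%N); exact: sumr_ge0.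
have bS n : `|\sum_k @c n k * phi (@y n k)| <= C * M.
  by apply: (@weak_sum_bound (fun n k => phi (@y n k))) => // k; exact/phiM/y_cube.
suff H eta : 0 < eta -> `|fine (\int[mu]_x (phi x)%:E)%E - ulim U (fun n => \sum_k @c n k * phi (@y n k))|
    <= eta * (1 + C).
  apply/eqP; rewrite -subr_eq0 -normr_le0; apply/ler_addgt0Pr => e e0; rewrite add0r.
  have C1 : 0 < 1 + C by rewrite ltr_wpDr.
  by have := H _ (divr_gt0 e0 C1); rewrite divfK// gt_eqF.
move=> eta0; have [N NP] := muI phi cphi eta eta0.
have [del del0 delP] := continuous_modulus cphi eta0.
have [N' N'P] := cell_small (d := d) del0.
pose m := maxn N N'.
have /NP h1 : (N <= m)%N by rewrite leq_maxl.
have h2 : `|\sum_(w : m.-tuple bool) phi (rep w) * q w - ulim U (fun n => \sum_k @c n k * phi (@y n k))|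
    <= eta * C.
  rewrite -(ulim_sum (index_enum _) (fun w : m.-tuple bool => phi (rep w)) (F := fun w n => mass n w) (C := C * 1)); last first.
    by move=> w n; exact: mass_bound.
  have E n : \sum_(w : m.-tuple bool) phi (rep w) * mass n w = \sum_k @c n k * phi (rep (word m (@y n k))).
    rewrite /mass; under eq_bigr do rewrite mulr_sumr.
    rewrite exchange_big /=; apply: eq_bigr => k _.
    rewrite (bigD1 (word m (y k)))//= big1 ?addr0 => [|w wy].
      case: asboolP; last by move=> /(_ (@cell_word _ _)).
      by rewrite mulr1 mulrC.
    case: asboolP => [/cell_wordP E|_]; last by rewrite !mulr0.
    by move: wy; rewrite E eqxx.
  under [X in ulim U X]eq_fun do rewrite E.
  have close n : `|\sum_k @c n k * phi (rep (word m (@y n k))) - \sum_k @c n k * phi (@y n k)| <= C * eta.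
    rewrite -sumrB; under eq_bigr do rewrite -mulrBr.
    apply: (@weak_sum_bound (fun n k => phi (rep (word m (@y n k))) - phi (@y n k))).
      exact: ltW.
    move=> k; apply: delP; first exact: y_cube.
    apply: (N'P (word m (y k))); rewrite ?size_tuple ?leq_maxr//.
    - exact: rep_cube.
    - apply: (@rep_nonempty _ (y k)); [exact: y_cube|exact: cell_word].
    - exact: cell_word.
  have bS' n : `|\sum_k @c n k * phi (rep (word m (@y n k)))| <= C * M.
    apply: (@weak_sum_bound (fun n k => phi (rep (word m (@y n k))))) => // k.
    by apply: phiM; exact: rep_cube.
  have := ulim_linear (U := U) (-1) bS bS'; rewrite mulN1r addrC => <-.
  have dB n : `|-1 * (\sum_k @c n k * phi (@y n k)) + \sum_k @c n k * phi (rep (word m (@y n k)))| <= eta * C.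
    by rewrite mulN1r addrC mulrC.
  rewrite ler_norml; apply/andP; split.
    rewrite -[leLHS](ulim_cst (U := U)); apply: (ulim_le (C := `|eta * C|) (C' := eta * C)) => //.
      by move=> n; rewrite normrN.
    by move=> n; have := dB n; rewrite ler_norml => /andP[].
  rewrite -[leRHS](ulim_cst (U := U)); apply: (ulim_le (C := eta * C) (C' := `|eta * C|)) => //.
  by move=> n; have := dB n; rewrite ler_norml => /andP[].
rewrite mulrDr mulr1; apply: le_trans (lerD h1 h2); apply: le_trans (ler_normD _ _).
by rewrite addrA subrK.
Qed.

End weak_limit.

(** * Riesz representation of bounded functionals on C^1_c that only see the cube *)

Section riesz.
Context {R : realType} {d : nat}.
Local Notation V := 'rV[R]_d.
Local Notation cube := (@unit_cube R d).

Variables (T : (V -> R) -> R) (C : R).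
Hypothesis C_ge0 : 0 <= C.
Hypothesis T_linear : forall a f g, C1c f -> C1c g ->
  T (fun x => a * f x + g x) = a * T f + T g.
Hypothesis T_bounded : forall f M, C1c f -> 0 <= M -> (forall x, `|f x| <= M) -> `|T f| <= M * C.
Hypothesis T_local : forall f, C1c f -> (forall x, cube x -> f x = 0) -> T f = 0.

Let T0 : T (fun=> 0) = 0.
Proof. by apply: T_local => //; exact: C1c0. Qed.

Let T_sum (I : Type) (r : seq I) (P : pred I) (a : I -> R) (F : I -> V -> R) :
  (forall k, C1c (F k)) ->
  T (fun x => \sum_(k <- r | P k) a k * F k x) = \sum_(k <- r | P k) a k * T (F k).
Proof.
move=> gF; elim: r => [|k r IH].
  by rewrite big_nil -[RHS]T0; congr T; apply/funext => x; rewrite big_nil.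
have [Pk|Pk] := boolP (P k); rewrite big_cons ?Pk ?(negPf Pk).
  rewrite -IH -T_linear//; last exact: C1c_sum.
  by congr T; apply/funext => x; rewrite big_cons Pk.
by rewrite -IH; congr T; apply/funext => x; rewrite big_cons (negPf Pk).
Qed.

Let weight n (K : @grid d n) : R := if touch (R := R) K then T (psi K) else 0.

(** With the signs of the weights as coefficients, the spline sum is a test function bounded by 1,
    and [T] takes the total mass as its value there. *)
Let weight_sum n : \sum_(K : @grid d n) `|weight K| <= C.
Proof.
have -> : \sum_(K : @grid d n) `|weight K| = T (fun x => \sum_(K : @grid d n | touch (R := R) K) Num.sg (T (psi K)) * psi K x).
  rewrite T_sum; last exact: psi_C1c.
  rewrite [RHS]big_mkcond; apply: eq_bigr => K _; rewrite /weight.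
  by case: ifP => _; rewrite ?normr0// normrEsg.
rewrite -[C]mul1r; apply: (le_trans (ler_norm _)); apply: T_bounded => //.
  by apply: C1c_sum; exact: psi_C1c.
move=> x; apply: weighted_bound => // K _ _.
by rewrite normr_sg; case: (_ != 0).
Qed.

Let approx_cvg f : C1c f ->
  (\sum_(K : @grid d n.+1) weight K * f (pt K)) @[n --> \oo] --> T f.
Proof.
move=> cf; apply/cvgrPdist_le => e e0.
have C1 : 0 < C + 1 by rewrite ltr_wpDl.
have [cf' _] := cf.
have [del del0 delP] := continuous_modulus cf' (divr_gt0 e0 C1).
near=> n.
have n3 : 3 / n.+1%:R <= del.
  rewrite ler_pdivrMr// -ler_pdivrMl// mulrC.
  rewrite (@le_trans _ _ n%:R) ?ler_nat//; near: n; exact: nbhs_infty_ger.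
have -> : \sum_(K : @grid d n.+1) weight K * f (pt K) = T (approx n.+1 f).
  rewrite T_sum; last exact: psi_C1c.
  rewrite [RHS]big_mkcond; apply: eq_bigr => K _; rewrite /weight.
  by case: ifP => _; rewrite ?mul0r// mulrC.
(* [f psit] differs from [f] only off the cube, where [T_local] ignores it, and the
   quasi-interpolant is close to it on all of R^d, as [T_bounded] demands. *)
have cfp : C1c (fun x => f x * psit n.+1 x) by apply: C1cM => //; exact: psit_C1c.
have -> : T f = T (fun x => f x * psit n.+1 x).
  apply/eqP; rewrite -subr_eq0 addrC -mulN1r -T_linear//; apply/eqP; apply: T_local.
    exact: C1c_linear.
  by move=> x cx; rewrite psit1// mulr1 mulN1r addNr.
rewrite addrC -mulN1r -T_linear//; last exact: approx_C1c.
apply: (@le_trans _ _ (e / (C + 1) * C)).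
  apply: T_bounded; [by apply: C1c_linear => //; exact: approx_C1c|by rewrite divr_ge0// ltW|].
  move=> x; rewrite mulN1r addrC.
  apply: (@approx_close _ _ setT) => //; first by rewrite divr_ge0// ltW.
  move=> {}x y _ cy xy; apply: delP => // i; exact: le_trans (xy i) n3.
by rewrite mulrAC ler_pdivrMr// ler_pM2l// lerDl.
Unshelve. all: by end_near. Qed.

(** The positive and negative parts of the weights, placed at the sample points, are discrete
    measures of mass at most [C]; their limits along one ultrafilter represent [T] by
    [approx_cvg]. *)
Lemma riesz : exists mp mn : {measure set V -> \bar R},
  [/\ (mp setT < +oo)%E /\ (mn setT < +oo)%E,
      mp (~` cube) = 0%E /\ mn (~` cube) = 0%E &
      forall f, C1c f -> T f = fine (\int[mp]_x (f x)%:E)%E - fine (\int[mn]_x (f x)%:E)%E].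
Proof.
have [U [UU oU]] := ultraFilterLemma (@eventually_filter : ProperFilter \oo).
pose pos n (K : @grid d n.+1) := Num.max (weight K) 0.
pose neg n (K : @grid d n.+1) := Num.max (- weight K) 0.
have pos0 n K : 0 <= @pos n K by rewrite le_max lexx orbT.
have neg0 n K : 0 <= @neg n K by rewrite le_max lexx orbT.
have posC n : \sum_K @pos n K <= C.
  apply: le_trans (weight_sum n.+1); apply: ler_sum => K _.
  by rewrite /pos ge_max normr_ge0 ler_norm.
have negC n : \sum_K @neg n K <= C.
  apply: le_trans (weight_sum n.+1); apply: ler_sum => K _.
  by rewrite /neg ge_max normr_ge0 -normrN ler_norm.
have ycube n (K : @grid d n.+1) : cube (pt K) by exact: pt_cube.
have [mp [mpT mpC mpI]] := weak_limit UU ycube pos0 posC.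
have [mn [mnT mnC mnI]] := weak_limit UU ycube neg0 negC.
exists mp, mn; split=> // f cf; have [cf' _] := cf.
have [M fM] := continuous_cube_bounded cf'.
have M0 : 0 <= M by exact: le_trans (fM _ (@cube0 _ _)).
rewrite mpI// mnI//.
have bp n := @weak_sum_bound _ _ pos C pos0 posC (fun n K => f (pt K)) M n M0 (fun K => fM _ (ycube n K)).
have bn n := @weak_sum_bound _ _ neg C neg0 negC (fun n K => f (pt K)) M n M0 (fun K => fM _ (ycube n K)).
rewrite addrC -mulN1r -(ulim_linear _ bn bp); apply/esym/ulim_cvg.
apply: cvg_trans (approx_cvg cf); apply: cvg_trans (_ : _ --> (_ @ \oo)); last first.
  by apply: cvg_app; exact: oU.
apply: near_eq_cvg; apply: nearW => n.
rewrite mulN1r addrC -sumrB; apply: eq_bigr => K _; rewrite -mulrBl; congr (_ * _).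
rewrite /pos /neg; case/orP: (le_total 0 (weight K)) => h.
  by rewrite (max_idPl h) max_r ?oppr_le0// subr0.
by rewrite (max_idPr h) max_l ?oppr_ge0// sub0r opprK.
Qed.

End riesz.

(** * Strong charges *)

Section gradient_measures.
Context {R : realType} {d : nat} (lam : {measure set 'rV[R]_d -> \bar R}).
Local Notation V := 'rV[R]_d.
Local Notation cube := (@unit_cube R d).
Local Notation pint := (pint lam).
Local Notation tv := (tv lam).
Implicit Types (u f g : V -> R) (v w : V -> V).

Definition mint (m : {measure set V -> \bar R}) (D : set V) (f : V -> R) : R :=
  fine (\int[m]_(x in D) (f x)%:E)%E.

Lemma C1c_bounded f : C1c f -> exists M, forall x, `|f x| <= M.
Proof.
move=> [cf [_ [_ [K [cK fK]]]]].
have := @compact_bounded _ _ _ (@continuous_compact _ _ f K (continuous_subspaceT cf) cK).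
move=> [M [_ /(_ (M + 1))]]; rewrite ltrDl ltr01 => /(_ isT) H1.
exists (`|M + 1|) => x; have [Kx|Kx] := pselect (K x).
  by rewrite (le_trans (H1 (f x) _)) ?ler_norm//; exists x.
by rewrite fK// normr0.
Qed.

Lemma C1c_integrable (m : {measure set V -> \bar R}) D f : measurable D -> (m setT < +oo)%E -> C1c f ->
  m.-integrable D (EFin \o f).
Proof.
move=> mD mT cf; have [M fM] := C1c_bounded cf.
apply: (integrableS measurableT) => //.
apply: (bounded_integrable measurableT mT (M := M)) => [|x _]; last exact: fM.
by apply: continuous_measurable_rV; have [] := cf.
Qed.

Lemma mintE (m : {measure set V -> \bar R}) D f : measurable D -> (m setT < +oo)%E -> C1c f ->
  (\int[m]_(x in D) (f x)%:E = (mint m D f)%:E)%E.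
Proof.
move=> mD mT cf; rewrite /mint fineK//.
exact: (integrable_fin_num mD (C1c_integrable mD mT cf)).
Qed.

Lemma grad_repP u (mp mn : 'I_d -> {measure set V -> \bar R}) : isBV lam u -> (forall i, (mp i setT < +oo)%E /\ (mn i setT < +oo)%E) ->
  (grad_rep lam u mp mn <-> forall i f, C1c f ->
     pint u (pderiv i f) = - (mint (mp i) setT f - mint (mn i) setT f)).
Proof.
move=> Bu fin; have Lu := isBV_L1cube Bu.
have E i f : C1c f -> (\int[lam]_x (u x * pderiv i f x)%:E =
     - (\int[mp i]_x (f x)%:E - \int[mn i]_x (f x)%:E))%E <->
     pint u (pderiv i f) = - (mint (mp i) setT f - mint (mn i) setT f).
  move=> cf; have [mpT mnT] := fin i.
  rewrite (pintE Lu (test_fun_pderiv i cf)) !mintE// -EFinB -EFinN.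
  by split=> [[]|->].
split=> [[_ H] i f cf|H]; first exact/E/H.
by split=> // i f cf; apply/E => //; exact: H.
Qed.

(** Pairing [u] with [pderiv i f] is bounded by [tv u] times the sup of [f] and ignores [f] off the
    cube, which is what [riesz] requires. *)
Lemma grad_rep_exists u : isBV lam u -> exists mp mn, grad_rep lam u mp mn /\
  forall i, mp i (~` cube) = 0%E /\ mn i (~` cube) = 0%E.
Proof.
move=> Bu; have Lu := isBV_L1cube Bu.
have Rz i := @riesz R d (fun f => - pint u (pderiv i f)) (tv u).
have {}Rz i : exists mpn : {measure set V -> \bar R} * {measure set V -> \bar R},
  [/\ (mpn.1 setT < +oo)%E /\ (mpn.2 setT < +oo)%E,
      mpn.1 (~` cube) = 0%E /\ mpn.2 (~` cube) = 0%E &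
      forall f, C1c f -> - pint u (pderiv i f) = mint mpn.1 setT f - mint mpn.2 setT f].
  have [| | | |mp [mn H]] := Rz i; last by exists (mp, mn).
  - exact: tv_ge0.
  - move=> a f g cf cg; rewrite pderiv_linear// pint_linearr ?opprD ?mulrN//; exact: test_fun_pderiv.
  - by move=> f M cf M0 fM; rewrite normrN; exact: pint_pderiv_le.
  - by move=> f cf f0; rewrite (pint_pderiv0 _ Lu)// oppr0.
pose F i := sval (cid (Rz i)).
exists (fun i => (F i).1), (fun i => (F i).2).
have FP i := svalP (cid (Rz i)).
split; last by move=> i; have [_ ? _] := FP i.
have fin i : ((F i).1 setT < +oo)%E /\ ((F i).2 setT < +oo)%E by have [? _ _] := FP i.
apply/(grad_repP Bu fin) => i f cf; have [_ _ H] := FP i.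
by rewrite -H// opprK.
Qed.

(** Only the difference [mp i - mn i] is determined by [u]. To avoid signed measures, the given pair
    is added crosswise to one carried by the cube: the two sums have equal integrals of C^1_c
    functions, hence coincide. *)
Lemma grad_rep_outside u mp mn i A : isBV lam u -> grad_rep lam u mp mn ->
  measurable A -> A `<=` ~` cube -> mp i A = mn i A.
Proof.
move=> Bu rep mA AC.
have [mp' [mn' [rep' out]]] := grad_rep_exists Bu.
have [fin _] := rep; have [fin' _] := rep'.
have [mpT mnT] := fin i; have [mpT' mnT'] := fin' i.
have zero (m : {measure set V -> \bar R}) : m (~` cube) = 0%E -> m A = 0%E.
  move=> m0; apply/eqP; rewrite -measure_le0 -m0; apply: le_measure; rewrite ?inE//.
  by apply: measurableC; exact: measurable_cube.
have [/zero mp'0 /zero mn'0] := out i.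
pose m1 : {measure set V -> \bar R} := measure_add (mp i) (mn' i).
pose m2 : {measure set V -> \bar R} := measure_add (mp' i) (mn i).
have m1E B : m1 B = (mp i B + mn' i B)%E by exact: measure_addE.
have m2E B : m2 B = (mp' i B + mn i B)%E by exact: measure_addE.
suff : m1 A = m2 A by rewrite m1E m2E mp'0 mn'0 adde0 add0e.
apply: measure_eq_C1c => //.
- by rewrite m1E lte_add_pinfty.
- by rewrite m2E lte_add_pinfty.
move=> f cf _.
have mf : measurable_fun setT (EFin \o f).
  by apply/measurable_EFinP; apply: continuous_measurable_rV; have [] := cf.
have iT (m : {measure set V -> \bar R}) : (m setT < +oo)%E -> m.-integrable setT (EFin \o f).
  by move=> mT; exact: C1c_integrable.
rewrite /m1 /m2 !integral_measure_add//; try exact: iT.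
have /(_ i f cf) h := (grad_repP Bu fin).1 rep.
have /(_ i f cf) h' := (grad_repP Bu fin').1 rep'.
rewrite !mintE// -!EFinD; congr EFin; lra.
Qed.

(** [grad_rep] integrates over R^d and [div_action] over the cube; the contributions of the
    complement cancel by [grad_rep_outside]. *)
Lemma grad_rep_cube u mp mn i f : isBV lam u -> grad_rep lam u mp mn -> C1c f ->
  pint u (pderiv i f) = - (mint (mp i) cube f - mint (mn i) cube f).
Proof.
move=> Bu rep cf; have [fin _] := rep; have [mpT mnT] := fin i.
rewrite ((grad_repP Bu fin).1 rep i f cf).
have mc := @measurable_cube R d.
have split_int (m : {measure set V -> \bar R}) : (m setT < +oo)%E ->
    mint m setT f = mint m cube f + mint m (~` cube) f.
  move=> mT; rewrite /mint -(setUv cube).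
  apply: (@Rintegral_setU _ _ _ m) => //; first exact: measurableC.
    by rewrite setUv; exact: C1c_integrable.
  by apply/disj_setPS; rewrite setICr.
rewrite !split_int// (_ : mint (mp i) (~` cube) f = mint (mn i) (~` cube) f); first by ring.
rewrite /mint; congr fine; apply: eq_measure_integral => A mA AC.
exact: (grad_rep_outside i Bu rep).
Qed.

Lemma cube_continuousP v j : {within cube, continuous v} ->
  forall y, cube y -> (fun x => v x ord0 j) @ within cube (nbhs y) --> v y ord0 j.
Proof.
move=> /subspace_continuousP cv y cy.
apply: (@cvg_comp _ _ _ v (fun z : V => z ord0 j) _ (nbhs (v y))); first exact: cv.
exact: coord_continuous.
Qed.

Lemma cube_approx f : (forall y, cube y -> f @ within cube (nbhs y) --> f y) ->
  forall eta, 0 < eta -> exists N, forall n, (N <= n)%N -> forall x, cube x ->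
    `|f x - approx n.+1 f x| <= eta.
Proof.
move=> cf eta eta0; have [del del0 H] := cube_modulus (@subset_refl _ cube) cf eta0.
exists (Num.truncn (3 / del)).+1 => n Nn x cx.
have n3 : 3 / n.+1%:R <= del.
  rewrite ler_pdivrMr// -ler_pdivrMl// mulrC.
  apply/ltW/(lt_le_trans (truncnS_gt _)); rewrite ler_nat; exact: leqW.
have := @approx_close R d cube n.+1 f eta isT (ltW eta0) _ x cx.
rewrite psit1// mulr1; apply => y z cy cz yz; apply: H => // i; exact: le_trans (yz i) n3.
Qed.

Lemma measurable_cube_continuous f : (forall y, cube y -> f @ within cube (nbhs y) --> f y) ->
  measurable_fun cube f.
Proof.
move=> cf; apply: (@measurable_fun_cvg _ _ _ cube (fun n => approx n.+1 f)).
  move=> n; apply: measurable_funTS; apply: continuous_measurable_rV.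
  by have [] := approx_C1c n.+1 f.
move=> x cx; apply/cvgrPdist_le => e e0; have [N NP] := cube_approx cf e0.
by exists N => // n /= Nn; exact: NP.
Qed.

Definition approx_field n v : V -> V := fun x => \row_j approx n (fun y => v y ord0 j) x.

Lemma approx_field_coord n v j : (fun x => approx_field n v x ord0 j) = approx n (fun y => v y ord0 j).
Proof. by apply/funext => x; rewrite mxE. Qed.

Lemma approx_field_C1c n v : C1c_field (approx_field n v).
Proof. by move=> j; rewrite approx_field_coord; exact: approx_C1c. Qed.

(** Componentwise quasi-interpolation: the coefficients are values on the cube, with weights summing
    to at most 1, so a bound on the cube passes to all of R^d. *)
Lemma field_approx v del : {within cube, continuous v} -> 0 < del ->
  exists w, [/\ C1c_field w, (forall x j, cube x -> `|v x ord0 j - w x ord0 j| <= del) &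
   forall M, (forall x j, cube x -> `|v x ord0 j| <= M) -> forall x j, `|w x ord0 j| <= M].
Proof.
move=> cv del0.
have H (j : 'I_d) := cube_approx (@cube_continuousP v j cv) del0.
pose N j := sval (cid (H j)).
pose n := \max_j N j.
exists (approx_field n.+1 v); split.
- exact: approx_field_C1c.
- move=> x j cx; rewrite mxE; apply: (svalP (cid (H j))) => //.
  exact: (leq_bigmax j).
- by move=> M vM x j; rewrite mxE; apply: approx_bound => y cy; exact: vM.
Qed.

Lemma cube_continuous_bounded v : {within cube, continuous v} ->
  exists M, forall x j, cube x -> `|v x ord0 j| <= M.
Proof.
move=> cv; have [w [cw vw _]] := field_approx cv ltr01.
have H (j : 'I_d) := C1c_bounded (cw j).
pose N j := sval (cid (H j)).
exists (\sum_j `|N j| + 1) => x j cx.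
rewrite -[v x ord0 j](subrK (w x ord0 j)) addrC (le_trans (ler_normD _ _))// lerD ?vw//.
apply: (le_trans (svalP (cid (H j)) x)); rewrite -/(N j) (bigD1 j)//=.
by apply: (le_trans (ler_norm _)); rewrite lerDl sumr_ge0.
Qed.

Lemma cube_fin (m : {measure set V -> \bar R}) : (m setT < +oo)%E -> (m cube < +oo)%E.
Proof.
by apply: le_lt_trans; apply: le_measure; rewrite ?inE//; exact: measurable_cube.
Qed.

Lemma cube_integrable (m : {measure set V -> \bar R}) v j : (m setT < +oo)%E ->
  {within cube, continuous v} -> m.-integrable cube (EFin \o (fun x => v x ord0 j)).
Proof.
move=> mT cv; have [M vM] := cube_continuous_bounded cv.
apply: (@bounded_integrable _ _ _ _ _ (@measurable_cube R d) (cube_fin mT) _ M).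
  by apply: measurable_cube_continuous; exact: cube_continuousP.
by move=> x cx; exact: vM.
Qed.

Definition flux mp mn v : R :=
  \sum_i (mint (mp i) cube (fun x => v x ord0 i) - mint (mn i) cube (fun x => v x ord0 i)).

Lemma div_actionP v u r : {within cube, continuous v} ->
  div_action lam v u r <-> exists mp mn, grad_rep lam u mp mn /\ r = - flux mp mn v.
Proof.
move=> cv; have mc := @measurable_cube R d.
have E mp mn : grad_rep lam u mp mn -> (- \sum_(i < d) (\int[mp i]_(x in cube) (v x ord0 i)%:E
    - \int[mn i]_(x in cube) (v x ord0 i)%:E))%E = (- flux mp mn v)%:E.
  move=> [fin _]; rewrite EFinN; congr (- _)%E.
  rewrite -sumEFin; apply: eq_bigr => i _; have [mpT mnT] := fin i.
  rewrite EFinB; congr (_ - _)%E; rewrite /mint fineK//; apply: (integrable_fin_num mc);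
    exact: cube_integrable.
split=> -[mp [mn [rep rE]]]; exists mp, mn; split => //.
  by apply: EFin_inj; rewrite rE E.
by rewrite rE E.
Qed.

Lemma flux_linear u mp mn a v w : grad_rep lam u mp mn ->
  {within cube, continuous v} -> {within cube, continuous w} ->
  flux mp mn (fun x => a *: v x + w x) = a * flux mp mn v + flux mp mn w.
Proof.
move=> [fin _] cv cw; rewrite /flux mulr_sumr -big_split; apply: eq_bigr => i _ /=.
have mc := @measurable_cube R d.
have E (m : {measure set V -> \bar R}) : (m setT < +oo)%E ->
    mint m cube (fun x => (a *: v x + w x) ord0 i) =
    a * mint m cube (fun x => v x ord0 i) + mint m cube (fun x => w x ord0 i).
  move=> mT; have iv := cube_integrable i mT cv; have iw := cube_integrable i mT cw.
  rewrite (_ : (fun x => _) = fun x => a * v x ord0 i + w x ord0 i); last first.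
    by apply/funext => x; rewrite !mxE.
  have iav : m.-integrable cube (EFin \o (fun x => a * v x ord0 i)).
    by have := integrableZl mc a iv; apply: eq_integrable => // x _ /=; rewrite EFinM.
  by have := RintegralD mc iav iw; rewrite (RintegralZl a mc iv).
have [mpT mnT] := fin i.
by rewrite !E//; ring.
Qed.

Lemma C1c_field_continuous w : C1c_field w -> continuous w.
Proof.
move=> cw x; have FF : Filter (nbhs x) by exact: nbhs_filter.
apply/cvgrPdist_le => e e0.
have H : \forall y \near x, forall j, `|w x ord0 j - w y ord0 j| <= e.
  apply: (@filter_forall V _ (fun j y => `|w x ord0 j - w y ord0 j| <= e) (nbhs x) FF) => j.
  by have [cj _] := cw j; have /cvgrPdist_le/(_ e e0) := cj x.
apply: (@filterS _ (nbhs x) FF _ _ _ H) => y {}H; rewrite /Num.norm /= mx_normrE.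
apply: bigmax_le => [|[i j] _]; first exact: ltW.
by rewrite !mxE ord1; exact: H.
Qed.

Lemma flux_divg u mp mn w : isBV lam u -> grad_rep lam u mp mn -> C1c_field w ->
  pint u (divg w) = - flux mp mn w.
Proof.
move=> Bu rep cw; rewrite (pint_divg (isBV_L1cube Bu) cw).
under eq_bigr do rewrite (grad_rep_cube _ Bu rep (cw _)).
by rewrite sumrN.
Qed.

Lemma div_action_divg u w : isBV lam u -> C1c_field w -> div_action lam w u (pint u (divg w)).
Proof.
move=> Bu cw; apply/div_actionP; first exact/continuous_subspaceT/C1c_field_continuous.
have [mp [mn [rep _]]] := grad_rep_exists Bu; exists mp, mn; split => //.
exact: flux_divg.
Qed.

(** [K] is the mass on the cube of one choice of gradient measures, so it depends on [u]; the users
    of this lemma remove it by letting [del] tend to 0. *)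
Lemma action_approx v u r : {within cube, continuous v} -> isBV lam u -> div_action lam v u r ->
  exists2 K, 0 <= K & forall del w, 0 <= del -> C1c_field w ->
    (forall x j, cube x -> `|v x ord0 j - w x ord0 j| <= del) ->
    `|r - pint u (divg w)| <= K * del.
Proof.
move=> cv Bu /(div_actionP _ _ cv)[mp [mn [rep ->]]]; have [fin _] := rep.
have mc := @measurable_cube R d.
exists (\sum_i (fine (mp i cube) + fine (mn i cube))).
  by apply: sumr_ge0 => i _; rewrite addr_ge0// fine_ge0.
move=> del w del0 cw vw; rewrite (flux_divg Bu rep cw).
have cw' : {within cube, continuous w} by exact/continuous_subspaceT/C1c_field_continuous.
rewrite -opprD normrN -sumrB mulr_suml.
apply: (le_trans (ler_norm_sum _ _ _)); apply: ler_sum => j _.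
have [M0 vM0] := cube_continuous_bounded cv; have [M1 wM1] := cube_continuous_bounded cw'.
have close (m : {measure set V -> \bar R}) : (m setT < +oo)%E ->
  `|mint m cube (fun x => v x ord0 j) - mint m cube (fun x => w x ord0 j)| <= del * fine (m cube).
  move=> mT; apply: (@integral_close _ _ _ _ _ mc (cube_fin mT) _ _ (Num.max M0 M1)) => //.
  - by apply: measurable_cube_continuous; exact: cube_continuousP.
  - by apply: measurable_cube_continuous; exact: cube_continuousP.
  - by move=> x cx; rewrite le_max vM0.
  - by move=> x cx; rewrite le_max wM1 ?orbT.
  - by move=> x cx; exact: vw.
have [mpT mnT] := fin j.
have := close _ mpT; have := close _ mnT.
set a := mint _ _ _; set b := mint _ _ _; set a' := mint _ _ _; set b' := mint _ _ _.
rewrite (_ : a' - a - _ = (a' - b') - (a - b)); last by ring.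
move=> h1 h2; apply: (le_trans (ler_normB _ _)); rewrite mulrDl addrC.
by rewrite (mulrC _ del) (mulrC _ del) [leRHS]addrC lerD.
Qed.

End gradient_measures.

(** * Charges as bounded linear functionals, and the isometry *)

Section charges.
Context {R : realType} {d : nat} (lam : {measure set 'rV[R]_d -> \bar R}).
Local Notation V := 'rV[R]_d.
Local Notation cube := (@unit_cube R d).
Local Notation pint := (pint lam).
Local Notation tv := (tv lam).
Local Notation isBV := (isBV lam).
Local Notation isCH := (isCH lam).
Implicit Types (u f g : V -> R) (v w : V -> V) (om : (V -> R) -> R).

Lemma le_of_forall_pos (a b c : R) : 0 <= c ->
  (forall e, 0 < e -> a <= b + c * e) -> a <= b.
Proof.
move=> c0 H; apply/ler_addgt0Pr => e e0.
have c1 : 0 < c + 1 by rewrite ltr_wpDl.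
apply: (le_trans (H _ (divr_gt0 e0 c1))); rewrite lerD2l.
by rewrite mulrCA ger_pMr// ler_pdivrMr// mul1r lerDl.
Qed.

Lemma C1c_field_linear a w1 w2 : C1c_field w1 -> C1c_field w2 ->
  C1c_field (fun x => a *: w1 x + w2 x).
Proof.
move=> c1 c2 j; have := C1c_linear a (c1 j) (c2 j); congr C1c.
by apply/funext => x; rewrite !mxE.
Qed.

Lemma pint_divg_linear u a w1 w2 : isBV u -> C1c_field w1 -> C1c_field w2 ->
  pint u (divg (fun x => a *: w1 x + w2 x)) = a * pint u (divg w1) + pint u (divg w2).
Proof.
move=> Bu c1 c2; have Lu := isBV_L1cube Bu.
rewrite !pint_divg//; last exact: C1c_field_linear.
rewrite mulr_sumr -big_split; apply: eq_bigr => i _ /=.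
rewrite -pint_linearr//; try exact: test_fun_pderiv.
congr (pint u); rewrite -(pderiv_linear i a (c1 i) (c2 i)); congr (pderiv i).
by apply/funext => x; rewrite !mxE.
Qed.

Lemma pint_divg_le u w M : isBV u -> C1c_field w -> 0 <= M ->
  (forall x j, `|w x ord0 j| <= M) -> `|pint u (divg w)| <= d%:R * M * tv u.
Proof.
move=> Bu cw M0 wM; rewrite (pint_divg (isBV_L1cube Bu) cw).
apply: (le_trans (ler_norm_sum _ _ _)).
have -> : d%:R * M * tv u = \sum_(j < d) M * tv u.
  by rewrite sumr_const card_ord -mulrA mulr_natl.
by apply: ler_sum => j _; apply: pint_pderiv_le => // x; exact: wM.
Qed.

(** The variation tests fields on all of R^d, whereas [w] is controlled on the cube alone. A spline
    approximation [w'] satisfies the bound everywhere, at a cost [K e] that vanishes with [e]. *)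
Lemma pint_divg_le_cube u w M : isBV u -> C1c_field w -> 0 <= M ->
  (forall x j, cube x -> `|w x ord0 j| <= M) -> `|pint u (divg w)| <= d%:R * M * tv u.
Proof.
move=> Bu cw M0 wM.
have cw' : {within cube, continuous w} by exact/continuous_subspaceT/C1c_field_continuous.
have [K K0 HK] := action_approx cw' Bu (div_action_divg Bu cw).
apply: (le_of_forall_pos K0) => e e0.
have [w' [cw1 ww' wM']] := field_approx cw' e0.
have h1 := HK e w' (ltW e0) cw1 ww'.
have h2 := pint_divg_le Bu cw1 M0 (wM' M wM).
rewrite -[pint u (divg w)](subrK (pint u (divg w'))).
by apply: (le_trans (ler_normD _ _)); rewrite addrC lerD.
Qed.

Lemma isCH_divg om w : C1c_field w -> (forall u, isBV u -> om u = pint u (divg w)) -> isCH om.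
Proof.
move=> cw omE; exists w; split; first exact/continuous_subspaceT/C1c_field_continuous.
by move=> u Bu; rewrite omE//; exact: div_action_divg.
Qed.

(** Two charges may use different gradient measures of the same [u], so a sum of charges is not
    visibly a charge. For a C^1_c field, [flux_divg] holds with whatever pair the other charge
    uses. *)
Lemma isCH_add_divg a om w : C1c_field w -> isCH om ->
  isCH (fun u => a * pint u (divg w) + om u).
Proof.
move=> cw [v [cv vom]].
have cw' : {within cube, continuous w} by exact/continuous_subspaceT/C1c_field_continuous.
have cav : {within cube, continuous (fun x => a *: w x + v x)}.
  apply/subspace_continuousP => x cx.
  have hw := (subspace_continuousP _ _).1 cw' x cx.
  have hv := (subspace_continuousP _ _).1 cv x cx.
  exact: (cvgD (cvgZ (cvg_cst a) hw) hv).
exists (fun x => a *: w x + v x); split => // u Bu.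
have /(div_actionP lam _ _ cv)[mp [mn [rep omE]]] := vom u Bu.
apply/(div_actionP lam _ _ cav); exists mp, mn; split => //.
by rewrite (flux_linear a rep cw' cv) omE (flux_divg Bu rep cw); ring.
Qed.

(** [w] must serve all [u] at once, but the constant of [action_approx] depends on [u]. A second
    field [w'], chosen after [u], is as close to [v] as desired; [w' - w] is at most [del + e] on
    the cube, which [pint_divg_le_cube] turns into a multiple of [tv u]. *)
Lemma isCH_approx om : isCH om -> forall eta, 0 < eta -> exists2 w, C1c_field w &
  forall u, isBV u -> `|om u - pint u (divg w)| <= eta * tv u.
Proof.
move=> [v [cv vom]] eta eta0.
have d1 : 0 < d%:R + 1 :> R by rewrite ltr_wpDl.
pose del := eta / (d%:R + 1).
have del0 : 0 < del by rewrite divr_gt0.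
have [w [cw vw _]] := field_approx cv del0.
exists w => // u Bu; have t0 := tv_ge0 lam u.
have [K K0 HK] := action_approx cv Bu (vom u Bu).
have c0 : 0 <= K + d%:R * tv u by rewrite addr_ge0 ?mulr_ge0.
apply: (le_of_forall_pos c0) => e e0.
have [w' [cw1 vw' _]] := field_approx cv e0.
have h1 := HK e w' (ltW e0) cw1 vw'.
have cww : C1c_field (fun x => -1 *: w x + w' x) by exact: C1c_field_linear.
have := pint_divg_le_cube Bu cww (addr_ge0 (ltW del0) (ltW e0)).
rewrite pint_divg_linear// mulN1r => h2.
have {}h2 : `|- pint u (divg w) + pint u (divg w')| <= d%:R * (del + e) * tv u.
  apply: h2 => x j cx; rewrite !mxE mulN1r.
  rewrite (_ : - _ + _ = (v x ord0 j - w x ord0 j) - (v x ord0 j - w' x ord0 j)); last by ring.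
  by apply: (le_trans (ler_normB _ _)); rewrite lerD ?vw ?vw'.
have -> : om u - pint u (divg w) = (om u - pint u (divg w')) + (- pint u (divg w) + pint u (divg w')).
  by rewrite [- _ + _]addrC addrA subrK.
apply: (le_trans (ler_normD _ _)); apply: (le_trans (lerD h1 h2)).
have : d%:R * del * tv u <= eta * tv u.
  by rewrite ler_wpM2r// /del mulrCA ger_pMr// ler_pdivrMr// mul1r lerDl.
lra.
Qed.

(** [div_action] picks the measures of [u1], [u2] and their combination independently; linearity is
    inherited from the approximating functionals, which are integrals against [u]. *)
Lemma isCH_linear om a u1 u2 : isCH om -> isBV u1 -> isBV u2 ->
  om (fun x => a * u1 x + u2 x) = a * om u1 + om u2.
Proof.
move=> com B1 B2; have B := isBV_linear a B1 B2.
apply/eqP; rewrite -subr_eq0 -normr_le0.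
pose u := fun x => a * u1 x + u2 x.
have c0 : 0 <= tv u + (`|a| * tv u1 + tv u2) by rewrite !addr_ge0 ?mulr_ge0 ?tv_ge0.
apply: (le_of_forall_pos c0) => e e0; rewrite add0r.
have [w cw H] := isCH_approx com e0.
have h := H u B; have h1 := H _ B1; have h2 := H _ B2.
have := pint_linearl a (isBV_L1cube B1) (isBV_L1cube B2) (test_fun_divg cw).
rewrite -/u => E.
have -> : om u - (a * om u1 + om u2) = (om u - pint u (divg w)) -
   (a * (om u1 - pint u1 (divg w)) + (om u2 - pint u2 (divg w))) by rewrite E; ring.
apply: (le_trans (ler_normB _ _)); rewrite mulrDl lerD ?(mulrC (tv u))//.
apply: (le_trans (ler_normD _ _)); rewrite normrM mulrDl lerD ?(mulrC (tv u2))//.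
by rewrite -mulrA (mulrC (tv u1)) ler_wpM2l.
Qed.

Lemma isCH_bounded om : isCH om -> exists2 K, 0 <= K & forall u, isBV u -> `|om u| <= K * tv u.
Proof.
move=> com; have [w cw H] := isCH_approx com ltr01.
have [M wM] := cube_continuous_bounded (continuous_subspaceT (A := cube) (C1c_field_continuous cw)).
have M0 : 0 <= `|M| by [].
exists (1 + d%:R * `|M|); first by rewrite addr_ge0// mulr_ge0.
move=> u Bu; rewrite mulrDl -[om u](subrK (pint u (divg w))).
apply: (le_trans (ler_normD _ _)); rewrite lerD ?H//.
apply: pint_divg_le_cube => // x j cx; exact: (le_trans (wM x j cx) (ler_norm _)).
Qed.

Lemma BVdual_norm_le om K : 0 <= K -> (forall u, isBV u -> `|om u| <= K * tv u) ->
  (BVdual_norm lam om <= K%:E)%E.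
Proof.
move=> K0 H; apply: ub_ereal_sup => _ [u [Bu u1] <-]; rewrite lee_fin.
apply: (le_trans (H u Bu)); rewrite ler_piMr//.
by rewrite -lee_fin -isBV_tv.
Qed.

Lemma BVdual_norm_ge0 om : (0 <= BVdual_norm lam om)%E.
Proof.
apply: ereal_sup_ge; exists `|om (fun=> 0)|%:E; last by rewrite lee_fin.
exists (fun=> 0) => //; split; first exact: isBV0.
by rewrite (isBV_tv (isBV0 lam)) tv0 lee_fin.
Qed.

Lemma isCH_BVdual_fin om : isCH om -> BVdual_norm lam om \is a fin_num.
Proof.
move=> /isCH_bounded[K K0 H]; rewrite ge0_fin_numE ?BVdual_norm_ge0//.
by apply: le_lt_trans (BVdual_norm_le K0 H) _; exact: ltry.
Qed.

Lemma isCH0 om : isCH om -> om (fun=> 0) = 0.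
Proof.
move=> com; have := isCH_linear 1 com (isBV0 lam) (isBV0 lam).
rewrite (_ : (fun x => 1 * 0 + 0) = fun _ : V => 0 : R); last by apply/funext => x; rewrite mulr0 addr0.
by rewrite mul1r => /eqP; rewrite -subr_eq0 opprD addrA subrr add0r oppr_eq0 => /eqP.
Qed.

Lemma isBVZ a u : isBV u -> isBV (fun x => a * u x).
Proof.
move=> Bu; have := isBV_linear a Bu (isBV0 lam); congr Defs.isBV.
by apply/funext => x; rewrite addr0.
Qed.

Lemma tvZ a u : isBV u -> tv (fun x => a * u x) <= `|a| * tv u.
Proof.
move=> Bu; have := tv_linear a Bu (isBV0 lam); rewrite tv0 addr0.
by under [X in tv X <= _ -> _]eq_fun do rewrite addr0.
Qed.

Lemma isCHZ om a u : isCH om -> isBV u -> om (fun x => a * u x) = a * om u.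
Proof.
move=> com Bu; have := isCH_linear a com Bu (isBV0 lam).
rewrite (isCH0 com) addr0 => <-; congr om.
by apply/funext => x; rewrite addr0.
Qed.

Lemma isCH_le_norm om u K : isCH om -> isBV u -> (BVdual_norm lam om <= K%:E)%E ->
  `|om u| <= tv u * K.
Proof.
move=> com Bu omK; have t0 := tv_ge0 lam u.
have K0 : 0 <= K by rewrite -lee_fin (le_trans (BVdual_norm_ge0 om)).
(* [tv u] may be [0], so [u] is normalised by a positive [t >= tv u], later [tv u + e]. *)
have key t : 0 < t -> tv u <= t -> `|om u| <= t * K.
  move=> tp ut; rewrite mulrC -ler_pdivrMr// -[X in _ / X]gtr0_norm// -normfV -normrM mulrC.
  rewrite -isCHZ// -lee_fin; apply: le_trans omK; apply: ereal_sup_ubound.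
  exists (fun x => t^-1 * u x) => //; have B := isBVZ t^-1 Bu; split => //.
  rewrite (isBV_tv B) lee_fin (le_trans (tvZ _ Bu))// normfV gtr0_norm//.
  by rewrite ler_pdivrMl// mulr1.
apply: (le_of_forall_pos K0) => e e0.
by apply: (le_trans (key (tv u + e) _ _)); [exact: ltr_wpDl|rewrite lerDl ltW|rewrite mulrDl (mulrC e)].
Qed.

Lemma Upsilon_isCHdual u : isBV u -> isCHdual lam (Upsilon u).
Proof.
move=> Bu; split => //; exists (tv u); split; first exact: tv_ge0.
move=> om com; rewrite -(fineK (isCH_BVdual_fin com)) -EFinM lee_fin.
by apply: isCH_le_norm => //; rewrite fineK//; exact: isCH_BVdual_fin.
Qed.

Lemma pint_divg_norm_le u w : isBV u -> C1c_field w -> sup_norm_le1 w ->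
  `|pint u (divg w)| <= tv u.
Proof.
move=> Bu cw w1.
have c0 : C1c_field (fun _ : V => 0 : V).
  by move=> j; have := @C1c0 R d; congr C1c; apply/funext => x; rewrite mxE.
have cw' := C1c_field_linear (-1) cw c0.
have w1' : sup_norm_le1 (fun x => -1 *: w x + 0).
  move=> x; apply: le_trans (w1 x).
  by rewrite le_eqVlt; apply/orP; left; apply/eqP/eq_bigr => j _; rewrite !mxE addr0 mulN1r sqrrN.
rewrite ler_norml (pint_divg_le_tv Bu cw w1) andbT lerNl.
have := pint_divg_le_tv Bu cw' w1'; rewrite pint_divg_linear// mulN1r.
have -> : pint u (divg (fun _ : V => 0 : V)) = 0.
  have := pint_divg_linear 1 Bu c0 c0; rewrite mul1r.
  rewrite (_ : (fun x => _) = fun _ : V => 0 : V); last by apply/funext => x; rewrite scaler0 addr0.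
  by move/eqP; rewrite -subr_eq0 opprD addrA subrr add0r oppr_eq0 => /eqP.
by rewrite addr0.
Qed.

(** For the lower bound, each field admissible in the variation defines a charge of dual norm at
    most 1, by [pint_divg_norm_le]. *)
Lemma Upsilon_isometry u : isBV u -> CHdual_norm lam (Upsilon u) = TV_norm lam u.
Proof.
move=> Bu; apply/eqP; rewrite eq_le; apply/andP; split.
  apply: ub_ereal_sup => _ [om [com om1] <-]; rewrite (isBV_tv Bu) lee_fin.
  by rewrite -[leRHS]mulr1; exact: isCH_le_norm.
apply: ub_ereal_sup => _ [w [cw w1] <-].
rewrite (pintE (isBV_L1cube Bu) (test_fun_divg cw)).
apply: (@le_trans _ _ `|pint u (divg w)|%:E); first by rewrite lee_fin ler_norm.
apply: ereal_sup_ubound; exists (fun u => pint u (divg w)) => //; split.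
  exact: (isCH_divg cw).
by apply: BVdual_norm_le => // u' Bu'; rewrite mul1r; exact: pint_divg_norm_le.
Qed.

End charges.

(** * Poincare inequality and injectivity *)

Section tensor_sums.
Context {R : realType} {d : nat}.

(** The sum over the grid factors into one sum per coordinate; coordinate [j] supplies [A], the
    others at most 1. *)
Lemma sum_tens_le (m : nat) (F : 'I_d -> 'I_m -> R) (j : 'I_d) A : 0 <= A ->
  (forall i k, 0 <= F i k) -> \sum_k F j k <= A ->
  (forall i, i != j -> \sum_k F i k <= 1) ->
  \sum_(K : {ffun 'I_d -> 'I_m}) \prod_i F i (K i) <= A.
Proof.
move=> A0 F0 FA F1; rewrite -(bigA_distr_bigA F) (bigD1 j)//=.
rewrite -[leRHS]mulr1; apply: ler_pM => //.
- exact: sumr_ge0.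
- by apply: prodr_ge0 => i _; exact: sumr_ge0.
- by apply: prodr_ile1 => i ij; rewrite sumr_ge0//=; exact: F1.
Qed.

End tensor_sums.

Section poincare.
Context {R : realType} {d : nat} (lam : {measure set 'rV[R]_d -> \bar R}).
Local Notation V := 'rV[R]_d.
Local Notation cube := (@unit_cube R d).
Local Notation pint := (pint lam).
Local Notation tv := (tv lam).
Local Notation isBV := (isBV lam).
Local Notation isCH := (isCH lam).
Variable j0 : 'I_d.

(* A primitive of [psi1 n k] minus its copy translated by 3, which no longer meets [0, 1]. *)
Definition prim1 n (k : nat) (t : R) : R :=
  n%:R^-1 * (ibump (n%:R * (t + 2) - k%:R) - ibump (n%:R * (t + 2) - (k + 3 * n)%:R)).

Lemma C1_1_prim1 n k : (0 < n)%N ->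
  C1_1 (prim1 n k) (fun t => psi1 n k t - psi1 n (k + 3 * n) t).
Proof.
move=> n0; have nn0 : n%:R != 0 :> R by rewrite pnatr_eq0 -lt0n.
have di b (t : R) : is_derive t 1 (fun s : R => ibump (n%:R * (s + 2) - b)) (n%:R * bump (n%:R * (t + 2) - b)).
  by apply: is_derive_affine; exact: is_derive_ibump.
split=> [t|].
  have d1 := is_deriveB (di k%:R t) (di (k + 3 * n)%:R t).
  have := is_deriveZ n%:R^-1 d1; move/is_derive_eq; apply.
  by rewrite /GRing.scale /= -mulrBr mulKf.
have c1 b : continuous (psi1 (R := R) n b) by exact: C1_1_continuous (C1_1_psi1 n b).
by move=> t; exact: (cvgB (c1 k t) (c1 (k + 3 * n)%N t)).
Qed.

Lemma prim1_le n k t : `|prim1 n k t| <= n%:R^-1.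
Proof.
rewrite /prim1 normrM ger0_norm ?invr_ge0// ler_piMr ?invr_ge0//.
have /andP[h1 h2] := ibump_itv (n%:R * (t + 2) - k%:R).
have /andP[h3 h4] := ibump_itv (n%:R * (t + 2) - (k + 3 * n)%:R).
by rewrite ler_norml; apply/andP; split; lra.
Qed.

Definition prim n (K : @grid d n) : V -> R :=
  tens (upd (fun i => psi1 n (K i)) j0 (prim1 n (K j0))).

Lemma C1_1_upd (f f' : 'I_d -> R -> R) (g g' : R -> R) :
  (forall i, C1_1 (f i) (f' i)) -> C1_1 g g' ->
  forall i, C1_1 (upd f j0 g i) (upd f' j0 g' i).
Proof. by move=> cf cg i; rewrite /upd; case: eqP. Qed.

Lemma psi1_out n (k : nat) (t : R) : (0 < n)%N -> (k < 4 * n)%N -> ~~ (-2 <= t <= 8) -> psi1 n k t = 0.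
Proof.
move=> n0 k4; apply: contraNeq => /psi1_neq0 /andP[h1 h2].
have n1 : 1 <= n%:R :> R by rewrite ler1n.
have k1 : k%:R + 1 <= 4 * n%:R :> R by rewrite -natrM natr1 ler_nat.
have k0 : 0 <= k%:R :> R by [].
apply/andP; split; nra.
Qed.

Lemma prim1_out n (k : nat) (t : R) : (0 < n)%N -> (k < 4 * n)%N -> ~~ (-2 <= t <= 8) -> prim1 n k t = 0.
Proof.
move=> n0 k4; rewrite negb_and -!ltNge => t28.
have n1 : 1 <= n%:R :> R by rewrite ler1n.
have k1 : k%:R + 1 <= 4 * n%:R :> R by rewrite -natrM natr1 ler_nat.
have k0 : 0 <= k%:R :> R by [].
rewrite /prim1 natrD natrM; case/orP: t28 => ht.
  by rewrite !ibump_le0 ?subrr ?mulr0//; nra.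
by rewrite !ibump_ge3 ?subrr ?mulr0//; nra.
Qed.

Lemma prim_C1c n (K : @grid d n) : (0 < n)%N -> C1c (prim K).
Proof.
move=> n0.
(* At [t = 8] the argument of the translated primitive is at least [10 n - (4 n - 1) - 3 n >= 3], so
   from there on both primitives equal 1 and cancel. *)
apply: (@C1c_tens _ _ _ _ (-2) 8 (C1_1_upd (fun i => C1_1_psi1 _ _) (C1_1_prim1 (K j0) n0))) => i t ht.
by rewrite /upd; case: eqP => _; [exact: prim1_out|exact: psi1_out].
Qed.

Lemma pderiv_prim n (K : @grid d n) x : (0 < n)%N -> cube x -> pderiv j0 (prim K) x = psi K x.
Proof.
move=> n0 cx.
rewrite (pderiv_tens j0 (C1_1_upd (fun i => C1_1_psi1 _ _) (C1_1_prim1 (K j0) n0))).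
rewrite !tens_upd /psi (tensD1 _ j0); congr (_ * _); last first.
  by apply: eq_bigr => i ij; rewrite /upd (negPf ij).
rewrite {1}/upd eqxx [X in _ - X](_ : _ = 0) ?subr0//.
(* For [t <= 1] the translate has argument [n (t + 2) - k - 3 n <= 0]. *)
apply: bump_out; rewrite negb_and -!leNgt; apply/orP; left.
have /andP[x0 x1] := cx j0.
have n1 : 1 <= n%:R :> R by rewrite ler1n.
have k0 : 0 <= (K j0)%:R :> R by [].
rewrite natrD natrM; nra.
Qed.

(** There are [4 n] indices in direction [j0], each with a primitive of size at most [1/n]. *)
Lemma prim_sum_le n x : (0 < n)%N -> \sum_(K : @grid d n) `|prim K x| <= 4.
Proof.
move=> n0.
pose F (i : 'I_d) (k : 'I_(4 * n)) := if i == j0 then `|prim1 n k (x ord0 i)| else psi1 n k (x ord0 i).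
have -> : \sum_(K : @grid d n) `|prim K x| = \sum_(K : @grid d n) \prod_i F i (K i).
  apply: eq_bigr => K _; rewrite /prim /tens normr_prod; apply: eq_bigr => i _.
  rewrite /F /upd; case: eqP => [->//|_]; by rewrite ger0_norm ?psi1_ge0.
apply: (@sum_tens_le _ _ _ _ j0) => //.
- by move=> i k; rewrite /F; case: ifP => _ //; exact: psi1_ge0.
- rewrite /F eqxx; apply: (@le_trans _ _ (\sum_(k < 4 * n) n%:R^-1)).
    by apply: ler_sum => k _; exact: prim1_le.
  by rewrite sumr_const card_ord -[leLHS]mulr_natl natrM mulfK// pnatr_eq0 -lt0n.
- by move=> i /negPf ij; rewrite /F ij; have /andP[] := psi1_sum_itv n (4 * n) (x ord0 i).
Qed.

Definition prim_approx n (f : V -> R) (x : V) : R := \sum_(K : @grid d n | touch (R := R) K) f (pt K) * prim K x.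

Lemma prim_approx_C1c n (f : V -> R) : (0 < n)%N -> C1c (prim_approx n f).
Proof.
move=> n0.
exact: (C1c_sum (index_enum (@grid d n)) (@touch R d n) (fun K : @grid d n => f (pt K)) (fun K => prim_C1c K n0)).
Qed.

Lemma pderiv_prim_approx n f x : (0 < n)%N -> cube x ->
  pderiv j0 (prim_approx n f) x = approx n f x.
Proof.
move=> n0 cx.
have -> := pderiv_sum j0 (index_enum (@grid d n)) (@touch R d n) (fun K : @grid d n => f (pt K)) (fun K => prim_C1c K n0).
by apply: eq_bigr => K _; rewrite pderiv_prim.
Qed.

Lemma prim_approx_le n f M x : (0 < n)%N -> (forall y, cube y -> `|f y| <= M) ->
  `|prim_approx n f x| <= 4 * M.
Proof.
move=> n0 fM; apply: (le_trans (ler_norm_sum _ _ _)).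
have M0 : 0 <= M by exact: le_trans (fM _ (@cube0 _ _)).
apply: (@le_trans _ _ (M * \sum_(K : @grid d n) `|prim K x|)); last first.
  by rewrite mulrC ler_wpM2r// prim_sum_le.
rewrite [X in M * X](bigID (@touch R d n)) /= mulrDr.
rewrite -[leLHS]addr0 lerD//; last by rewrite mulr_ge0// sumr_ge0.
rewrite mulr_sumr; apply: ler_sum => K _.
by rewrite normrM ler_wpM2r// fM//; exact: pt_cube.
Qed.

Lemma continuous_cube_cvg (f : V -> R) : continuous f ->
  forall y, cube y -> f @ within cube (nbhs y) --> f y.
Proof. by move=> cf y _; apply: cvg_within_filter; exact: cf. Qed.

Lemma pint_approx u f : L1cube lam u -> continuous f ->
  forall eta, 0 < eta -> exists N, forall n, (N <= n)%N ->
    `|pint u f - pint u (approx n.+1 f)| <= eta.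
Proof.
move=> Lu cf eta eta0.
have n1 := norm1_ge0 lam u.
have e0 : 0 < eta / (norm1 lam u + 1) by rewrite divr_gt0// ltr_wpDl.
have [N NP] := cube_approx (continuous_cube_cvg cf) e0.
exists N => n Nn.
have gf := test_fun_continuous cf; have ga := test_fun_C1c (approx_C1c n.+1 f).
rewrite distrC addrC -mulN1r -pint_linearr//.
apply: (@le_trans _ _ (eta / (norm1 lam u + 1) * norm1 lam u)).
  apply: pint_le_norm1 => //; [exact: test_fun_linear|exact: ltW|].
  by move=> x cx; rewrite mulN1r addrC distrC; exact: NP.
by rewrite mulrAC ler_pdivrMr ?ltr_wpDl// ler_pM2l// lerDl.
Qed.

Lemma pint_approx_prim u n f : (0 < n)%N -> L1cube lam u ->
  pint u (approx n f) = pint u (pderiv j0 (prim_approx n f)).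
Proof.
move=> n0 Lu; apply: eq_pint => //.
- exact/test_fun_C1c/approx_C1c.
- exact/test_fun_pderiv/prim_approx_C1c.
- by move=> x cx; rewrite pderiv_prim_approx.
Qed.

Lemma poincare u f M : isBV u -> continuous f -> (forall y, cube y -> `|f y| <= M) ->
  `|pint u f| <= 4 * M * tv u.
Proof.
move=> Bu cf fM; have Lu := isBV_L1cube Bu.
have M0 : 0 <= M by exact: le_trans (fM _ (@cube0 _ _)).
apply: (@le_of_forall_pos _ _ _ 1) => // e e0; rewrite mul1r.
have [N /(_ N (leqnn N)) h] := pint_approx Lu cf e0.
rewrite -[pint u f](subrK (pint u (approx N.+1 f))) addrC.
apply: (le_trans (ler_normD _ _)); rewrite lerD// pint_approx_prim//.
apply: pint_pderiv_le => //; [exact: prim_approx_C1c|by rewrite mulr_ge0|].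
by move=> x; exact: prim_approx_le.
Qed.

Lemma pint_eq0 u : L1cube lam u -> (forall g j, C1c g -> pint u (pderiv j g) = 0) ->
  forall f, continuous f -> pint u f = 0.
Proof.
move=> Lu u0 f cf; apply/eqP; rewrite -normr_le0.
apply: (@le_of_forall_pos _ _ _ 1) => // e e0; rewrite mul1r add0r.
have [N /(_ N (leqnn N))] := pint_approx Lu cf e0.
by rewrite pint_approx_prim// u0 ?subr0//; exact: prim_approx_C1c.
Qed.

Lemma box_integral0 u a b : L1cube lam u -> (forall f, continuous f -> pint u f = 0) ->
  (\int[lam]_(x in obox a b) (u x)%:E = 0)%E.
Proof.
move=> Lu u0; have [mu iu _] := Lu.
have mob : measurable (obox a b) by exact: measurable_obox.
have mF n : measurable_fun [set: V] (fun x => (u x * boxfun a b n x)%:E).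
  by apply/measurable_EFinP; apply: measurable_funM => //; exact: measurable_boxfun.
have mG : measurable_fun [set: V] (fun x => (u x * \1_(obox a b) x)%:E).
  by apply/measurable_EFinP; apply: measurable_funM => //; exact: measurable_indic.
have c1 : {ae lam, forall x, setT x -> (u x * boxfun a b n x)%:E @[n --> \oo] --> (u x * \1_(obox a b) x)%:E}.
  apply: aeW => x _ /=; under eq_fun do rewrite EFinM; rewrite EFinM.
  by apply: cvgeZl => //; exact: boxfun_cvg.
have d1 : {ae lam, forall x n, setT x -> (`|(u x * boxfun a b n x)%:E| <= `|(u x)%:E|)%E}.
  apply: aeW => x n _ /=; rewrite lee_fin normrM ler_piMr//.
  by have /andP[h1 h2] := boxfun_itv a b n x; rewrite ger0_norm.
have iu' : lam.-integrable [set: V] (fun x => `|(u x)%:E|)%E by exact: integrable_abse.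
have [_ _ c] := dominated_convergence measurableT mF mG c1 iu' d1.
have E : (\int[lam]_x (u x * \1_(obox a b) x)%:E = 0)%E.
  apply: (@cvg_unique _ (@ereal_hausdorff R) _ _ _ _ c).
  rewrite (_ : [sequence _]_n = cst 0%E); first exact: cvg_cst.
  apply/funext => n /=.
  have cb : continuous (boxfun a b n) by have [] := boxfun_C1c a b n.
  by rewrite (pintE Lu (test_fun_continuous cb)) u0.
rewrite -E integral_mkcond; apply: eq_integral => x _.
by rewrite patchE indicE; case: (x \in obox a b); rewrite ?mulr1 ?mulr0.
Qed.

(** The densities [h^\+] and [h^\-] define two finite measures that agree on open boxes, hence on
    all Borel sets; so the integral of [u] over each of them vanishes. *)
Lemma ae_eq0_of_pairing u : L1cube lam u -> (forall f, continuous f -> pint u f = 0) ->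
  {ae lam, forall x, u x = 0}.
Proof.
move=> Lu u0; have [mu iu _] := Lu.
pose h := EFin \o u.
have mh : measurable_fun [set: V] h by exact/measurable_EFinP.
pose dens (g : V -> \bar R) (A : set V) := (\int[lam]_(x in A) g x)%E.
have dmeas (g : V -> \bar R) : measurable_fun setT g -> (forall x, (0 <= g x)%E) ->
    exists m : {measure set V -> \bar R}, forall A, m A = dens g A.
  move=> mg g0.
  have m0 : dens g set0 = 0%E by rewrite /dens integral_set0.
  have mge0 A : (0 <= dens g A)%E by apply: integral_ge0.
  have msig : semi_sigma_additive (dens g).
    move=> F mF tF mUF; rewrite /dens ge0_integral_bigcup//; last exact: measurable_funTS.
    by apply: is_cvg_ereal_nneg_natsum_cond => n _ _; exact: integral_ge0.
  pose m : {measure set V -> \bar R} := HB.pack (dens g) (isMeasure.Build _ _ _ (dens g) m0 mge0 msig).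
  by exists m.
have [mp mpE] := dmeas h^\+%E (measurable_funepos mh) (fun x => funepos_ge0 h x).
have [mn mnE] := dmeas h^\-%E (measurable_funeneg mh) (fun x => funeneg_ge0 h x).
have hE A : (\int[lam]_(x in A) h x = mp A - mn A)%E by rewrite mpE mnE -integralE.
have mpT : (mp setT < +oo)%E by rewrite mpE; exact: integral_funepos_lt_pinfty.
have mnT : (mn setT < +oo)%E by rewrite mnE; exact: integral_funeneg_lt_pinfty.
have fin (m : {measure set V -> \bar R}) A : measurable A -> (m setT < +oo)%E -> m A \is a fin_num.
  move=> mA mT; rewrite ge0_fin_numE//; apply: le_lt_trans mT.
  by apply: le_measure; rewrite ?inE.
have mpn A : measurable A -> mp A = mn A.
  apply: measure_eq_obox => // a b.
  have mob : measurable (obox a b) by exact: measurable_obox.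
  have := hE (obox a b); rewrite /h box_integral0//.
  rewrite -(fineK (fin mp _ mob mpT)) -(fineK (fin mn _ mob mnT)) -EFinB => -[/esym/eqP].
  by rewrite subr_eq0 => /eqP ->.
have := @integral_ae_eq _ _ _ lam setT measurableT (cst 0%E) h iu (measurable_cst _) _.
have Z E : E `<=` setT -> measurable E -> (\int[lam]_(x in E) h x = \int[lam]_(x in E) cst 0%E x)%E.
  by move=> _ mE; rewrite hE mpn// subee ?fin// integral0.
by move=> /(_ Z); apply: filterS => x /(_ I) [].
Qed.

Lemma Upsilon_injective u1 u2 : isBV u1 -> isBV u2 ->
  (forall om, isCH om -> Upsilon u1 om = Upsilon u2 om) -> {ae lam, forall x, u1 x = u2 x}.
Proof.
move=> B1 B2 H; pose u := fun x => -1 * u1 x + u2 x.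
have Bu : isBV u by exact: isBV_linear.
have Lu := isBV_L1cube Bu.
have : {ae lam, forall x, u x = 0}.
  apply: ae_eq0_of_pairing => //; apply: pint_eq0 => // g j cg.
  rewrite /u pint_linearl ?mulN1r; [|exact: isBV_L1cube|exact: isBV_L1cube|exact: test_fun_pderiv].
  have := H (fun u => pint u (divg (single j g))) (isCH_divg (C1c_single j cg) (fun _ _ => erefl)).
  by rewrite /Upsilon divg_single// => ->; rewrite addNr.
by apply: filterS => x; rewrite /u mulN1r addrC => /eqP; rewrite subr_eq0 => /eqP ->.
Qed.

End poincare.

(** * Grid refinement *)

Section refinement.
Context {R : realType} {d : nat}.
Local Notation V := 'rV[R]_d.

(* Coordinates below [j] from [b], the others from [a]: the intermediate products of the telescoping of [tens a - tens b]. *)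
Definition mix (j : nat) (a b : 'I_d -> R -> R) : 'I_d -> R -> R :=
  fun i => if (i < j)%N then b i else a i.

(** Each term changes a single factor, so it is a [j]-derivative as soon as the difference of the
    two factors has a primitive. *)
Lemma tens_telescope (a b : 'I_d -> R -> R) (x : V) :
  tens a x - tens b x = \sum_(j < d) tens (upd (mix j a b) j (fun t => a j t - b j t)) x.
Proof.
pose T j := tens (mix j a b) x.
have -> : tens a x = T 0%N by [].
have -> : tens b x = T d by apply: eq_bigr => i _; rewrite /mix ltn_ord.
have -> : T 0%N - T d = \sum_(0 <= j < d) (T j - T j.+1).
  have := @telescope_sumr R 0 d (fun j => - T j) (leq0n _).
  by rewrite opprK addrC => <-; apply: eq_bigr => j _; rewrite opprK addrC.
rewrite big_mkord; apply: eq_bigr => j _.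
rewrite /T (tensD1 _ j) (tensD1 (mix j.+1 a b) j) tens_upd.
rewrite {1 3}/mix ltnn ltnS leqnn mulrBl; congr (_ - _ * _).
apply: eq_bigr => i ij; rewrite /mix ltnS leq_eqVlt.
by have -> : (i == j :> nat) = false by apply/negbTE.
Qed.

Lemma sum_half (g : nat -> R) m : \sum_(k < 2 * m) g k./2 = 2 * \sum_(k < m) g k.
Proof.
elim: m => [|m IH]; first by rewrite muln0 !big_ord0 mulr0.
rewrite mulnS add2n !big_ord_recr /= IH mulrDr -addrA; congr (_ + _).
by rewrite mul2n doubleK uphalf_double; ring.
Qed.

(** [ramp (s + 1) - ramp s] is a nonnegative trapezoid equal to 1 on [[0, 3]], the support of
    [bump]; being a difference, it sums over the grid to at most 4. *)
Definition ramp (s : R) : R := pospart s - pospart (s - 4).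

Lemma ramp_itv s : 0 <= ramp s <= 4.
Proof.
rewrite /ramp; have [[? ->]|[? ->]] := pospartP s; have [[? ->]|[? ->]] := pospartP (s - 4);
  apply/andP; split; lra.
Qed.

Lemma ramp_incr s : ramp s <= ramp (s + 1).
Proof.
rewrite /ramp; have [[? ->]|[? ->]] := pospartP s; have [[? ->]|[? ->]] := pospartP (s - 4);
 have [[? ->]|[? ->]] := pospartP (s + 1); have [[? ->]|[? ->]] := pospartP (s + 1 - 4); lra.
Qed.

Lemma ramp_mid s : 0 <= s <= 3 -> ramp (s + 1) - ramp s = 1.
Proof.
move=> /andP[s0 s3]; rewrite /ramp (pospart_ge s0) (@pospart_le _ (s - 4)); last lra.
rewrite (@pospart_ge _ (s + 1)); last lra.
rewrite (@pospart_le _ (s + 1 - 4)); lra.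
Qed.

(* A primitive of [psi1 (2 * n) k - 2^-1 * psi1 n k./2]; it vanishes outside a compact set since both splines have the same integral. *)
Definition corr (n k : nat) (t : R) : R :=
  (2 * n)%:R^-1 * (ibump ((2 * n)%:R * (t + 2) - k%:R) - ibump (n%:R * (t + 2) - (k./2)%:R)).

Lemma C1_1_corr n k : (0 < n)%N ->
  C1_1 (corr n k) (fun t => psi1 (2 * n) k t - 2^-1 * psi1 n k./2 t).
Proof.
move=> n0; have nn0 : n%:R != 0 :> R by rewrite pnatr_eq0 -lt0n.
have di (m : nat) (b t : R) : is_derive t 1 (fun s : R => ibump (m%:R * (s + 2) - b)) (m%:R * bump (m%:R * (t + 2) - b)).
  by apply: is_derive_affine; exact: is_derive_ibump.
split=> [t|].
  have d1 := is_deriveB (di (2 * n)%N k%:R t) (di n (k./2)%:R t).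
  have := is_deriveZ (2 * n)%:R^-1 d1; move/is_derive_eq; apply.
  rewrite /GRing.scale /= /psi1 natrM; set x := bump _; set y := bump _.
  by field.
have c1 m b : continuous (psi1 (R := R) m b) by exact: C1_1_continuous (C1_1_psi1 m b).
move=> t; exact: (cvgB (c1 (2 * n)%N k t) (cvgM (cvg_cst (2^-1 : R)) (c1 n k./2 t))).
Qed.

Lemma half_odd k : (k%:R : R) = (odd k)%:R + 2 * (k./2)%:R.
Proof. by rewrite -{1}(odd_double_half k) natrD -mul2n natrM. Qed.

(** In the variable [s] of the parent spline the fine one has argument [2 s - odd k]. The two
    primitives agree for [s <= 0] and for [s >= 3], and differ by at most 1 in between. *)
Lemma corr_le n k t : (0 < n)%N -> `|corr n k t| <=
  (2 * n)%:R^-1 * (ramp (n%:R * (t + 2) - (k./2)%:R + 1) - ramp (n%:R * (t + 2) - (k./2)%:R)).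
Proof.
move=> n0; rewrite /corr normrM ger0_norm ?invr_ge0// ler_wpM2l ?invr_ge0//.
set s := n%:R * (t + 2) - (k./2)%:R.
have o01 : 0 <= ((odd k)%:R : R) <= 1 by case: (odd k); rewrite /= ?lexx ?ler01.
have -> : (2 * n)%:R * (t + 2) - k%:R = 2 * s - (odd k)%:R.
  by rewrite (half_odd k) natrM /s; ring.
have /andP[od0 od1] := o01.
have [s0|s0] := leP s 0.
  by rewrite !ibump_le0 ?subrr ?normr0 ?subr_ge0 ?ramp_incr//; lra.
have [s3|s3] := leP 3 s.
  by rewrite !ibump_ge3 ?subrr ?normr0 ?subr_ge0 ?ramp_incr//; lra.
rewrite ramp_mid; last by apply/andP; split; exact: ltW.
have /andP[h1 h2] := ibump_itv (2 * s - (odd k)%:R); have /andP[h3 h4] := ibump_itv s.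
by rewrite ler_norml; apply/andP; split; lra.
Qed.

(** Two fine indices share a parent, so the telescoped total is at most
    [(2 n)^-1 * 2 * 4 = 4 / n]. *)
Lemma corr_sum_le n t : (0 < n)%N -> \sum_(k < 4 * (2 * n)) `|corr n k t| <= 4 / n%:R.
Proof.
move=> n0; have nn0 : n%:R != 0 :> R by rewrite pnatr_eq0 -lt0n.
set a := n%:R * (t + 2).
apply: (@le_trans _ _ (\sum_(k < 4 * (2 * n)) (2 * n)%:R^-1 * (ramp (a - (k./2)%:R + 1) - ramp (a - (k./2)%:R)))).
  by apply: ler_sum => k _; exact: corr_le.
rewrite -mulr_sumr mulnCA.
rewrite (sum_half (fun k => ramp (a - k%:R + 1) - ramp (a - k%:R))).
have -> : \sum_(k < 4 * n) (ramp (a - k%:R + 1) - ramp (a - k%:R)) = ramp (a + 1) - ramp (a + 1 - (4 * n)%:R).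
  have -> : ramp (a + 1) - ramp (a + 1 - (4 * n)%:R) = - ramp (a + 1 - (4 * n)%:R) - - ramp (a + 1 - 0%:R).
    by rewrite subr0 opprK addrC.
  rewrite -(@telescope_sumr R 0 (4 * n) (fun k => - ramp (a + 1 - k%:R)))// big_mkord.
  apply: eq_bigr => k _; rewrite opprK addrC; congr (- ramp _ + ramp _).
    by rewrite -natr1; ring.
  by ring.
have /andP[h1 h2] := ramp_itv (a + 1); have /andP[h3 h4] := ramp_itv (a + 1 - (4 * n)%:R).
set r := ramp (a + 1) - _.
have -> : (2 * n)%:R^-1 * (2 * r) = r / n%:R by rewrite natrM; field.
by rewrite ler_pM2r ?invr_gt0 ?ltr0n// /r; lra.
Qed.

Lemma corr_out n (k : nat) (t : R) : (0 < n)%N -> (k < 4 * (2 * n))%N -> ~~ (-2 <= t <= 8) -> corr n k t = 0.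
Proof.
move=> n0 k4; rewrite negb_and -!ltNge => t28.
have n1 : 1 <= n%:R :> R by rewrite ler1n.
have k1 : k%:R + 1 <= 8 * n%:R :> R by rewrite -natrM natr1 ler_nat; lia.
have k0 : 0 <= k%:R :> R by [].
have kh := half_odd k.
have o01 : 0 <= ((odd k)%:R : R) <= 1 by case: (odd k); rewrite /= ?lexx ?ler01.
have /andP[od0 od1] := o01.
have h0 : 0 <= (k./2)%:R :> R by [].
rewrite /corr natrM; case/orP: t28 => ht.
  by rewrite !ibump_le0 ?subrr ?mulr0//; nra.
by rewrite !ibump_ge3 ?subrr ?mulr0//; nra.
Qed.

Lemma half_lt n (k : 'I_(4 * (2 * n))) : (k./2 < 4 * n)%N.
Proof. by have := ltn_ord k; lia. Qed.

Definition half_grid n (K : @grid d (2 * n)) : @grid d n := [ffun i => Ordinal (half_lt (K i))].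

Definition fine_factor n (K : @grid d (2 * n)) (i : 'I_d) : R -> R := psi1 (2 * n) (K i).
Definition coarse_factor n (K : @grid d (2 * n)) (i : 'I_d) (t : R) : R := 2^-1 * psi1 n (K i)./2 t.

Definition corr_field n (K : @grid d (2 * n)) (j : 'I_d) : V -> R :=
  tens (upd (mix j (fine_factor K) (coarse_factor K)) j (corr n (K j))).

Lemma C1_1_coarse n (K : @grid d (2 * n)) i :
  C1_1 (coarse_factor K i) (fun t => 2^-1 * psi1' n (K i)./2 t).
Proof.
have [d1 c1] := C1_1_psi1 (R := R) n (K i)./2; split=> t.
  by have := d1 t => ?; exact: is_deriveZ.
exact: (cvgM (cvg_cst (2^-1 : R)) (c1 t)).
Qed.

Lemma C1_1_corr_factors n (K : @grid d (2 * n)) (j : 'I_d) : (0 < n)%N -> forall i, C1_1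
  (upd (mix j (fine_factor K) (coarse_factor K)) j (corr n (K j)) i)
  (upd (mix j (fun i => psi1' (2 * n) (K i)) (fun i t => 2^-1 * psi1' n (K i)./2 t)) j
     (fun t => fine_factor K j t - coarse_factor K j t) i).
Proof.
move=> n0 i; rewrite /upd; case: eqP => _; first exact: C1_1_corr.
rewrite /mix; case: ifP => _; [exact: C1_1_coarse|exact: C1_1_psi1].
Qed.

Lemma corr_field_C1c n (K : @grid d (2 * n)) j : (0 < n)%N -> C1c (corr_field K j).
Proof.
move=> n0; apply: (@C1c_tens _ _ _ _ (-2) 8 (C1_1_corr_factors K j n0)) => i t ht.
rewrite /upd; case: eqP => _; first exact: corr_out.
rewrite /mix /coarse_factor /fine_factor; case: ifP => _.
  by rewrite psi1_out ?mulr0//; exact: half_lt.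
by apply: psi1_out => //; rewrite muln_gt0.
Qed.

Lemma pderiv_corr_field n (K : @grid d (2 * n)) j : (0 < n)%N ->
  pderiv j (corr_field K j) = tens (upd (mix j (fine_factor K) (coarse_factor K)) j
     (fun t => fine_factor K j t - coarse_factor K j t)).
Proof.
move=> n0; rewrite (pderiv_tens j (C1_1_corr_factors K j n0)).
apply/funext => x; rewrite !tens_upd; congr (_ * _); first by rewrite /upd eqxx.
by apply: eq_bigr => i /negPf ij; rewrite /upd ij.
Qed.

Lemma tens_coarse n (K : @grid d (2 * n)) x :
  tens (coarse_factor K) x = (2^-1) ^+ d * psi (half_grid K) x.
Proof.
rewrite /tens /coarse_factor big_split /= prodr_const card_ord; congr (_ * _).
by apply: eq_bigr => i _; rewrite ffunE.
Qed.

Lemma refine_divg n (K : @grid d (2 * n)) x : (0 < n)%N ->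
  psi K x - (2^-1) ^+ d * psi (half_grid K) x = \sum_j pderiv j (corr_field K j) x.
Proof.
move=> n0; rewrite -tens_coarse (tens_telescope (fine_factor K)).
by apply: eq_bigr => j _; rewrite pderiv_corr_field.
Qed.

(** Coordinate [j] gives [4 / n] by [corr_sum_le]. In a coordinate with coarse factors, the factor
    [2^-1] compensates for each parent being counted twice. *)
Lemma corr_field_sum_le n j (x : V) : (0 < n)%N ->
  \sum_(K : @grid d (2 * n)) `|corr_field K j x| <= 4 / n%:R.
Proof.
move=> n0.
pose F (i : 'I_d) (k : 'I_(4 * (2 * n))) : R := if i == j then `|corr n k (x ord0 i)|
  else if (i < j)%N then 2^-1 * psi1 n k./2 (x ord0 i) else psi1 (2 * n) k (x ord0 i).
have -> : \sum_(K : @grid d (2 * n)) `|corr_field K j x| = \sum_(K : @grid d (2 * n)) \prod_i F i (K i).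
  apply: eq_bigr => K _; rewrite /corr_field /tens normr_prod; apply: eq_bigr => i _.
  rewrite /F /upd; case: eqP => [->//|_]; rewrite /mix; case: ifP => _; rewrite ger0_norm ?psi1_ge0//.
  by rewrite mulr_ge0 ?psi1_ge0.
apply: (@sum_tens_le _ _ _ _ j) => //.
- by move=> i k; rewrite /F; case: ifP => _ //; case: ifP => _; rewrite ?mulr_ge0 ?psi1_ge0.
- by rewrite /F eqxx; exact: corr_sum_le.
- move=> i /negPf ij; rewrite /F ij; case: (boolP (i < j)%N) => _; last first.
    by have /andP[] := psi1_sum_itv (R := R) (2 * n) (4 * (2 * n)) (x ord0 i).
  rewrite -mulr_sumr mulnCA (sum_half (fun k => psi1 n k (x ord0 i))) mulKf//.
  by have /andP[] := psi1_sum_itv n (4 * n) (x ord0 i).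
Qed.

End refinement.

(** * L^1 limits of sequences with geometrically small increments *)

Section L1_limit.
Context d' (T : measurableType d') {R : realType} (m : {measure set T -> \bar R}).
Variables (v : nat -> T -> R) (c : R).
Hypothesis mv : forall n, measurable_fun [set: T] (v n).
Hypothesis iv : forall n, m.-integrable [set: T] (EFin \o v n).
Hypothesis dv : forall n, (\int[m]_x `|v n.+1 x - v n x|%:E <= (c / 2 ^+ n)%:E)%E.

Let D n x : \bar R := `|v n.+1 x - v n x|%:E.
(** [|v 0| + G] is integrable and dominates every [v n]; where [G] is finite the increments are
    absolutely summable and [v n] converges. *)
Let G x : \bar R := (\sum_(n <oo) D n x)%E.

Let D_ge0 n x : (0 <= D n x)%E. Proof. by rewrite lee_fin. Qed.

Let mD n : measurable_fun [set: T] (D n).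
Proof.
by apply/measurable_EFinP; apply: measurableT_comp => //; exact: measurable_funB.
Qed.

Let G_ge0 x : (0 <= G x)%E. Proof. exact: nneseries_ge0. Qed.

Let mG : measurable_fun [set: T] G.
Proof. by apply: (@ge0_emeasurable_sum _ _ _ setT D xpredT) => // k _; exact: mD. Qed.

Let partial_geometric n : \sum_(0 <= k < n) c / 2 ^+ k = c * (2 - 2 / 2 ^+ n).
Proof.
elim: n => [|n IH]; first by rewrite big_nil expr0 divr1 subrr mulr0.
rewrite big_nat_recr//= IH exprS; field.
by rewrite expf_neq0.
Qed.

Let c_ge0 : 0 <= c.
Proof.
have := dv 0; rewrite expr0 divr1 => h; rewrite -lee_fin; apply: le_trans h.
by apply: integral_ge0 => x _; rewrite lee_fin.
Qed.

Let iG : (\int[m]_x G x < +oo)%E.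
Proof.
rewrite /G integral_nneseries//.
apply: (@le_lt_trans _ _ (c * 2)%:E); last exact: ltry.
apply: lime_le.
  by apply: is_cvg_ereal_nneg_natsum_cond => n _ _; exact: integral_ge0.
apply: nearW => n.
apply: (@le_trans _ _ (\sum_(0 <= k < n) (c / 2 ^+ k)%:E)%E).
  by apply: lee_sum => k _; exact: dv.
rewrite sumEFin lee_fin partial_geometric ler_wpM2l// gerDl oppr_le0.
by rewrite divr_ge0// exprn_ge0.
Qed.

Let v_le n x : (`|v n x|%:E <= `|v 0 x|%:E + G x)%E.
Proof.
apply: (@le_trans _ _ (`|v 0 x|%:E + \sum_(0 <= k < n) D k x)%E); last first.
  by rewrite leeD2l//; apply: nneseries_lim_ge => k _ _.
rewrite sumEFin -EFinD lee_fin.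
elim: n => [|n IH]; first by rewrite big_nil addr0.
rewrite big_nat_recr//=; have := ler_normD (v n.+1 x - v n x) (v n x).
by rewrite subrK; move: IH; lra.
Qed.

Let v_cvg x : (G x < +oo)%E -> cvgn (fun n => v n x).
Proof.
move=> Gx; pose s k := v k.+1 x - v k x.
have gE : (fine (G x))%:E = G x by rewrite fineK// ge0_fin_numE.
have cs : cvgn (series s).
  apply: normed_cvg; apply: nondecreasing_is_cvgn.
    by apply: nondecreasing_series => k _ _ /=.
  exists (fine (G x)) => _ [n _ <-]; rewrite -lee_fin gE /series /= -sumEFin.
  by apply: nneseries_lim_ge => k _ _.
have -> : (fun n => v n x) = (fun n => series s n + v 0 x).
  by apply/funext => n; rewrite /series /= /s telescope_sumr// subrK.
by apply: is_cvgD => //; exact: is_cvg_cst.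
Qed.

Let u x : R := if (G x < +oo)%E then limn (fun n => v n x) else 0.

Let G_fin_ae : {ae m, forall x, (G x < +oo)%E}.
Proof.
have : m.-integrable [set: T] G.
  by apply/integrableP; split => //; under eq_integral do rewrite gee0_abs//.
move=> /(integrable_ae measurableT); apply: filterS => x /(_ I).
by rewrite ge0_fin_numE.
Qed.

Lemma L1_limit : exists u : T -> R, [/\ measurable_fun [set: T] u,
  m.-integrable [set: T] (EFin \o u),
  {ae m, forall x, v n x @[n --> \oo] --> u x} &
  (\int[m]_x `|v n x - u x|%:E)%E @[n --> \oo] --> 0%E].
Proof.
exists u.
have vu x : (G x < +oo)%E -> v n x @[n --> \oo] --> u x.
  by move=> Gx; rewrite /u Gx; exact: v_cvg.
have mE : measurable [set x | (G x < +oo)%E].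
  by have := measurable_lte measurableT mG (measurable_cst +oo%E); rewrite setTI.
have mu : measurable_fun [set: T] u.
  (* The indicator makes the sequence converge everywhere, with limit the default [0] of [u] where
     [G] is infinite. *)
  apply: (@measurable_fun_cvg _ _ _ setT (fun n x => v n x * \1_[set x | (G x < +oo)%E] x)).
    by move=> n; apply: measurable_funM => //; exact: measurable_indic.
  move=> x _; have [Gx|Gx] := boolP (G x < +oo)%E.
    rewrite (_ : (fun n => _) = (fun n => v n x)); first exact: vu.
    by apply/funext => n; rewrite indicE mem_set// mulr1.
  rewrite /u (negPf Gx) (_ : (fun n => _) = cst 0); first exact: cvg_cst.
  by apply/funext => n; rewrite indicE memNset ?mulr0//; exact/negP.
have ae_vu : {ae m, forall x, v n x @[n --> \oo] --> u x} by apply: filterS G_fin_ae.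
have mEv n : measurable_fun [set: T] (fun x => (v n x)%:E) by exact/measurable_EFinP.
have mEu : measurable_fun [set: T] (fun x => (u x)%:E) by exact/measurable_EFinP.
have ig : m.-integrable [set: T] (fun x => `|v 0 x|%:E + G x)%E.
  apply: integrableD => //; first exact: (integrable_norm (iv 0)).
  by apply/integrableP; split => //; under eq_integral do rewrite gee0_abs//.
have c1 : {ae m, forall x, setT x -> (v n x)%:E @[n --> \oo] --> (u x)%:E}.
  by apply: filterS ae_vu => x h _; apply: cvg_EFin => //; exact: nearW.
have d1 : {ae m, forall x n, setT x -> (`|(v n x)%:E| <= `|v 0 x|%:E + G x)%E}.
  by apply: aeW => x n _; rewrite abse_EFin; exact: v_le.
have [iu c0 _] := dominated_convergence measurableT mEv mEu c1 ig d1.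
split => //.
Qed.

End L1_limit.

(** * Half-open cells of the grid *)

Section grid_cells.
Context {R : realType} {d : nat}.
Local Notation V := 'rV[R]_d.
Local Notation cube := (@unit_cube R d).

(** The lowest corner cell of the support of [psi K], which spans three cells in each direction.
    With this choice, halving indices sends a fine cell to the coarse cell containing it. *)
Definition hbox n (K : @grid d n) : set V :=
  [set x | forall i, (K i)%:R <= n%:R * (x ord0 i + 2) < (K i)%:R + 1].

Lemma measurable_hbox n (K : @grid d n) : (0 < n)%N -> measurable (hbox K).
Proof.
move=> n0; have nn0 : 0 < n%:R :> R by rewrite ltr0n.
apply: (@measurable_coords _ _ (fun i => [set t : R | (K i)%:R <= n%:R * (t + 2) < (K i)%:R + 1])) => i.
have -> : [set t : R | (K i)%:R <= n%:R * (t + 2) < (K i)%:R + 1] =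
    `[(K i)%:R / n%:R - 2, ((K i)%:R + 1) / n%:R - 2[%classic.
  apply/seteqP; split => t /=; rewrite in_itv/= lerBlDr ltrBrDr ler_pdivrMr// ltr_pdivlMr//.
    by rewrite mulrC.
  by rewrite [_ * n%:R]mulrC.
exact: measurable_itv.
Qed.

Lemma measurable_rbox a b : measurable (rbox a b : set V).
Proof.
have -> : rbox a b = [set x | forall i, `[a i, b i]%classic (x ord0 i)].
  by apply/seteqP; split => x /= H i; have := H i; rewrite in_itv.
by apply: (@measurable_coords _ _ (fun i => `[a i, b i]%classic)) => i; exact: measurable_itv.
Qed.

Lemma bernoulli_le (t : R) m : 0 <= t <= 1 -> 1 - m%:R * t <= (1 - t) ^+ m.
Proof.
move=> /andP[t0 t1]; elim: m => [|m IH]; first by rewrite mul0r subr0 expr0.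
have h : 0 <= 1 - t by lra.
rewrite exprS; apply: le_trans (ler_wpM2l h IH).
have m0 : 0 <= m%:R :> R by [].
rewrite -natr1; nra.
Qed.

(** [lam] is known on closed boxes: the half-open cell lies in one of side [1/n] and contains those
    of side [(1 - t)/n]. Bernoulli's inequality bounds the relative loss by [d t]. *)
Lemma lebesgue_hbox (lam : {measure set V -> \bar R}) n (K : @grid d n) :
  is_lebesgue_measure lam -> (0 < n)%N -> lam (hbox K) = ((n%:R^-1) ^+ d)%:E.
Proof.
move=> leb n0; have nn0 : 0 < n%:R :> R by rewrite ltr0n.
have ni0 : 0 < n%:R^-1 :> R by rewrite invr_gt0.
pose a (i : 'I_d) : R := (K i)%:R / n%:R - 2.
pose b (t : R) (i : 'I_d) : R := ((K i)%:R + 1 - t) / n%:R - 2.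
have ab t i : b t i - a i = (1 - t) / n%:R by rewrite /a /b; ring.
have boxE t : t <= 1 -> lam (rbox a (b t)) = (((1 - t) / n%:R) ^+ d)%:E.
  move=> t1; rewrite leb => [|i].
    by congr EFin; under eq_bigr do rewrite ab; rewrite prodr_const card_ord.
  by rewrite -subr_ge0 ab divr_ge0// subr_ge0.
have mh := measurable_hbox K n0.
have cellP (t : R) (x : V) i : (a i <= x ord0 i <= b t i) =
    ((K i)%:R <= n%:R * (x ord0 i + 2) <= (K i)%:R + 1 - t).
  by rewrite /a /b lerBlDr lerBrDr ler_pdivrMr// ler_pdivlMr// [_ * n%:R]mulrC.
have upper : (lam (hbox K) <= ((n%:R^-1) ^+ d)%:E)%E.
  have := boxE 0 ler01; rewrite subr0 div1r => <-.
  apply: le_measure; rewrite ?inE//; first exact: measurable_rbox.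
  move=> x Kx i; rewrite cellP subr0; have /andP[-> /ltW] := Kx i; exact.
have lower (t : R) : 0 < t -> t <= 1 -> ((((1 - t) / n%:R) ^+ d)%:E <= lam (hbox K))%E.
  move=> t0 t1; rewrite -boxE//; apply: le_measure; rewrite ?inE//; first exact: measurable_rbox.
  move=> x Kx i; have := Kx i; rewrite cellP => /andP[-> h] /=; lra.
have fin : lam (hbox K) \is a fin_num.
  by rewrite ge0_fin_numE//; exact: le_lt_trans upper (ltry _).
apply/eqP; rewrite eq_le upper /= -(fineK fin) lee_fin.
have c0 : 0 <= (n%:R^-1 : R) ^+ d * d%:R by rewrite mulr_ge0// exprn_ge0// ltW.
apply: (le_of_forall_pos c0) => e e0.
pose t := Num.min e 1.
have t0 : 0 < t by rewrite lt_min e0 ltr01.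
have t1 : t <= 1 by rewrite ge_min lexx orbT.
have te : t <= e by rewrite ge_min lexx.
have := lower t t0 t1; rewrite -(fineK fin) lee_fin => h.
have hb : 1 - d%:R * t <= (1 - t) ^+ d by apply: bernoulli_le; rewrite ltW.
have p0 : 0 <= (n%:R^-1 : R) ^+ d by rewrite exprn_ge0// ltW.
apply: (@le_trans _ _ (((1 - t) / n%:R) ^+ d + n%:R^-1 ^+ d * d%:R * e)); last by rewrite lerD2r.
rewrite exprMn mulrC -lerBlDr.
have d0 : 0 <= d%:R :> R by [].
have := ler_wpM2r p0 hb; have : n%:R^-1 ^+ d * d%:R * t <= n%:R^-1 ^+ d * d%:R * e by rewrite ler_wpM2l.
lra.
Qed.

Lemma hbox_inj n (K K' : @grid d n) x : hbox K x -> hbox K' x -> K = K'.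
Proof.
move=> Kx K'x; apply/ffunP => i; apply/val_inj => /=.
have /andP[h1 h2] := Kx i; have /andP[h3 h4] := K'x i.
have k1 : (K i < (K' i).+1)%N by rewrite -(ltr_nat R) -natr1; exact: le_lt_trans h1 h4.
have k2 : (K' i < (K i).+1)%N by rewrite -(ltr_nat R) -natr1; exact: le_lt_trans h3 h2.
by lia.
Qed.

Lemma hbox_eval n (b : @grid d n -> R) (K : @grid d n) x : hbox K x ->
  \sum_(K' : @grid d n) b K' * \1_(hbox K') x = b K.
Proof.
move=> Kx; rewrite (bigD1 K)//= indicE mem_set// mulr1 big1 ?addr0// => K' KK'.
rewrite indicE memNset ?mulr0// => K'x.
by move/eqP: KK'; apply; exact: hbox_inj K'x Kx.
Qed.

Lemma hbox_half n (K : @grid d (2 * n)) x : hbox K x -> hbox (half_grid K) x.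
Proof.
move=> Kx i; rewrite ffunE /=; have /andP := Kx i.
rewrite (half_odd (K i)) natrM => -[h1 h2].
have o01 : 0 <= ((odd (K i))%:R : R) <= 1 by case: (odd (K i)); rewrite /= ?lexx ?ler01.
by have /andP[? ?] := o01; apply/andP; split; lra.
Qed.

Lemma hbox_double n (k : @grid d n) x : hbox k x -> exists2 K : @grid d (2 * n), hbox K x & half_grid K = k.
Proof.
move=> kx.
(* [e i] tells whether [x_i] lies in the upper half of its coarse interval. *)
pose e (i : 'I_d) : nat := ~~ (2 * (n%:R * (x ord0 i + 2)) < 2 * (k i)%:R + 1).
have elt i : (2 * k i + e i < 4 * (2 * n))%N.
  have h1 := ltn_ord (k i); have h2 : (e i <= 1)%N by exact: leq_b1.
  by lia.
exists [ffun i => Ordinal (elt i)].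
  move=> i; rewrite ffunE /= natrD !natrM; have /andP[h1 h2] := kx i.
  rewrite /e; case: ltP => h /=; apply/andP; split; lra.
apply/ffunP => i; rewrite ffunE; apply/val_inj; rewrite /= ffunE /=.
have : (e i <= 1)%N by exact: leq_b1.
by lia.
Qed.

Lemma hbox_refine n (b : @grid d n -> R) x :
  \sum_(k : @grid d n) b k * \1_(hbox k) x =
  \sum_(K : @grid d (2 * n)) b (half_grid K) * \1_(hbox K) x.
Proof.
have [[k kx]|H] := pselect (exists k : @grid d n, hbox k x).
  have [K Kx Kk] := hbox_double kx.
  by rewrite (hbox_eval b kx) (hbox_eval (fun K => b (half_grid K)) Kx) Kk.
rewrite !big1// => [K _|k _]; rewrite indicE memNset ?mulr0// => Kx; apply: H.
  by exists (half_grid K); exact: hbox_half.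
by exists k.
Qed.

Lemma hbox_pt n (K : @grid d n) x i : (0 < n)%N -> touch (R := R) K -> hbox K x ->
  `|x ord0 i - (pt K : V) ord0 i| <= 3 / n%:R.
Proof.
move=> n0 tK Kx; have nn0 : 0 < n%:R :> R by rewrite ltr0n.
have /andP[h1 h2] := Kx i; have /andP[h3 h4] := psi_neq0 (pt_neq0 tK) i.
rewrite ler_pdivlMr// -(gtr0_norm nn0) -normrM.
by rewrite ler_norml; apply/andP; split; lra.
Qed.

End grid_cells.

Section step_integrals.
Context d' (T : measurableType d') {R : realType} (m : {measure set T -> \bar R}).
Context (I : Type) (A : I -> set T).
Hypothesis mA : forall k, measurable (A k).
Hypothesis finA : forall k, (m (A k) < +oo)%E.

Lemma integrable_indicM (f : T -> R) M k : measurable_fun [set: T] f ->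
  (forall x, `|f x| <= M) -> m.-integrable [set: T] (EFin \o (fun x => \1_(A k) x * f x)).
Proof.
move=> mf fM; have := @bounded_integrable _ _ _ m _ (mA k) (finA k) f M (measurable_funTS mf) (fun x _ => fM x).
move/(integrable_mkcond _ (mA k)); apply: eq_integrable => // x _.
by rewrite /= patchE indicE; case: (x \in A k); rewrite /= ?mul1r ?mul0r.
Qed.

Lemma integrable_step (r : seq I) (b : I -> R) (f : T -> R) M : measurable_fun [set: T] f ->
  (forall x, `|f x| <= M) ->
  m.-integrable [set: T] (EFin \o (fun x => (\sum_(k <- r) b k * \1_(A k) x) * f x)).
Proof.
move=> mf fM.
have := @integrable_sum _ _ _ m _ measurableT I r xpredT (fun k x => ((b k)%:E * (\1_(A k) x * f x)%:E)%E).
have H k : m.-integrable [set: T] (fun x => ((b k)%:E * (\1_(A k) x * f x)%:E)%E).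
  by apply: integrableZl => //; exact: integrable_indicM fM.
move=> /(_ (fun k _ => H k)); apply: eq_integrable => // x _ /=.
rewrite mulr_suml -sumEFin; apply: eq_bigr => k _.
by rewrite -EFinM mulrA.
Qed.

Lemma integral_step (r : seq I) (b : I -> R) (f : T -> R) M : measurable_fun [set: T] f ->
  (forall x, `|f x| <= M) ->
  fine (\int[m]_x ((\sum_(k <- r) b k * \1_(A k) x) * f x)%:E)%E =
  \sum_(k <- r) b k * fine (\int[m]_(x in A k) (f x)%:E)%E.
Proof.
move=> mf fM; elim: r => [|k r IH].
  rewrite big_nil (eq_integral (cst 0%E)) ?integral0// => x _.
  by rewrite big_nil mul0r.
have i1 := integrable_indicM k mf fM; have i2 := integrable_step r b mf fM.
have i3 : m.-integrable [set: T] (EFin \o (fun x => b k * (\1_(A k) x * f x))).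
  by have := integrableZl measurableT (b k) i1; apply: eq_integrable => // x _ /=; rewrite EFinM.
have := RintegralD measurableT i3 i2; rewrite (RintegralZl (b k) measurableT i1) /Rintegral IH.
have -> : (\int[m]_x (\1_(A k) x * f x)%:E = \int[m]_(x in A k) (f x)%:E)%E.
  rewrite [RHS]integral_mkcond; apply: eq_integral => x _.
  by rewrite /= patchE indicE; case: (x \in A k); rewrite /= ?mul1r ?mul0r.
rewrite big_cons => <-; congr fine; apply: eq_integral => x _.
by rewrite /= big_cons mulrDl mulrA.
Qed.

Lemma norm_step_le (r : seq I) (b : I -> R) :
  (\int[m]_x `|\sum_(k <- r) b k * \1_(A k) x|%:E <= \sum_(k <- r) `|b k|%:E * m (A k))%E.
Proof.
have mi k : measurable_fun [set: T] (fun x => (`|b k| * \1_(A k) x)%:E).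
  by apply/measurable_EFinP; apply: measurable_funM => //; exact: measurable_indic.
apply: (@le_trans _ _ (\int[m]_x (\sum_(k <- r) (`|b k| * \1_(A k) x)%:E))%E).
  apply: ge0_le_integral => //.
  - apply/measurable_EFinP; apply: measurableT_comp => //; apply: measurable_sum => k.
    by apply: measurable_funM => //; exact: measurable_indic.
  - exact: emeasurable_sum.
  - move=> x _; rewrite sumEFin lee_fin; apply: (le_trans (ler_norm_sum _ _ _)).
    apply: ler_sum => k _; rewrite normrM indicE ler_wpM2l//.
    by case: (_ \in _); rewrite ?normr1 ?normr0.
rewrite ge0_integral_sum//.
apply: lee_sum => k _; under eq_integral do rewrite EFinM.
rewrite ge0_integralZl//; last by apply/measurable_EFinP; exact: measurable_indic.
by rewrite integral_indic// setIT.
Qed.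

End step_integrals.

(** * Surjectivity *)

Section dual_functionals.
Context {R : realType} {d : nat} (lam : {measure set 'rV[R]_d -> \bar R}).
Local Notation V := 'rV[R]_d.
Local Notation cube := (@unit_cube R d).
Local Notation pint := (pint lam).
Local Notation tv := (tv lam).
Local Notation isBV := (isBV lam).
Local Notation isCH := (isCH lam).
Variable j0 : 'I_d.
Variables (L : ((V -> R) -> R) -> R) (C : R).
Hypothesis L_lin : forall (a : R) om1 om2, isCH om1 -> isCH om2 ->
  L (fun u => a * om1 u + om2 u) = a * L om1 + L om2.
Hypothesis C0 : 0 <= C.
Hypothesis L_le : forall om, isCH om -> (`|L om|%:E <= C%:E * BVdual_norm lam om)%E.

Lemma functional_le om K : isCH om -> 0 <= K -> (forall u, isBV u -> `|om u| <= K * tv u) ->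
  `|L om| <= C * K.
Proof.
move=> com K0 h; rewrite -lee_fin EFinM; apply: (le_trans (L_le com)).
by apply: lee_wpmul2l; rewrite ?lee_fin//; exact: BVdual_norm_le.
Qed.

(** [L] sees maps defined on all of [V -> R], whereas only values on BV are controlled: a difference
    vanishing on BV is a charge of norm 0. The common field [w] allows [isCH_add_divg] to form that
    difference. *)
Lemma functional_ext om1 om2 w : C1c_field w ->
  (forall u, isBV u -> om1 u = pint u (divg w)) ->
  (forall u, isBV u -> om2 u = pint u (divg w)) -> L om1 = L om2.
Proof.
move=> cw.
have key om : (forall u, isBV u -> om u = pint u (divg w)) -> L om = L (fun u => pint u (divg w)).
  move=> h; have c1 : isCH om by exact: (isCH_divg cw).
  have c2 : isCH (fun u => pint u (divg w)) by exact: (isCH_divg cw).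
  have := L_lin (-1) c2 c1.
  have := @functional_le (fun u => -1 * pint u (divg w) + om u) 0 (isCH_add_divg (-1) cw c1) (lexx 0).
  rewrite mulr0 normr_le0 => /(_ _)/eqP ->; first by move=> e; lra.
  by move=> u Bu; rewrite h// mulN1r addNr normr0 mul0r.
by move=> /key -> /key ->.
Qed.

(** These are functions whose integral pairing is a charge by [isCH_divg]; agreement on the cube is
    enough, as BV functions vanish almost everywhere outside. *)
Definition divergence_like f := continuous f /\
  exists2 w, C1c_field w & forall x, cube x -> f x = divg w x.

Local Notation dl := divergence_like.

Definition density_value f : R := L (fun u => pint u f).

Local Notation l := density_value.

Lemma divergence_like_pint f w u : continuous f -> C1c_field w ->
  (forall x, cube x -> f x = divg w x) -> isBV u -> pint u f = pint u (divg w).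
Proof.
move=> cf cw fw Bu; apply: eq_pint fw; [exact: isBV_L1cube|exact: test_fun_continuous|exact: test_fun_divg].
Qed.

Lemma divergence_like_isCH f : dl f -> isCH (fun u => pint u f).
Proof.
by move=> [cf [w cw fw]]; apply: (isCH_divg cw) => u; exact: divergence_like_pint.
Qed.

Lemma divergence_like_linear a f g : dl f -> dl g -> dl (fun x => a * f x + g x).
Proof.
move=> [cf [w1 cw1 fw]] [cg [w2 cw2 gw]]; split.
  by move=> x; apply: cvgD (cg x); apply: cvgMr (cf x); exact: cvg_cst.
exists (fun x => a *: w1 x + w2 x); first exact: C1c_field_linear.
move=> x cx; rewrite fw// gw// /divg mulr_sumr -big_split; apply: eq_bigr => i _ /=.
rewrite (_ : (fun y => (a *: w1 y + w2 y) ord0 i) = fun y => a * w1 y ord0 i + w2 y ord0 i); last first.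
  by apply/funext => y; rewrite !mxE.
by rewrite (pderiv_linear i a (cw1 i) (cw2 i)).
Qed.

Lemma density_value_linear a f g : dl f -> dl g -> l (fun x => a * f x + g x) = a * l f + l g.
Proof.
move=> df dg; rewrite -(L_lin _ (divergence_like_isCH df) (divergence_like_isCH dg)).
have [cfg [w cw fgw]] := divergence_like_linear a df dg.
apply: (functional_ext cw) => u Bu; first exact: divergence_like_pint.
rewrite -(divergence_like_pint cfg cw fgw Bu) pint_linearr//; first exact: isBV_L1cube.
  by apply: test_fun_continuous; case: df.
by apply: test_fun_continuous; case: dg.
Qed.

Lemma divergence_like0 : dl (fun=> 0).
Proof.
split; first by case: (@C1c0 R d).
exists (single j0 (fun=> 0)); first exact: (C1c_single j0 (@C1c0 R d)).
move=> x _; rewrite (divg_single j0 (@C1c0 R d)) /pderiv.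
by rewrite (_ : (fun=> 0) = cst (0 : R))// derive_cst.
Qed.

Lemma density_value0 : l (fun=> 0) = 0.
Proof.
have := density_value_linear (-1) divergence_like0 divergence_like0.
by rewrite (_ : (fun x : V => _) = fun=> 0); [lra|apply/funext => x; rewrite mulr0 addr0].
Qed.

Lemma divergence_like_sum (I : Type) (r : seq I) (p : pred I) (c : I -> R) (F : I -> V -> R) :
  (forall k, dl (F k)) -> dl (fun x => \sum_(k <- r | p k) c k * F k x).
Proof.
move=> dF; elim: r => [|k r IH].
  by move: divergence_like0; congr divergence_like; apply/funext => x; rewrite big_nil.
case pk : (p k); last by move: IH; congr divergence_like; apply/funext => x; rewrite big_cons pk.
have := divergence_like_linear (c k) (dF k) IH; congr divergence_like.
by apply/funext => x; rewrite big_cons pk.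
Qed.

Lemma density_value_sum (I : Type) (r : seq I) (p : pred I) (c : I -> R) (F : I -> V -> R) :
  (forall k, dl (F k)) ->
  l (fun x => \sum_(k <- r | p k) c k * F k x) = \sum_(k <- r | p k) c k * l (F k).
Proof.
move=> dF; elim: r => [|k r IH].
  by rewrite big_nil -[RHS]density_value0; congr l; apply/funext => x; rewrite big_nil.
rewrite big_cons; case pk : (p k).
  rewrite -IH -density_value_linear//; last exact: divergence_like_sum.
  by congr l; apply/funext => x; rewrite big_cons pk.
by rewrite -IH; congr l; apply/funext => x; rewrite big_cons pk.
Qed.

Lemma density_value_le f M : dl f -> (forall x, cube x -> `|f x| <= M) -> `|l f| <= C * (4 * M).
Proof.
move=> df fM; have M0 : 0 <= M by apply: le_trans (fM 0 cube0).
apply: functional_le; [exact: divergence_like_isCH|by rewrite mulr_ge0|].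
by move=> u Bu; apply: (poincare j0) => //; case: df.
Qed.

Lemma divergence_like_psi n (K : @grid d n) : (0 < n)%N -> dl (psi K).
Proof.
move=> n0; split; first by case: (psi_C1c (R := R) K).
exists (single j0 (prim j0 K)); first by apply: C1c_single; exact: prim_C1c.
by move=> x cx; rewrite divg_single ?pderiv_prim//; exact: prim_C1c.
Qed.

Lemma divergence_like_divg w : C1c_field w -> dl (divg w).
Proof.
move=> cw; split; last by exists w.
rewrite /divg; apply: continuous_big => [|i _]; first exact: add_continuous.
by have [_ [_ [h _]]] := cw i; exact: h.
Qed.

Lemma divergence_like_approx n f : (0 < n)%N -> dl (approx n f).
Proof.
move=> n0; exact: (@divergence_like_sum _ (index_enum (@grid d n)) (@touch R d n)
  (fun K => f (pt K)) (fun K => psi K) (fun K => divergence_like_psi K n0)).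
Qed.

Lemma density_value_approx n f : (0 < n)%N ->
  l (approx n f) = \sum_(K : @grid d n | touch (R := R) K) f (pt K) * l (psi K).
Proof.
move=> n0; exact: (@density_value_sum _ (index_enum (@grid d n)) (@touch R d n)
  (fun K => f (pt K)) (fun K => psi K) (fun K => divergence_like_psi K n0)).
Qed.

Lemma density_value_touchN n (K : @grid d n) : (0 < n)%N -> ~~ touch (R := R) K -> l (psi K) = 0.
Proof.
move=> n0 tK; apply/eqP; rewrite -normr_le0.
have := @density_value_le (psi K) 0 (divergence_like_psi K n0).
by rewrite !mulr0; apply => x cx; rewrite touchN// normr0.
Qed.

(** With the signs as coefficients, the spline sum is bounded by 1; the factor 4 is that of
    [poincare]. *)
Lemma density_mass_le n : (0 < n)%N -> \sum_(K : @grid d n | touch (R := R) K) `|l (psi K)| <= C * 4.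
Proof.
move=> n0; pose s (K : @grid d n) := Num.sg (l (psi K)).
have h1 := @divergence_like_sum _ (index_enum (@grid d n)) (@touch R d n)
  s (fun K => psi K) (fun K => divergence_like_psi K n0).
have h2 := @density_value_sum _ (index_enum (@grid d n)) (@touch R d n)
  s (fun K => psi K) (fun K => divergence_like_psi K n0).
have -> : \sum_(K : @grid d n | touch (R := R) K) `|l (psi K)| =
    \sum_(K : @grid d n | touch (R := R) K) s K * l (psi K).
  by apply: eq_bigr => K _; rewrite normrEsg.
rewrite -h2; apply: le_trans (ler_norm _) _; rewrite -[4]mulr1.
apply: density_value_le h1 _ => x cx; apply: weighted_bound => // K _ _.
by rewrite normr_sg; case: (_ != 0); rewrite ?ler01.
Qed.

(** The signed sum of the differences is the divergence of a field with coordinates at most [4 / n].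
    Applying [poincare] to that sum would give no decay in [n]. *)
Lemma density_refine_le n : (0 < n)%N ->
  \sum_(K : @grid d (2 * n)) `|l (psi K) - 2^-1 ^+ d * l (psi (half_grid K))| <=
  C * (d%:R * (4 / n%:R)).
Proof.
move=> n0; have n20 : (0 < 2 * n)%N by rewrite muln_gt0.
pose g (K : @grid d (2 * n)) (x : V) := - 2^-1 ^+ d * psi (half_grid K) x + psi K x.
have dg K : dl (g K) by apply: divergence_like_linear; exact: divergence_like_psi.
have lg K : l (g K) = l (psi K) - 2^-1 ^+ d * l (psi (half_grid K)).
  by rewrite density_value_linear; [rewrite mulNr addrC|exact: divergence_like_psi..].
pose s (K : @grid d (2 * n)) := Num.sg (l (g K)).
have h1 := @divergence_like_sum _ (index_enum (@grid d (2 * n))) xpredT s g dg.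
have h2 := @density_value_sum _ (index_enum (@grid d (2 * n))) xpredT s g dg.
have -> : \sum_(K : @grid d (2 * n)) `|l (psi K) - 2^-1 ^+ d * l (psi (half_grid K))| =
    \sum_(K : @grid d (2 * n)) s K * l (g K).
  by apply: eq_bigr => K _; rewrite -lg normrEsg.
rewrite -h2; apply: le_trans (ler_norm _) _.
have f0 : 0 <= 4 / n%:R :> R by rewrite divr_ge0.
apply: functional_le; [exact: divergence_like_isCH|by rewrite mulr_ge0|].
pose w (x : V) : V := \row_j \sum_(K : @grid d (2 * n)) s K * corr_field K j x.
have wE j : (fun x => w x ord0 j) = fun x => \sum_(K : @grid d (2 * n)) s K * corr_field K j x.
  by apply/funext => x; rewrite mxE.
have cw : C1c_field w.
  move=> j; rewrite wE.
  apply: (@C1c_sum _ _ _ (index_enum (@grid d (2 * n))) xpredT s (fun K => corr_field K j)) => K.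
  exact: corr_field_C1c.
have wg : (fun x => \sum_(K : @grid d (2 * n)) s K * g K x) = divg w.
  apply/funext => x; rewrite /divg.
  under [RHS]eq_bigr do rewrite wE.
  rewrite [RHS](eq_bigr (fun j => \sum_(K : @grid d (2 * n)) s K * pderiv j (corr_field K j) x)); last first.
    move=> j _.
    by rewrite (@pderiv_sum _ _ _ _ (index_enum (@grid d (2 * n))) xpredT s (fun K => corr_field K j))// => K; exact: corr_field_C1c.
  rewrite exchange_big; apply: eq_bigr => K _.
  by rewrite -mulr_sumr -refine_divg// /g mulNr addrC.
move=> u Bu; rewrite wg; apply: pint_divg_le => // x j.
rewrite mxE; apply: le_trans (ler_norm_sum _ _ _) _; apply: le_trans (corr_field_sum_le j x n0).
apply: ler_sum => K _; rewrite normrM normr_sg.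
by case: (_ != 0); rewrite ?mul1r ?mul0r.
Qed.

End dual_functionals.

Section bounded_pairing.
Context d' (T : measurableType d') {R : realType} (m : {measure set T -> \bar R}).

Lemma integrable_mul_bounded (v f : T -> R) (M : R) : m.-integrable [set: T] (EFin \o v) ->
  measurable_fun [set: T] f -> (forall x, `|f x| <= M) ->
  m.-integrable [set: T] (EFin \o (fun x => v x * f x)).
Proof.
move=> iv mf fM; have mv : measurable_fun [set: T] v by apply/measurable_EFinP; exact: measurable_int iv.
apply: (@le_integrable _ _ _ _ _ measurableT _ (fun x => (M%:E * (v x)%:E)%E)).
- by apply/measurable_EFinP; exact: measurable_funM.
- move=> x _ /=; rewrite lee_fin !normrM mulrC ler_wpM2r//.
  by apply: le_trans (fM x) _; exact: ler_norm.
- exact: integrableZl.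
Qed.

Lemma pairing_close (v u f : T -> R) (M : R) :
  m.-integrable [set: T] (EFin \o v) -> m.-integrable [set: T] (EFin \o u) ->
  measurable_fun [set: T] f -> (forall x, `|f x| <= M) ->
  `|fine (\int[m]_x (v x * f x)%:E)%E - fine (\int[m]_x (u x * f x)%:E)%E| <=
  M * fine (\int[m]_x `|v x - u x|%:E)%E.
Proof.
move=> iv iu mf fM.
have ivu : m.-integrable [set: T] (EFin \o (fun x => v x - u x)).
  have := integrableB measurableT iv iu; exact: eq_integrable.
have i1 := integrable_mul_bounded iv mf fM; have i2 := integrable_mul_bounded iu mf fM.
have i3 := integrable_mul_bounded ivu mf fM.
have i4 : m.-integrable [set: T] (EFin \o (fun x => `|v x - u x|)) by exact: (integrable_norm ivu).
have := RintegralB measurableT i1 i2; rewrite /Rintegral => <-.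
have -> : (\int[m]_x (v x * f x - u x * f x)%:E = \int[m]_x ((v x - u x) * f x)%:E)%E.
  by apply: eq_integral => x _; rewrite mulrBl.
apply: le_trans (le_normr_Rintegral measurableT i3) _.
have := RintegralZl M measurableT i4; rewrite /Rintegral => <-.
apply: (@le_Rintegral _ _ _ m) => //.
- exact: (integrable_norm i3).
- have := integrableZl measurableT M i4; exact: eq_integrable.
- by move=> x _; rewrite normrM mulrC ler_wpM2r.
Qed.

End bounded_pairing.

(** * Step densities of a functional *)

Section density.
Context {R : realType} {d : nat} (lam : {measure set 'rV[R]_d -> \bar R}).
Local Notation V := 'rV[R]_d.
Local Notation cube := (@unit_cube R d).
Local Notation pint := (pint lam).
Local Notation tv := (tv lam).
Local Notation isBV := (isBV lam).
Local Notation isCH := (isCH lam).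
Variable j0 : 'I_d.
Hypothesis leb : is_lebesgue_measure lam.
Variables (L : ((V -> R) -> R) -> R) (C : R).
Hypothesis L_lin : forall (a : R) om1 om2, isCH om1 -> isCH om2 ->
  L (fun u => a * om1 u + om2 u) = a * L om1 + L om2.
Hypothesis C0 : 0 <= C.
Hypothesis L_le : forall om, isCH om -> (`|L om|%:E <= C%:E * BVdual_norm lam om)%E.
Local Notation l := (density_value lam L).
Local Notation dl := (@divergence_like R d).

(** [n^d] is the inverse volume of a cell, so the cell of [K] carries the mass [l (psi K)]. *)
Definition step_density n (x : V) : R :=
  \sum_(K : @grid d n) (n%:R ^+ d * l (psi K)) * \1_(hbox K) x.

Let fin_hbox n (K : @grid d n) : (0 < n)%N -> (lam (hbox K) < +oo)%E.
Proof. by move=> n0; rewrite lebesgue_hbox// ltry. Qed.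

Lemma measurable_step_density n : (0 < n)%N -> measurable_fun [set: V] (step_density n).
Proof.
move=> n0; apply: measurable_sum => K; apply: measurable_funM => //.
by apply: measurable_indic; exact: measurable_hbox.
Qed.

Lemma integrable_step_density n : (0 < n)%N -> lam.-integrable [set: V] (EFin \o step_density n).
Proof.
move=> n0; have := @integrable_step _ _ _ lam (@grid d n) (@hbox R d n)
  (fun K => measurable_hbox K n0) (fun K => fin_hbox K n0) (index_enum (@grid d n))
  (fun K => n%:R ^+ d * l (psi K)) (fun=> 1) 1.
move=> /(_ (measurable_cst _) _); rewrite normr1 => /(_ (fun=> lexx _)).
by apply: eq_integrable => // x _ /=; rewrite mulr1.
Qed.

(** On the fine cells, of volume [(2 n)^-d], the difference has as coefficients [(2 n)^d] times the
    quantities summed in [density_refine_le]. *)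
Lemma step_density_close n : (0 < n)%N ->
  (\int[lam]_x `|step_density (2 * n) x - step_density n x|%:E <= (C * (d%:R * (4 / n%:R)))%:E)%E.
Proof.
move=> n0; have n20 : (0 < 2 * n)%N by rewrite muln_gt0.
pose b (K : @grid d (2 * n)) := (2 * n)%:R ^+ d * (l (psi K) - 2^-1 ^+ d * l (psi (half_grid K))).
have vE x : step_density (2 * n) x - step_density n x =
    \sum_(K : @grid d (2 * n)) b K * \1_(hbox K) x.
  rewrite /step_density (hbox_refine (fun k => n%:R ^+ d * l (psi k))) -sumrB.
  apply: eq_bigr => K _; rewrite -mulrBl; congr (_ * _); rewrite /b mulrBr; congr (_ - _).
  by rewrite mulrA -exprMn natrM mulrAC divff// mul1r.
under eq_integral do rewrite vE.
apply: le_trans (@norm_step_le _ _ _ lam (@grid d (2 * n)) (@hbox R d (2 * n))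
  (fun K => measurable_hbox K n20) (index_enum (@grid d (2 * n))) b) _.
apply: (@le_trans _ _ (\sum_(K : @grid d (2 * n)) `|l (psi K) - 2^-1 ^+ d * l (psi (half_grid K))|%:E)%E).
  apply: lee_sum => K _; rewrite lebesgue_hbox// -EFinM lee_fin /b normrM.
  have nn0 : 0 < (2 * n)%:R :> R by rewrite ltr0n.
  rewrite ger0_norm ?exprn_ge0// mulrAC -exprMn divff ?gt_eqF// expr1n mul1r//.
by rewrite sumEFin lee_fin; apply: (density_refine_le j0).
Qed.

(** Splines missing the cube have value 0 under [l], and the cells of the others stay within [3 / n]
    of the cube in each coordinate. *)
Lemma step_density_out n (x : V) : (0 < n)%N ->
  (exists i, forall y : V, cube y -> 3 / n%:R < `|x ord0 i - y ord0 i|) -> step_density n x = 0.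
Proof.
move=> n0 [i far]; rewrite /step_density big1// => K _.
have [tK|tK] := boolP (touch (R := R) K); last first.
  by rewrite (density_value_touchN j0 C0 L_le n0 tK) mulr0 mul0r.
rewrite indicE memNset ?mulr0// => Kx.
by have := hbox_pt i n0 tK Kx; rewrite leNgt (far _ (pt_cube K)).
Qed.

(** On the cell of [K], [f] is within [eta] of [f (pt K)], and [f (pt K) * l (psi K)] is a term of
    [l (approx n f)]; [density_mass_le] sums the errors. *)
Lemma step_density_pairing n (f : V -> R) (M eta : R) : (0 < n)%N -> continuous f -> (forall x, `|f x| <= M) ->
  (forall x y : V, cube y -> (forall i, `|x ord0 i - y ord0 i| <= 3 / n%:R) -> `|f x - f y| <= eta) ->
  0 <= eta ->
  `|fine (\int[lam]_x (step_density n x * f x)%:E)%E - l (approx n f)| <= C * 4 * eta.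
Proof.
move=> n0 cf fM fe eta0; have mf := continuous_measurable_rV cf.
have nn0 : 0 < n%:R :> R by rewrite ltr0n.
rewrite (@integral_step _ _ _ lam (@grid d n) (@hbox R d n)
  (fun K => measurable_hbox K n0) (fun K => fin_hbox K n0) (index_enum (@grid d n))
  (fun K => n%:R ^+ d * l (psi K)) f M mf fM).
rewrite (density_value_approx j0 L_lin C0 L_le f n0) (bigID (@touch R d n))/= [X in (_ + X) - _]big1 ?addr0; last first.
  by move=> K tK; rewrite (density_value_touchN j0 C0 L_le n0 tK) mulr0 mul0r.
rewrite -sumrB; apply: le_trans (ler_norm_sum _ _ _) _.
apply: (@le_trans _ _ (\sum_(K : @grid d n | touch (R := R) K) `|l (psi K)| * eta)); last first.
  by rewrite -mulr_suml ler_wpM2r//; exact: (density_mass_le j0).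
apply: ler_sum => K tK.
have lamK : fine (lam (hbox K)) = n%:R^-1 ^+ d by rewrite lebesgue_hbox.
have close := @integral_close _ _ _ lam _ (measurable_hbox K n0) (fin_hbox K n0) f
  (fun=> f (pt K)) M eta (measurable_funTS mf) (measurable_cst _) (fun x _ => fM x) (fun x _ => fM _).
have {}close := close (fun x Kx => fe x _ (pt_cube K) (fun i => hbox_pt i n0 tK Kx)).
rewrite lamK in close.
have ic : fine (\int[lam]_(x in hbox K) (f (pt K))%:E)%E = f (pt K) * n%:R^-1 ^+ d.
  by rewrite integral_cst ?lebesgue_hbox//; exact: measurable_hbox.
rewrite ic in close.
have -> : n%:R ^+ d * l (psi K) * fine (\int[lam]_(x in hbox K) (f x)%:E)%E - f (pt K) * l (psi K) =
   l (psi K) * (n%:R ^+ d * (fine (\int[lam]_(x in hbox K) (f x)%:E)%E - f (pt K) * n%:R^-1 ^+ d)).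
  rewrite mulrBr [n%:R ^+ d * (f _ * _)]mulrCA -exprMn divff ?gt_eqF// expr1n mulr1; ring.
rewrite normrM ler_wpM2l// normrM ger0_norm ?exprn_ge0//.
apply: le_trans (ler_wpM2l _ close) _; first by rewrite exprn_ge0.
by rewrite mulrCA -exprMn divff ?gt_eqF// expr1n mulr1.
Qed.

End density.

(** * The BV function representing a functional *)

Section surjectivity.
Context {R : realType} {d : nat} (lam : {measure set 'rV[R]_d -> \bar R}).
Local Notation V := 'rV[R]_d.
Local Notation cube := (@unit_cube R d).
Local Notation pint := (pint lam).
Local Notation tv := (tv lam).
Local Notation isBV := (isBV lam).
Local Notation isCH := (isCH lam).
Variable j0 : 'I_d.
Hypothesis leb : is_lebesgue_measure lam.
Variables (L : ((V -> R) -> R) -> R) (C : R).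
Hypothesis L_lin : forall (a : R) om1 om2, isCH om1 -> isCH om2 ->
  L (fun u => a * om1 u + om2 u) = a * L om1 + L om2.
Hypothesis C0 : 0 <= C.
Hypothesis L_le : forall om, isCH om -> (`|L om|%:E <= C%:E * BVdual_norm lam om)%E.
Local Notation l := (density_value lam L).
Local Notation dl := (@divergence_like R d).

(* [2 ^ m], in a form for which [scale m.+1] reduces to [2 * scale m], as the grid types require. *)
Let scale m := iter m (muln 2) 1%N.

Let scale_gt m : (m < scale m)%N.
Proof. by elim: m => // m IH; rewrite /scale iterS -/(scale m); lia. Qed.

Let scale_gt0 m : (0 < scale m)%N. Proof. exact: leq_ltn_trans (scale_gt m). Qed.

Let scaleE m : (scale m)%:R = 2 ^+ m :> R.
Proof. by elim: m => // m IH; rewrite /scale iterS natrM -/(scale m) IH exprS. Qed.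

Let three_over_scale e : 0 < e -> exists N, forall m, (N <= m)%N -> 3 / (scale m)%:R <= e :> R.
Proof.
move=> e0; have := archi_boundP (ltW (divr_gt0 (ltr0Sn R 2) e0)).
set N := Num.bound _ => h; exists N => m Nm.
rewrite ler_pdivrMr ?ltr0n// mulrC -ler_pdivrMr//; apply: ltW (lt_le_trans h _).
by rewrite ler_nat; apply: leq_trans Nm _; apply: ltnW.
Qed.

Lemma density_exists : exists u, [/\ measurable_fun [set: V] u,
  lam.-integrable [set: V] (EFin \o u), {ae lam, forall x, ~ cube x -> u x = 0} &
  forall f, C1c f -> dl f -> pint u f = l f].
Proof.
pose v m := step_density lam L (scale m).
have mv m : measurable_fun [set: V] (v m) by exact: measurable_step_density.
have iv m : lam.-integrable [set: V] (EFin \o v m) by exact: integrable_step_density.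
have dv m : (\int[lam]_x `|v m.+1 x - v m x|%:E <= (C * (d%:R * 4) / 2 ^+ m)%:E)%E.
  by have := step_density_close j0 leb L_lin C0 L_le (scale_gt0 m); rewrite scaleE !mulrA.
have [u [mu iu vu v1]] := L1_limit mv iv dv.
exists u; split => //.
  apply: filterS vu => x vx ncx.
  (* Off the closed cube some coordinate of [x] is at distance at least [e] from the cube; once
     [3 / scale m <= e / 2], [step_density_out] makes [v m x] vanish. *)
  have [i [e e0 far]] : exists i, exists2 e, 0 < e & forall y : V, cube y -> e <= `|x ord0 i - y ord0 i|.
    have [i /negP xi] : exists i, ~ (0 <= x ord0 i <= 1).
      by apply: contrapT => h; apply: ncx => i; apply: contrapT => hi; apply: h; exists i.
    exists i; move: xi; rewrite negb_and -!ltNge => /orP[xi|xi].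
      exists (- x ord0 i); first by rewrite oppr_gt0.
      move=> y cy; have /andP[y0 y1] := cy i; rewrite ler0_norm; lra.
    exists (x ord0 i - 1); first by rewrite subr_gt0.
    move=> y cy; have /andP[y0 y1] := cy i; rewrite ger0_norm; lra.
  have [N hN] := three_over_scale (divr_gt0 e0 (ltr0Sn R 1)).
  have v0 : v m x @[m --> \oo] --> (0 : R).
    apply: cvg_near_cst; exists N => // m /= Nm; apply: (step_density_out j0 C0 L_le (scale_gt0 m)).
    exists i => y cy; apply: le_lt_trans (hN m Nm) _; apply: lt_le_trans (far y cy).
    by rewrite ltr_pdivrMr//; lra.
  by apply: cvg_unique vx v0.
move=> f cf df.
have [M fM] := C1c_bounded cf; have cof : continuous f by case: cf.
have mf := continuous_measurable_rV cof.
have M0 : 0 <= M by apply: le_trans (fM 0).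
(* Three errors: [M e] from the L^1 convergence, [4 C e] from [step_density_pairing], and [4 C e]
   from replacing [f] by its quasi-interpolant under [l]. *)
have K0 : 0 <= M + C * 4 + C * 4 by rewrite !addr_ge0 ?mulr_ge0.
apply/eqP; rewrite -subr_eq0 -normr_le0; apply: (le_of_forall_pos K0) => e e0; rewrite add0r.
have [N1 h1] : exists N, forall m, (N <= m)%N -> fine (\int[lam]_x `|v m x - u x|%:E)%E <= e.
  have ivu m : (\int[lam]_x `|v m x - u x|%:E)%E \is a fin_num.
    have ii : lam.-integrable [set: V] (EFin \o (fun x => v m x - u x)).
      by have := integrableB measurableT (iv m) iu; exact: eq_integrable.
    by have := integrable_fin_num measurableT (integrable_norm ii).
  have : fine (\int[lam]_x `|v m x - u x|%:E)%E @[m --> \oo] --> (0 : R) by exact: fine_cvg.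
  move=> /cvgr0Pnorm_le /(_ e e0) [N _ hN]; exists N => m Nm.
  by apply: le_trans (ler_norm _) _; exact: hN.
have [del del0 fdel] := continuous_modulus cof e0.
have [N2 h2] := three_over_scale del0.
have [N3 h3] := cube_approx (continuous_cube_cvg cof) e0.
pose m := maxn N1 (maxn N2 N3).
have m1 : (N1 <= m)%N by rewrite leq_maxl.
have m2 : (N2 <= m)%N by rewrite /m; lia.
have m3 : (N3 <= m)%N by rewrite /m; lia.
have c1 := pairing_close (iv m) iu mf fM.
have c2 : `|fine (\int[lam]_x (v m x * f x)%:E)%E - l (approx (scale m) f)| <= C * 4 * e.
  apply: (step_density_pairing j0 leb L_lin C0 L_le (scale_gt0 m) cof fM) => [x y cy xy|]; last exact: ltW.
  by apply: fdel => // i; exact: le_trans (xy i) (h2 m m2).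
have c3 : `|l (approx (scale m) f) - l f| <= C * (4 * e).
  have da : dl (approx (scale m) f) by exact: (divergence_like_approx j0).
  have := density_value_linear L_lin C0 L_le (-1) df da; rewrite mulN1r [- _ + _]addrC => <-.
  apply: (density_value_le j0 C0 L_le); first exact: divergence_like_linear.
  move=> x cx; rewrite mulN1r addrC distrC.
  (* [cube_approx] speaks of [n.+1]; the bound [N3 <= (scale m).-1] comes from [m < scale m]. *)
  have -> : scale m = (scale m).-1.+1 by rewrite prednK.
  by apply: h3 => //; rewrite -ltnS prednK//; exact: leq_ltn_trans m3 (scale_gt m).
have c4 := ler_wpM2l M0 (h1 m m1).
have c5 := le_trans c1 c4.
rewrite !mulrDl -[C * 4 * e]mulrA.
have -> : pint u f - l f = - (fine (\int[lam]_x (v m x * f x)%:E)%E - pint u f) +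
   (fine (\int[lam]_x (v m x * f x)%:E)%E - l (approx (scale m) f)) +
   (l (approx (scale m) f) - l f) by ring.
apply: le_trans (ler_normD _ _) _; apply: lerD; last exact: c3.
apply: le_trans (ler_normD _ _) _; apply: lerD; first by rewrite normrN.
by rewrite mulrA.
Qed.

Lemma functional_represented : exists2 u, isBV u & forall om, isCH om -> L om = Upsilon u om.
Proof.
have [u [mu iu u0 ul]] := density_exists.
have Lu : L1cube lam u by split.
(* [divg w] is merely continuous, while [density_exists] tests against C^1_c functions; the
   quasi-interpolants of [divg w] are C^1_c and, on the cube, divergences. *)
have ulw w : C1c_field w -> pint u (divg w) = l (divg w).
  move=> cw; have dw := divergence_like_divg cw; have cow : continuous (divg w) by case: dw.
  apply/eqP; rewrite -subr_eq0 -normr_le0.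
  have K0 : 0 <= 1 + C * 4 by rewrite addr_ge0 ?mulr_ge0.
  apply: (le_of_forall_pos K0) => e e0; rewrite add0r.
  have [N1 h1] := pint_approx Lu cow e0.
  have [N2 h2] := cube_approx (continuous_cube_cvg cow) e0.
  pose n := maxn N1 N2.
  have n1 : (N1 <= n)%N by rewrite leq_maxl.
  have n2 : (N2 <= n)%N by rewrite leq_maxr.
  have da : dl (approx n.+1 (divg w)) by exact: (divergence_like_approx j0).
  have c1 := h1 n n1; rewrite (ul _ (approx_C1c _ _) da) in c1.
  have c2 : `|l (approx n.+1 (divg w)) - l (divg w)| <= C * (4 * e).
    have := density_value_linear L_lin C0 L_le (-1) dw da; rewrite mulN1r [- _ + _]addrC => <-.
    apply: (density_value_le j0 C0 L_le); first exact: divergence_like_linear.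
    by move=> x cx; rewrite mulN1r addrC distrC; exact: h2.
  rewrite mulrDl mul1r -mulrA.
  have -> : pint u (divg w) - l (divg w) = (pint u (divg w) - l (approx n.+1 (divg w))) +
    (l (approx n.+1 (divg w)) - l (divg w)) by ring.
  by apply: le_trans (ler_normD _ _) _; exact: lerD.
(* An admissible field gives a charge of dual norm at most 1, so the bound of [L] also bounds the
   variation and [u] is in BV. *)
have Tu : (TV_norm lam u <= C%:E)%E.
  apply: TV_norm_le => // w cw w1; rewrite ulw//; apply: le_trans (ler_norm _) _.
  rewrite -[leRHS]mulr1; apply: (functional_le C0 L_le) => //; first exact: (isCH_divg cw).
  by move=> u' Bu'; rewrite mul1r; exact: pint_divg_norm_le.
have Bu : isBV u by split => //; exact: le_lt_trans Tu (ltry _).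
exists u => [//|om com]; apply/eqP; rewrite -subr_eq0 -normr_le0.
have K0 : 0 <= C + tv u by rewrite addr_ge0// tv_ge0.
apply: (le_of_forall_pos K0) => e e0; rewrite add0r /Upsilon.
have [w cw omw] := isCH_approx com e0.
have c1 : `|L om - l (divg w)| <= C * e.
  have cd : isCH (fun u => pint u (divg w)) by exact: (isCH_divg cw).
  have := L_lin (-1) cd com; rewrite mulN1r [- _ + _]addrC => <-.
  apply: (functional_le C0 L_le); [exact: isCH_add_divg|exact: ltW|].
  by move=> u' Bu'; rewrite mulN1r addrC; exact: omw.
have -> : L om - om u = (L om - l (divg w)) - (om u - pint u (divg w)) by rewrite ulw//; ring.
rewrite mulrDl; apply: le_trans (ler_normB _ _) _; apply: lerD => //.
by rewrite mulrC; exact: omw.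
Qed.

End surjectivity.

Theorem theorem3p2 (R : realType) (d : nat)
    (lam : {measure set 'rV[R]_d -> \bar R}) :
  (0 < d)%N -> is_lebesgue_measure lam ->
  [/\ (* Upsilon u is an element of CH^* *)
      (forall u, isBV lam u -> isCHdual lam (Upsilon u)),
      (* Upsilon is linear *)
      (forall (a : R) u1 u2 om, isBV lam u1 -> isBV lam u2 -> isCH lam om ->
         Upsilon (fun x => a * u1 x + u2 x) om = a * Upsilon u1 om + Upsilon u2 om),
      (* Upsilon is isometric *)
      (forall u, isBV lam u -> CHdual_norm lam (Upsilon u) = TV_norm lam u),
      (* Upsilon is injective (on L^1 classes) *)
      (forall u1 u2, isBV lam u1 -> isBV lam u2 ->
         (forall om, isCH lam om -> Upsilon u1 om = Upsilon u2 om) ->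
         {ae lam, forall x, u1 x = u2 x}) &
      (* Upsilon is surjective onto CH^* *)
      (forall L, isCHdual lam L ->
         exists2 u, isBV lam u & forall om, isCH lam om -> L om = Upsilon u om)].
Proof.
(* Positive dimension supplies the direction [j0] in which primitives are taken. *)
move=> d0 leb; pose j0 : 'I_d := Ordinal d0; split.
- exact: Upsilon_isCHdual.
- by move=> a u1 u2 om B1 B2 com; rewrite /Upsilon; exact: isCH_linear com B1 B2.
- exact: Upsilon_isometry.
- exact: (Upsilon_injective j0).
- by move=> L [L_lin [C [C0 L_le]]]; exact: (functional_represented j0 leb L_lin C0 L_le).
Qed.
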